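(* Let $\mathbb{H}^1$ be the first Heisenberg group with its Carnot–Carathéodory distance $d_{cc}$ and Haar measure $\mu$, let $Q=4$ and $q^*=Q/(Q-1)=4/3$. Then there is an $\alpha>0$ depending only on $Q$ such that there is a continuous embedding $$W^{1,1}_H(\mathbb{H}^1)\hookrightarrow L^{q^*+,\alpha}(\mathbb{H}^1),$$ where $W^{1,1}_H(\mathbb{H}^1)$ is the horizontal Sobolev space with norm $\|u\|_{L^1}+\|\nabla_H u\|_{L^1}$ and $$\|u\|_{L^{q^*+,\alpha}}=\sup_{1\le q<q^*}(q^*-q)^\alpha\,\|u\|_{L^q(\mathbb{H}^1)} .$$ Moreover, this embedding is equivalent to the statement $I_{\mathbb{H}^1}(s)\asymp s^{3/4}$ for the isoperimetric profile of $(\mathbb{H}^1,d_{cc},\mu)$.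
   Context: $\mathbb{H}^1$ is $\mathbb{R}^3$ with group law $(x,y,t)\cdot(x',y',t')=(x+x',y+y',t+t'+xy'-yx')$; $\mu$ is Lebesgue measure on $\mathbb{R}^3$. The left-invariant horizontal vector fields are $X=\partial_x-y\,\partial_t$ and $Y=\partial_y+x\,\partial_t$; the horizontal gradient is $\nabla_H u=(Xu,Yu)$ with $|\nabla_H u|=(|Xu|^2+|Yu|^2)^{1/2}$; $d_{cc}$ is the Carnot–Carathéodory distance associated with $X,Y$. $Q=4$ is the homogeneous dimension: $\mu(B_{cc}(x,r))\asymp r^Q$. $W^{1,1}_H(\mathbb{H}^1)$ is the space of $u\in L^1(\mathbb{H}^1)$ with (weak) horizontal gradient in $L^1$. For measurable $E\subset\mathbb{H}^1$, with $E_\varepsilon=\{x:d_{cc}(x,E)<\varepsilon\}$, the perimeter (outer Minkowski content) is $\mu^+(E)=\liminf_{\varepsilon\downarrow0}\frac{\mu(E_\varepsilon)-\mu(E)}{\varepsilon}$, and the isoperimetric profile is $I_{\mathbb{H}^1}(s)=\inf\{\mu^+(E):E\text{ measurable},\ \mu(E)=s\}$. The relation $I_{\mathbb{H}^1}(s)\asymp s^{3/4}$ means two-sided comparability up to positive constants for $s\in(0,1)$. *)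

(* Defs.v *)
From HB Require Import structures.
From mathcomp Require Import all_boot all_order all_algebra.
From mathcomp Require Import all_classical all_reals all_analysis.
From mathcomp Require Import ring.

Set Implicit Arguments.
Unset Strict Implicit.
Unset Printing Implicit Defensive.

Import Order.TTheory GRing.Theory Num.Theory.
Import numFieldNormedType.Exports.

Local Open Scope classical_set_scope.
Local Open Scope ring_scope.

(* The first Heisenberg group is R^3, with points written ((x, y), t). *)
Definition xc (R : realType) (p : R * R * R) : R := p.1.1.
Definition yc (R : realType) (p : R * R * R) : R := p.1.2.
Definition tc (R : realType) (p : R * R * R) : R := p.2.

Definition heis_mul (R : realType) (p q : R * R * R) : R * R * R :=
  (xc p + xc q, yc p + yc q, tc p + tc q + (xc p * yc q - yc p * xc q)).

Definition vfX (R : realType) (p : R * R * R) : R * R * R := (1, 0, - yc p).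
Definition vfY (R : realType) (p : R * R * R) : R * R * R := (0, 1, xc p).

(* vfX and vfY are the left-invariant vector fields of heis_mul: they generate
   the right translations by (s, 0, 0) and (0, s, 0). *)
Lemma heis_mul_vfX (R : realType) (p : R * R * R) (s : R) :
  heis_mul p (s, 0, 0) = p + s *: vfX p.
Proof.
case: p => [[x y] t]; rewrite /heis_mul /vfX /xc /yc /tc /=.
by congr (_, _, _); rewrite /= /GRing.scale /=; ring.
Qed.

Lemma heis_mul_vfY (R : realType) (p : R * R * R) (s : R) :
  heis_mul p (0, s, 0) = p + s *: vfY p.
Proof.
case: p => [[x y] t]; rewrite /heis_mul /vfY /xc /yc /tc /=.
by congr (_, _, _); rewrite /= /GRing.scale /=; ring.
Qed.

(* Lebesgue measure on the Borel sets of R^3. The library attaches the measure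
   to the copy measurableTypeR R of R, which is convertible to R. *)
Definition leb3 (R : realType) :
    set (measurableTypeR R * measurableTypeR R * measurableTypeR R) -> \bar R :=
  (@lebesgue_measure R \x @lebesgue_measure R \x @lebesgue_measure R)%E.

HB.instance Definition _ (R : realType) := Measure.on (@leb3 R).

(* The completed Lebesgue measure: leb3_ext is the outer measure induced by
   leb3, and the Lebesgue-measurable sets are its Caratheodory-measurable
   sets. *)
Definition leb3_ext (R : realType) : set (R * R * R) -> \bar R :=
  (@leb3 R)^*%mu.

Definition lebesgue_measurable (R : realType) (E : set (R * R * R)) : Prop :=
  (@leb3 R)^*%mu.-cara.-measurable E.

(* gam is an absolutely continuous curve on [0, T] whose velocity is
   a X(gam) + b Y(gam) almost everywhere, with a, b in L^1; this is written in
   integral form, coordinate by coordinate. *)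
Definition horizontal_curve (R : realType) (T : R) (gam : R -> R * R * R)
    (a b : R -> R) : Prop :=
  let leb := @lebesgue_measure R in
  let solves (c : R * R * R -> R) := forall s : R, s \in `[0, T] ->
    c (gam s) = c (gam 0) +
      \int[leb]_(r in `[0, s]) (a r * c (vfX (gam r)) + b r * c (vfY (gam r)))
  in
  [/\ 0 <= T,
      leb.-integrable `[0, T] (EFin \o a),
      leb.-integrable `[0, T] (EFin \o b) &
      [/\ solves (@xc R), solves (@yc R) & solves (@tc R)]].

Definition cc_length (R : realType) (T : R) (a b : R -> R) : \bar R :=
  (\int[@lebesgue_measure R]_(s in `[0%R, T])
     (Num.sqrt (a s ^+ 2 + b s ^+ 2))%:E)%E.

Definition d_cc (R : realType) (p q : R * R * R) : \bar R :=
  ereal_inf [set l | exists (T : R) (gam : R -> R * R * R) (a b : R -> R),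
    [/\ horizontal_curve T gam a b, gam 0 = p, gam T = q
      & l = cc_length T a b]].

Definition d_cc_set (R : realType) (p : R * R * R) (E : set (R * R * R)) :
    \bar R :=
  ereal_inf [set d_cc p q | q in E].

Definition enlargement (R : realType) (eps : R) (E : set (R * R * R)) :
    set (R * R * R) :=
  [set p | (d_cc_set p E < eps%:E)%E].

Definition minkowski_content (R : realType) (E : set (R * R * R)) : \bar R :=
  limf_einf (fun eps : R =>
    ((leb3_ext (enlargement eps E) - leb3_ext E) * (eps^-1)%:E)%E) 0^'+.

Definition isoperimetric_profile (R : realType) (s : R) : \bar R :=
  ereal_inf [set minkowski_content E | E in
    [set E : set (R * R * R) | lebesgue_measurable E /\ leb3_ext E = s%:E]].

Definition profile_comparable (R : realType) : Prop :=
  exists c C : R, [/\ 0 < c, 0 < C & forall s : R, 0 < s < 1 ->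
    ((c * s `^ (3 / 4))%:E <= isoperimetric_profile s /\
     isoperimetric_profile s <= (C * s `^ (3 / 4))%:E)%E].

(* Functions of class C^n: all iterated directional derivatives up to order n
   exist everywhere and are continuous. *)
Fixpoint Cn (R : realType) (n : nat) (f : R * R * R -> R) : Prop :=
  continuous f /\
  if n is m.+1 then
    forall v : R * R * R, (forall p, derivable f p v) /\ Cn m (fun p => 'D_v f p)
  else True.

Definition test_function (R : realType) (f : R * R * R -> R) : Prop :=
  (forall n, Cn n f) /\ compact (closure [set p | f p != 0]).

Definition lie_derivative (R : realType) (V : R * R * R -> R * R * R)
    (f : R * R * R -> R) (p : R * R * R) : R := 'D_(V p) f p.

(* The coefficients of X and of Y are divergence free, so the formal adjoint of
   each is its opposite. *)
Definition is_weak_lie_derivative (R : realType)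
    (V : R * R * R -> R * R * R) (u g : R * R * R -> R) : Prop :=
  forall f : R * R * R -> R, test_function f ->
    \int[@leb3 R]_p (u p * lie_derivative V f p) =
    - \int[@leb3 R]_p (g p * f p).

(* Borel functions; they represent every class of L^1. *)
Definition in_L1 (R : realType) (u : R * R * R -> R) : Prop :=
  (@leb3 R).-integrable setT (EFin \o u).

Definition is_weak_hgrad (R : realType) (u : R * R * R -> R)
    (g : (R * R * R -> R) * (R * R * R -> R)) : Prop :=
  [/\ in_L1 g.1, in_L1 g.2, is_weak_lie_derivative (@vfX R) u g.1
    & is_weak_lie_derivative (@vfY R) u g.2].

Definition W11 (R : realType) (u : R * R * R -> R) : Prop :=
  in_L1 u /\ exists g, is_weak_hgrad u g.

(* The weak gradient is unique almost everywhere when it exists; get selects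
   a representative. *)
Definition hgrad (R : realType) (u : R * R * R -> R) :
    (R * R * R -> R) * (R * R * R -> R) :=
  get [set g | is_weak_hgrad u g].

Definition hgrad_norm (R : realType) (u : R * R * R -> R) (p : R * R * R) : R :=
  Num.sqrt ((hgrad u).1 p ^+ 2 + (hgrad u).2 p ^+ 2).

Definition W11_norm (R : realType) (u : R * R * R -> R) : \bar R :=
  (Lnorm (@leb3 R) 1 (EFin \o u) + Lnorm (@leb3 R) 1 (EFin \o hgrad_norm u))%E.

Definition Qdim (R : realType) : R := 4.
Definition qstar (R : realType) : R := Qdim R / (Qdim R - 1).

Definition grand_norm (R : realType) (alpha : R) (u : R * R * R -> R) : \bar R :=
  ereal_sup [set (((qstar R - q) `^ alpha)%:E *
                  Lnorm (@leb3 R) q%:E (EFin \o u))%E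
            | q in [set q : R | 1 <= q < qstar R]].

Definition grand_Lebesgue (R : realType) (alpha : R) (u : R * R * R -> R) :
    Prop :=
  @measurable_fun _ _
    (measurableTypeR R * measurableTypeR R * measurableTypeR R)%type
    (measurableTypeR R) setT u /\
  (grand_norm alpha u < +oo)%E.

Definition continuous_embedding (R : realType) (alpha : R) : Prop :=
  (forall u : R * R * R -> R, W11 u -> grand_Lebesgue alpha u) /\
  exists2 C : R, 0 < C & forall u : R * R * R -> R, W11 u ->
    (grand_norm alpha u <= C%:E * W11_norm u)%E.

(* Main.v *)
(* Both the embedding (with alpha = 1) and the estimate I(s) ~ s^(3/4) hold, so
   they are equivalent.

   The map piX is constant on the integral lines of X, piY on those of Y.
   The common engine is a Loomis-Whitney inequality: if piX(W) is contained in A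
   and piY(W) in B, where |A|, |B| <= b^3, then |W| <= 5 b^4.

   Embedding.  A weak derivative in L^1 along X bounds |u(p)| by the integral of
   |Xu| over the X-line through p, for almost every p, and likewise for Y.  Hence
   {|u| >= l} projects into two sets of measure <= N / l, and Loomis-Whitney gives
   the weak-type estimate |{|u| >= l}| <= 5 (N / l)^(4/3).  Summing over the levels
   N e^k bounds the q-th power of the L^q norm by a constant times N^q / (4/3 - q).

   Lower bound for the profile.  Moving a set by distances up to r along X
   lengthens each X-line section that is not null by at least r, so that
   the enlargement gains at least r times the measure of the X-shadow; the same
   holds for Y, and by Loomis-Whitney one of the two shadows is large.

   Upper bound for the profile.  Take the box |x|, |y| <= m, |t| <= m^2. *)
From HB Require Import structures.
Require Import Defs.
From mathcomp Require Import all_boot all_order all_algebra.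
From mathcomp Require Import all_classical all_reals all_analysis.
From mathcomp Require Import measurable_realfun ring lra.

Set Implicit Arguments.
Unset Strict Implicit.
Unset Printing Implicit Defensive.

Import Order.TTheory GRing.Theory Num.Theory.
Import numFieldNormedType.Exports.

Local Open Scope classical_set_scope.
Local Open Scope ring_scope.

(** * Measure-preserving changes of variables *)

(** Since X and Y do not commute, no coordinates straighten both families of lines, and the usual
    proof of Loomis-Whitney in product coordinates does not apply. After a shear, a point of W
    becomes an incidence between a point of A and a plane line indexed by B. Lines through one point
    spread apart away from it, so a point lies on few lines that meet A in a long set; balancing the
    count by lines against the count by points gives the exponent 4/3.

    Of a weak derivative only integrals against test functions are known. In coordinates where X is
    d/dx, the x-factor of a product test function is made to tend to a primitive of an indicator;
    uniqueness of measures on boxes turns the limit identity into one that holds almost everywhere.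

    The exponent alpha = 1 compensates the factor 1 / (4/3 - q) left by a geometric series of ratio
    e^(q - 4/3).

    The profile involves Lebesgue-measurable sets and outer measures of enlargements, while the
    arguments on fibres are about Borel sets; Borel approximations from inside and outside bridge
    the two. *)

Notation leb R := (@lebesgue_measure R).
Notation line R := (measurableTypeR R).
Notation plane R := (measurableTypeR R * measurableTypeR R)%type.
Notation space R :=
  (measurableTypeR R * measurableTypeR R * measurableTypeR R)%type.

Definition leb2 (R : realType) : set (plane R) -> \bar R :=
  (leb R \x leb R)%E.
HB.instance Definition _ (R : realType) := Measure.on (@leb2 R).

(** Gives [leb2] and [leb3] the structure under which Tonelli's theorem applies to them. *)
Lemma product_measure_sigma_finite d1 d2 (T1 : measurableType d1)
    (T2 : measurableType d2) (R : realType)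
    (m1 : {sigma_finite_measure set T1 -> \bar R})
    (m2 : {sigma_finite_measure set T2 -> \bar R}) :
  sigma_finite setT (m1 \x m2)%E.
Proof.
have /sigma_finiteP[F [UF ndF Foo]] := sigma_finiteT m1.
have /sigma_finiteP[G [UG ndG Goo]] := sigma_finiteT m2.
exists (fun n => F n `*` G n) => [|k].
  apply/esym; rewrite -subTset => -[x y] _.
  have [n _ Fnx] : (\bigcup_i F i) x by rewrite -UF.
  have [k _ Gky] : (\bigcup_i G i) y by rewrite -UG.
  exists (maxn n k) => //; split => /=.
    by move: x Fnx; apply/subsetPset/ndF/leq_maxl.
  by move: y Gky; apply/subsetPset/ndG/leq_maxr.
have [mF Fk] := Foo k; have [mG Gk] := Goo k; split; first exact: measurableX.
by rewrite product_measure1E// lte_mul_pinfty// ge0_fin_numE.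
Qed.

HB.instance Definition _ (R : realType) :=
  Measure_isSigmaFinite.Build _ _ _ (@leb2 R)
   (product_measure_sigma_finite (leb R) (leb R)).
HB.instance Definition _ (R : realType) :=
  Measure_isSigmaFinite.Build _ _ _ (@leb3 R)
   (product_measure_sigma_finite (@leb2 R) (leb R)).

Definition measure_preserving d (T : measurableType d) (R : realType)
    (mu : set T -> \bar R) (f : T -> T) :=
  measurable_fun setT f /\
  forall A, measurable A -> mu (f @^-1` A) = mu A.

Section measure_preserving.
Local Open Scope ereal_scope.
Context d (T : measurableType d) (R : realType).
Variables (mu : {measure set T -> \bar R}) (f : T -> T).
Hypothesis mpf : measure_preserving mu f.
Let mf : measurable_fun setT f := mpf.1.

Lemma mp_ge0_integral (g : T -> \bar R) : measurable_fun setT g ->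
  (forall x, 0 <= g x) -> \int[mu]_x g (f x) = \int[mu]_x g x.
Proof.
move=> mg g0.
have := @ge0_integral_pushforward _ _ T T R f mf mu setT g measurableT mg (fun x _ => g0 x).
rewrite preimage_setT => <-.
by apply: eq_measure_integral => // A mA _; exact: mpf.2.
Qed.
End measure_preserving.

Section transfer_integrable.
Local Open Scope ereal_scope.
Context d (T : measurableType d) (R : realType).
Variables (mu : {measure set T -> \bar R}) (f : T -> T).
Hypothesis mpf : measure_preserving mu f.

Lemma mp_integrable (g : T -> \bar R) :
  mu.-integrable setT g -> mu.-integrable setT (g \o f).
Proof.
move=> /integrableP[mg goo]; apply/integrableP; split.
  by apply: measurableT_comp => //; exact: mpf.1.
rewrite (mp_ge0_integral mpf (g := fun x => `|g x|))//.
by apply: measurableT_comp.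
Qed.

(** The positive and negative parts transfer separately, so the equality holds for every measurable
    g, with the convention of the integral when both parts are infinite. *)
Lemma mp_integral (g : T -> \bar R) : measurable_fun setT g ->
  \int[mu]_x g (f x) = \int[mu]_x g x.
Proof.
move=> mg; rewrite [LHS]integralE [RHS]integralE; congr (_ - _).
  have := mp_ge0_integral mpf (measurable_funepos mg) (funepos_ge0 g).
  by move=> <-; apply: eq_integral => x _; rewrite !funeposE.
have := mp_ge0_integral mpf (measurable_funeneg mg) (funeneg_ge0 g).
by move=> <-; apply: eq_integral => x _; rewrite !funenegE.
Qed.

Lemma mp_ae (P : T -> Prop) : {ae mu, forall x, P x} ->
  {ae mu, forall x, P (f x)}.
Proof.
move=> [N [mN N0 PN]]; exists (f @^-1` N); split => //.
- by rewrite -[_ @^-1` _]setTI; exact: mpf.1.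
- by rewrite mpf.2.
- by move=> x /= nP; exact: PN.
Qed.

End transfer_integrable.

Section leb_affine.
Local Open Scope ereal_scope.
Variable R : realType.

Lemma measurable_affine (a b : R) :
  measurable_fun setT (fun x : line R => a * x + b : line R)%R.
Proof. by apply: measurable_funD => //; exact: measurable_funM. Qed.

(** By uniqueness of Lebesgue measure: its image under x -> a x + b, multiplied by |a|, gives each
    interval ]c, d] its length. *)
Lemma ge0_integral_affine (a b : R) (f : line R -> \bar R) :
  a != 0%R -> measurable_fun setT f -> (forall x, 0 <= f x) ->
  `|a|%:E * \int[leb R]_x f (a * x + b)%R = \int[leb R]_x f x.
Proof.
move=> a0 mf f0.
pose phi := fun x : line R => (a * x + b : line R)%R.
have mphi : measurable_fun setT phi := measurable_affine a b.
pose nu := mscale (NngNum (normr_ge0 a)) (pushforward (leb R) phi).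
have nuE : forall A, measurable A -> leb R A = nu mphi A.
  apply: lebesgue_measure_unique => _ [[c d] /= cd <-].
  rewrite lebesgue_measure_itv/= /nu /mscale/= /pushforward/=.
  have [{}a0|{}a0|] := ltgtP 0%R a; last by move=> a0'; rewrite -a0' eqxx in a0.
  - rewrite (_ : phi @^-1` _ = `]((c - b) / a)%R, ((d - b) / a)%R]%classic); last first.
      apply/seteqP; split => x /=; rewrite !in_itv/= ltr_pdivrMr// ler_pdivlMr//;
        rewrite /phi => /andP[? ?]; apply/andP; split; lra.
    rewrite lebesgue_measure_itv/= !lte_fin ltr_pM2r ?invr_gt0// ltrD2r.
    case: ifP => // _; last by rewrite mule0.
    by rewrite -!EFinD -EFinM gtr0_norm//; congr EFin; field; rewrite gt_eqF.
  (* A negative slope reverses the interval, so the preimage of ]c, d] is closed on the left and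
     open on the right. *)
  - rewrite (_ : phi @^-1` _ = `[((d - b) / a)%R, ((c - b) / a)%R[%classic); last first.
      apply/seteqP; split => x /=; rewrite !in_itv/= ltr_ndivlMr// ler_ndivrMr//;
        rewrite /phi => /andP[? ?]; apply/andP; split; lra.
    rewrite lebesgue_measure_itv/= !lte_fin ltr_nM2r ?invr_lt0// ltrD2r.
    case: ifP => // _; last by rewrite mule0.
    by rewrite -!EFinD -EFinM ltr0_norm//; congr EFin; field; rewrite lt_eqF.
rewrite [RHS](eq_measure_integral (nu mphi)); last by move=> A mA _; exact: nuE.
rewrite ge0_integral_mscale// ge0_integral_pushforward//.
Qed.

End leb_affine.

Section leb2.
Local Open Scope ereal_scope.
Variable R : realType.

Lemma measurable_xc : measurable_fun setT (@xc R : space R -> line R).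
Proof. exact: measurableT_comp measurable_fst measurable_fst. Qed.
Lemma measurable_yc : measurable_fun setT (@yc R : space R -> line R).
Proof. exact: measurableT_comp measurable_snd measurable_fst. Qed.
Lemma measurable_tc : measurable_fun setT (@tc R : space R -> line R).
Proof. exact: measurable_snd. Qed.

Lemma ge0_integral_leb2 (f : plane R -> \bar R) :
  measurable_fun setT f -> (forall z, 0 <= f z) ->
  \int[@leb2 R]_z f z = \int[leb R]_x \int[leb R]_y f (x, y).
Proof. by move=> mf f0; rewrite [LHS](fubini_tonelli1 f mf f0). Qed.

Lemma ge0_integral_leb2C (f : plane R -> \bar R) :
  measurable_fun setT f -> (forall z, 0 <= f z) ->
  \int[@leb2 R]_z f z = \int[leb R]_y \int[leb R]_x f (x, y).
Proof. by move=> mf f0; rewrite [LHS](fubini_tonelli2 f mf f0). Qed.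

Lemma ge0_integral_leb3 (f : space R -> \bar R) :
  measurable_fun setT f -> (forall z, 0 <= f z) ->
  \int[@leb3 R]_p f p = \int[@leb2 R]_z \int[leb R]_t f (z, t).
Proof. move=> mf f0. exact: (@fubini_tonelli1 _ _ _ _ R (@leb2 R) (leb R) f mf f0). Qed.

Lemma measurable_shear (c : plane R -> line R) : measurable_fun setT c ->
  measurable_fun setT (fun p : space R => (p.1, p.2 + c p.1)%R : space R).
Proof.
move=> mc; apply/measurable_fun_pairP; split; first exact: measurable_fst.
apply: measurable_funD; first exact: measurable_snd.
by apply: measurableT_comp => //; exact: measurable_fst.
Qed.

Lemma ge0_integral_translate (c : R) (f : line R -> \bar R) :
  measurable_fun setT f -> (forall x, 0 <= f x) ->
  \int[leb R]_x f (x + c)%R = \int[leb R]_x f x.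
Proof.
move=> mf f0; rewrite -[RHS](@ge0_integral_affine R 1 c f (oner_neq0 _) mf f0).
by rewrite normr1 mul1e; apply: eq_integral => x _; rewrite mul1r.
Qed.

Lemma ge0_integral_opp (f : line R -> \bar R) :
  measurable_fun setT f -> (forall x, 0 <= f x) ->
  \int[leb R]_x f (- x)%R = \int[leb R]_x f x.
Proof.
move=> mf f0; rewrite -[RHS](@ge0_integral_affine R (-1) 0 f _ mf f0) ?oppr_eq0 ?oner_neq0//.
by rewrite normrN1 mul1e; apply: eq_integral => x _; rewrite addr0 mulN1r.
Qed.

Lemma mp_of_integral d (T : measurableType d) (mu : {measure set T -> \bar R})
    (f : T -> T) : measurable_fun setT f ->
  (forall A, measurable A -> \int[mu]_x (\1_A (f x))%:E = \int[mu]_x (\1_A x)%:E) ->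
  measure_preserving mu f.
Proof.
move=> mf h; split=> // A mA.
have mfA : measurable (f @^-1` A) by rewrite -[_ @^-1` _]setTI; exact: mf.
by rewrite -[in RHS](setIT A) -integral_indic// -h// -[in LHS](setIT (f @^-1` A)) -integral_indic.
Qed.

(** On each vertical line the shear is a translation, and Tonelli reduces the claim to translation
    invariance on the line. *)
Lemma mp_shear (c : plane R -> line R) : measurable_fun setT c ->
  measure_preserving (@leb3 R) (fun p : space R => (p.1, p.2 + c p.1)%R : space R).
Proof.
move=> mc; apply: mp_of_integral; first exact: measurable_shear.
move=> A mA.
have m1 : measurable_fun setT (fun p : space R => (\1_A p)%:E : \bar R).
  by apply/measurable_EFinP; exact: measurable_indic.
have p0 (p : space R) : 0 <= (\1_A p)%:E :> \bar R by rewrite lee_fin.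
have m1s := measurableT_comp m1 (measurable_shear mc).
rewrite [LHS](ge0_integral_leb3 m1s (fun p => p0 _)) [RHS](ge0_integral_leb3 m1 p0).
apply: eq_integral => z _ /=.
apply: (@ge0_integral_translate (c z) (fun t => (\1_A (z, t))%:E)).
  exact: measurableT_comp m1 (pair1_measurable z).
by move=> t; rewrite lee_fin.
Qed.

Lemma mp_comp d (T : measurableType d) (mu : {measure set T -> \bar R})
    (f g : T -> T) :
  measure_preserving mu f -> measure_preserving mu g ->
  measure_preserving mu (g \o f).
Proof.
move=> [mf pf] [mg pg]; split; first exact: measurableT_comp.
move=> A mA; rewrite comp_preimage pf ?pg//.
by rewrite -[_ @^-1` _]setTI; exact: mg.
Qed.

Let measurable_oneE (A : set (space R)) : measurable A ->
  measurable_fun setT (fun p : space R => (\1_A p)%:E : \bar R).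
Proof. by move=> mA; apply/measurable_EFinP; exact: measurable_indic. Qed.

Let oneE_ge0 (A : set (space R)) p : 0 <= (\1_A p)%:E :> \bar R.
Proof. by rewrite lee_fin. Qed.

Lemma mp_swap12 :
  measure_preserving (@leb3 R) (fun p : space R => (yc p, xc p, tc p) : space R).
Proof.
have ms : measurable_fun setT (fun p : space R => (yc p, xc p, tc p) : space R).
  apply/measurable_fun_pairP; split; last exact: measurable_tc.
  by apply/measurable_fun_pairP; split; [exact: measurable_yc|exact: measurable_xc].
apply: mp_of_integral => // A mA.
have m1 := measurable_oneE mA; have p0 := @oneE_ge0 A.
have m1s := measurableT_comp m1 ms.
rewrite [LHS](ge0_integral_leb3 m1s (fun p => p0 _)) [RHS](ge0_integral_leb3 m1 p0).
have mg := measurable_fun_fubini_tonelli_F (m2 := leb R) _ m1 p0.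
have g0 z : 0 <= \int[leb R]_t (\1_A (z, t))%:E :> \bar R by exact: integral_ge0.
have mgs := measurable_fun_fubini_tonelli_F (m2 := leb R) _ m1s (fun p => p0 _).
have gs0 (z : plane R) : 0 <= \int[leb R]_t (\1_A (z.2, z.1, t))%:E :> \bar R by exact: integral_ge0.
by rewrite [RHS](ge0_integral_leb2 mg g0) [LHS](ge0_integral_leb2C mgs gs0).
Qed.

Lemma mp_swap23 :
  measure_preserving (@leb3 R) (fun p : space R => (xc p, tc p, yc p) : space R).
Proof.
have ms : measurable_fun setT (fun p : space R => (xc p, tc p, yc p) : space R).
  apply/measurable_fun_pairP; split; last exact: measurable_yc.
  by apply/measurable_fun_pairP; split; [exact: measurable_xc|exact: measurable_tc].
apply: mp_of_integral => // A mA.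
have m1 := measurable_oneE mA; have p0 := @oneE_ge0 A.
have m1s := measurableT_comp m1 ms.
rewrite [LHS](ge0_integral_leb3 m1s (fun p => p0 _)) [RHS](ge0_integral_leb3 m1 p0).
have mg := measurable_fun_fubini_tonelli_F (m2 := leb R) _ m1 p0.
have mgs := measurable_fun_fubini_tonelli_F (m2 := leb R) _ m1s (fun p => p0 _).
have g0 z : 0 <= \int[leb R]_t (\1_A (z, t))%:E :> \bar R by exact: integral_ge0.
have gs0 (z : plane R) : 0 <= \int[leb R]_t (\1_A (z.1, t, z.2))%:E :> \bar R by exact: integral_ge0.
rewrite [RHS](ge0_integral_leb2 mg g0) [LHS](ge0_integral_leb2 mgs gs0).
apply: eq_integral => x _.
apply: (fubini_tonelli (fun z : plane R => (\1_A (x, z.2, z.1))%:E)) => //.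
apply: (measurableT_comp m1).
apply: measurable_fun_pair; last exact: measurable_fst.
by apply: measurable_fun_pair; [exact: measurable_cst|exact: measurable_snd].
Qed.

Lemma mp_opp3 :
  measure_preserving (@leb3 R) (fun p : space R => (p.1, - p.2)%R : space R).
Proof.
have ms : measurable_fun setT (fun p : space R => (p.1, - p.2)%R : space R).
  apply/measurable_fun_pairP; split; first exact: measurable_fst.
  by apply: measurable_funN; exact: measurable_snd.
apply: mp_of_integral => // A mA.
have m1 := measurable_oneE mA; have p0 := @oneE_ge0 A.
have m1s := measurableT_comp m1 ms.
rewrite [LHS](ge0_integral_leb3 m1s (fun p => p0 _)) [RHS](ge0_integral_leb3 m1 p0).
apply: eq_integral => z _ /=.
apply: (@ge0_integral_opp (fun t => (\1_A (z, t))%:E)) => //.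
exact: measurableT_comp m1 (pair1_measurable z).
Qed.

Lemma mp_shear_mul (k : R) : measure_preserving (@leb3 R)
  (fun p : space R => (p.1, p.2 + k * (p.1.1 * p.1.2))%R : space R).
Proof.
apply: (@mp_shear (fun z => k * (z.1 * z.2))%R).
apply: measurable_funM => //; apply: measurable_funM.
  exact: measurable_fst.
exact: measurable_snd.
Qed.

(* A group automorphism exchanging X and Y, by which the statements about Y
   follow from those about X. *)
Definition flip (p : space R) : space R := (yc p, xc p, - tc p)%R.

Lemma flipK : involutive flip.
Proof. by move=> [[x y] t]; rewrite /flip /xc /yc /tc/= opprK. Qed.

Lemma mp_flip : measure_preserving (@leb3 R) flip.
Proof. exact: mp_comp mp_swap12 mp_opp3. Qed.

End leb2.

(** * Loomis-Whitney inequality *)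

Section loomis_whitney.
Local Open Scope ereal_scope.
Variable R : realType.

Definition piX (p : space R) : plane R := (yc p, tc p + xc p * yc p)%R.
Definition piY (p : space R) : plane R := (xc p, tc p - xc p * yc p)%R.

Lemma measurable_piX : measurable_fun setT piX.
Proof.
apply: measurable_fun_pair; first exact: measurable_yc.
apply: measurable_funD; first exact: measurable_tc.
by apply: measurable_funM; [exact: measurable_xc|exact: measurable_yc].
Qed.

Lemma measurable_piY : measurable_fun setT piY.
Proof.
apply: measurable_fun_pair; first exact: measurable_xc.
apply: measurable_funB; first exact: measurable_tc.
by apply: measurable_funM; [exact: measurable_xc|exact: measurable_yc].
Qed.

Definition ind d (T : measurableType d) (A : set T) (x : T) : \bar R := (\1_A x)%:E.

Lemma ind_ge0 d (T : measurableType d) (A : set T) x : 0 <= ind A x.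
Proof. by rewrite lee_fin. Qed.

Lemma measurable_ind d (T : measurableType d) (A : set T) : measurable A ->
  measurable_fun setT (ind A).
Proof. by move=> mA; apply/measurable_EFinP; exact: measurable_indic. Qed.

Lemma integral_ind d (T : measurableType d) (mu : {measure set T -> \bar R})
   (A : set T) : measurable A -> \int[mu]_x ind A x = mu A.
Proof. by move=> mA; rewrite integral_indic// setIT. Qed.

(** The ball of radius a/4 about y0 has measure a/2, so S keeps measure at least a/2 outside it,
    where 2 |y - y0| >= a/2. *)
Let dist_bound (S : set (line R)) (y0 a : R) : measurable S -> (0 < a)%R ->
  a%:E <= leb R S ->
  (a ^+ 2 / 4)%:E <= \int[leb R]_y (`|2 * (y - y0)|%:E * ind S y).
Proof.
move=> mS a0 aS.
pose B : set (line R) := ball (y0 : R) (a / 4)%R.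
have mB : measurable (B : set (line R)) by exact: measurable_ball.
have mabs : measurable_fun setT (fun y : line R => `|2 * (y - y0)|%:E).
  apply/measurable_EFinP; apply: measurableT_comp => //.
  by apply: measurable_funM => //; exact: measurable_funB.
(* The ball is added on the right rather than removed from S, since the measure of S may be
   infinite. *)
have h y : ((a / 2)%:E * ind S y) <=
    (`|2 * (y - y0)|%:E * ind S y) + (a / 2)%:E * ind B y.
  rewrite /ind -!EFinM -EFinD lee_fin !indicE.
  have [yB|yB] := boolP (y \in B).
    by case: (_ \in S); rewrite /= ?mulr1 ?mulr0 ?add0r ?lerDr//; lra.
  case: (_ \in S); rewrite /= ?mulr1 ?mulr0 ?addr0//.
  move: yB; rewrite notin_setE /B /ball/= => /negP; rewrite -leNgt distrC => yB.
  by rewrite normrM ger0_norm//; lra.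
have : (a / 2)%:E * leb R S <=
    \int[leb R]_y (`|2 * (y - y0)|%:E * ind S y) + (a / 2)%:E * leb R B.
  rewrite -(integral_ind (leb R) mS) -(integral_ind (leb R) mB).
  rewrite -!ge0_integralZl//; first last.
  - by rewrite lee_fin; lra.
  - by move=> y _; exact: ind_ge0.
  - exact: measurable_ind.
  - by rewrite lee_fin; lra.
  - by move=> y _; exact: ind_ge0.
  - exact: measurable_ind.
  have h0 y : 0 <= (a / 2)%:E * ind B y.
    by apply: mule_ge0; [rewrite lee_fin; lra|exact: ind_ge0].
  have h0' y : 0 <= (`|2 * (y - y0)|%:E * ind S y).
    by apply: mule_ge0; [rewrite lee_fin|exact: ind_ge0].
  have mh : measurable_fun setT (fun y : line R => (a / 2)%:E * ind B y).
    by apply: emeasurable_funM => //; exact: measurable_ind.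
  have mh' : measurable_fun setT (fun y : line R => `|2 * (y - y0)|%:E * ind S y).
    by apply: emeasurable_funM => //; exact: measurable_ind.
  rewrite -ge0_integralD//.
  apply: ge0_le_integral => //.
  - by move=> y _; apply: mule_ge0; [rewrite lee_fin; lra|exact: ind_ge0].
  - by apply: emeasurable_funM => //; exact: measurable_ind.
  - exact: emeasurable_funD.
have -> : leb R B = (a / 2)%:E.
  by rewrite /B lebesgue_measure_ball; [congr EFin; lra|lra].
move=> H.
have : (a / 2)%:E * a%:E <= \int[leb R]_y (`|2 * (y - y0)|%:E * ind S y) + (a / 2)%:E * (a / 2)%:E.
  apply: le_trans H; apply: lee_pmul => //; rewrite lee_fin; lra.
rewrite -leeBlDr// -!EFinM -EFinB; apply: le_trans.
by rewrite lee_fin; lra.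
Qed.

(* The measure of the trace on A of the line z = z.2 + 2 z.1 y; after the shear
   t -> t + xy, such lines are the fibres of piY seen through piX. *)
Definition line_section (A : set (plane R)) (z : plane R) : \bar R :=
  \int[leb R]_y ind A (y, z.2 + 2 * z.1 * y)%R.

Let mline (A : set (plane R)) : measurable A ->
  measurable_fun setT (fun p : space R => ind A (p.2, p.1.2 + 2 * p.1.1 * p.2)%R).
Proof.
move=> mA; apply: (measurableT_comp (measurable_ind mA)).
apply: measurable_fun_pair; first exact: measurable_tc.
apply: measurable_funD; first exact: measurable_yc.
apply: measurable_funM; last exact: measurable_tc.
by apply: measurable_funM; [exact: measurable_cst|exact: measurable_xc].
Qed.

Lemma measurable_line_section (A : set (plane R)) : measurable A ->
  measurable_fun setT (line_section A).
Proof.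
move=> mA.
exact: (measurable_fun_fubini_tonelli_F (m2 := leb R) _ (mline mA) (fun=> ind_ge0 _ _)).
Qed.

(* The points of A seen from (y0, z0) along the lines z = z0 + 2 x (y - y0)
   are swept with Jacobian 2 |y - y0|. *)
Lemma bush (A : set (plane R)) (y0 z0 a : R) : measurable A -> (0 < a)%R ->
  (a ^+ 2 / 4)%:E *
    leb R [set x | a%:E <= line_section A (x, z0 - 2 * x * y0)%R] <= @leb2 R A.
Proof.
move=> mA a0.
set X0 := [set x | _].
have msec : measurable_fun setT (fun x : line R => line_section A (x, z0 - 2 * x * y0)%R).
  apply: (measurableT_comp (measurable_line_section mA)).
  apply: measurable_fun_pair => //; apply: measurable_funB => //.
  by apply: measurable_funM => //; exact: measurable_funM.
have mX0 : measurable (X0 : set (line R)).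
  by rewrite -[X0]setTI; exact: emeasurable_fun_c_infty.
have mq : measurable_fun setT (fun z : plane R =>
    `|2 * (z.2 - y0)|%:E * ind A (z.2, z0 + 2 * z.1 * (z.2 - y0))%R).
  apply: emeasurable_funM.
    apply/measurable_EFinP; apply: measurableT_comp => //.
    apply: measurable_funM => //; apply: measurable_funB => //; exact: measurable_snd.
  apply: (measurableT_comp (measurable_ind mA)).
  apply: measurable_fun_pair; first exact: measurable_snd.
  apply: measurable_funD => //; apply: measurable_funM => //.
    by apply: measurable_funM => //; exact: measurable_fst.
  by apply: measurable_funB => //; exact: measurable_snd.
have q0 (z : plane R) : 0 <= `|2 * (z.2 - y0)|%:E * ind A (z.2, z0 + 2 * z.1 * (z.2 - y0))%R.
  by apply: mule_ge0; [rewrite lee_fin|exact: ind_ge0].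
have mA2 (y : line R) : measurable_fun setT (fun z : line R => ind A (y, z)).
  exact: measurableT_comp (measurable_ind mA) (pair1_measurable y).
apply: (@le_trans _ _ (\int[leb R]_y \int[leb R]_x
    (`|2 * (y - y0)|%:E * ind A (y, z0 + 2 * x * (y - y0))%R))); last first.
  rewrite -(integral_ind (@leb2 R) mA) (ge0_integral_leb2 (measurable_ind mA) (ind_ge0 A)).
  apply: ge0_le_integral => //.
  - by move=> y _; apply: integral_ge0 => x _; exact: (q0 (x, y)).
  - exact: measurable_fun_fubini_tonelli_G mq q0.
  - exact: measurable_fun_fubini_tonelli_F (measurable_ind mA) (ind_ge0 A).
  move=> y _.
  (* At y = y0 the map x -> z0 + 2 x (y - y0) is constant and the change of variables fails, but the
     weight vanishes. *)
  have [->|yy0] := eqVneq y y0.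
    rewrite integral0_eq; first by apply: integral_ge0 => z _; exact: ind_ge0.
    by move=> x _; rewrite subrr mulr0 normr0 mul0e.
  rewrite ge0_integralZl//; last 2 first.
  - apply: (measurableT_comp (mA2 y)); apply: measurable_funD => //.
    by apply: measurable_funM => //; exact: measurable_funM.
  - by move=> x _; exact: ind_ge0.
  rewrite -(@ge0_integral_affine R (2 * (y - y0)) z0 _ _ (mA2 y)) => [| |z]; last 2 first.
  - by rewrite mulf_neq0// subr_eq0.
  - exact: ind_ge0.
  rewrite le_eqVlt; apply/orP; left; apply/eqP; congr (_ * _).
  by apply: eq_integral => x _; congr (ind A (_, _)); ring.
rewrite -(fubini_tonelli _ mq q0).
rewrite -(integral_ind (leb R) mX0) -ge0_integralZl//; last 3 first.
- exact: measurable_ind.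
- by move=> x _; exact: ind_ge0.
- by rewrite lee_fin divr_ge0// sqr_ge0.
apply: ge0_le_integral => //.
- by move=> x _; apply: mule_ge0; [rewrite lee_fin divr_ge0// sqr_ge0|exact: ind_ge0].
- by apply: emeasurable_funM => //; exact: measurable_ind.
- exact: measurable_fun_fubini_tonelli_F mq q0.
move=> x _; rewrite /ind indicE.
have [xX|_] := boolP (x \in X0); last first.
  by rewrite mule0; apply: integral_ge0 => y _; exact: (q0 (x, y)).
rewrite mule1.
(* For x in X0, S is the trace on A of a line through (y0, z0), of measure at least a, and
   [dist_bound] applies to it. *)
pose S := [set y | A (y, z0 + 2 * x * (y - y0))%R].
have mS : measurable (S : set (line R)).
  have mf : measurable_fun setT (fun y : line R => (y, z0 + 2 * x * (y - y0))%R : plane R).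
    apply: measurable_fun_pair => //; apply: measurable_funD => //.
    by apply: measurable_funM => //; exact: measurable_funB.
  by rewrite -[S]setTI; exact: mf.
apply: le_trans (dist_bound y0 mS a0 _) _; last by [].
move: xX; rewrite inE => /le_trans; apply.
rewrite -(integral_ind (leb R) mS) le_eqVlt; apply/orP; left; apply/eqP.
apply: eq_integral => y _; rewrite /ind /line_section /=.
by congr (EFin (\1_ _ _)); congr (_, _); ring.
Qed.

Let measurable_piXsub (k : R) (i j l : space R -> line R) :
  measurable_fun setT i -> measurable_fun setT j -> measurable_fun setT l ->
  measurable_fun setT (fun p : space R => (i p, l p + k * (j p * i p))%R : plane R).
Proof.
move=> mi mj ml; apply: measurable_fun_pair => //; apply: measurable_funD => //.
by apply: measurable_funM => //; exact: measurable_funM.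
Qed.

(** A point (x, y, t) of the set on the left is an incidence: the line with parameters (x, t), taken
    from B, passes at abscissa y through a point of A. Integrating in y first counts incidences line
    by line. *)
Let incidence (A B : set (plane R)) : measurable A -> measurable B ->
  leb3 [set p : space R | A (yc p, tc p + 2 * (xc p * yc p))%R /\ B (xc p, tc p)]
  = \int[@leb2 R]_z (ind B z * line_section A z).
Proof.
move=> mA mB; set E := [set p | _].
have mA' : measurable_fun setT (fun p : space R => ind A (yc p, tc p + 2 * (xc p * yc p))%R).
  apply: (measurableT_comp (measurable_ind mA)); apply: measurable_piXsub.
  - exact: measurable_yc.
  - exact: measurable_xc.
  - exact: measurable_tc.
have mB' : measurable_fun setT (fun p : space R => ind B (xc p, tc p)).
  apply: (measurableT_comp (measurable_ind mB)).
  by apply: measurable_fun_pair; [exact: measurable_xc|exact: measurable_tc].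
have EE (p : space R) : ind A (yc p, tc p + 2 * (xc p * yc p))%R * ind B (xc p, tc p) = ind E p.
  rewrite /ind -EFinM !indicE -natrM mulnb; congr (_%:R%:E); congr nat_of_bool.
  apply/andP/idP => [[/set_mem ? /set_mem ?]|/set_mem[? ?]]; first exact/mem_set.
  by split; exact/mem_set.
have mE : measurable E.
  have -> : E = (ind E) @^-1` [set 1%E].
    apply/seteqP; split => p; rewrite /ind/= indicE; first by move=> /mem_set ->.
    by case: (boolP (p \in E)) => [/set_mem//|_ [] /eqP]; rewrite eq_sym oner_eq0.
  rewrite -[X in measurable X]setTI.
  have mind : measurable_fun setT (ind E).
    apply: eq_measurable_fun (emeasurable_funM mA' mB') => p _; exact: EE.
  by apply: mind => //; exact: emeasurable_set1.
rewrite -(integral_ind (@leb3 R) mE).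
transitivity (\int[@leb3 R]_p
    (ind A (yc p, tc p + 2 * (xc p * yc p))%R * ind B (xc p, tc p))).
  by apply: eq_integral => p _; rewrite EE.
have mAB := emeasurable_funM mA' mB'.
have AB0 p : 0 <= ind A (yc p, tc p + 2 * (xc p * yc p))%R * ind B (xc p, tc p).
  by apply: mule_ge0; exact: ind_ge0.
rewrite -(mp_ge0_integral (mp_swap23 R) mAB AB0).
have mABs := measurableT_comp mAB (mp_swap23 R).1.
rewrite (ge0_integral_leb3 mABs (fun p => AB0 _)); apply: eq_integral => -[x t] _.
rewrite /line_section -ge0_integralZl//; last 3 first.
- exact: (measurableT_comp (mline mA) (pair1_measurable (x, t))).
- by move=> y _; exact: ind_ge0.
- exact: ind_ge0.
apply: eq_integral => y _; rewrite /= muleC; congr (_ * ind A (_, _)).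
by rewrite /xc /yc /tc/=; ring.
Qed.

(* The points of B whose line meets A in measure less than a contribute at most
   a |B|.  By [bush], every point of A lies on few lines meeting A in measure at
   least a, which gives the quadratic term. *)
Lemma loomis_whitney (A B : set (plane R)) (a : R) :
  measurable A -> measurable B -> (0 < a)%R ->
  leb3 [set p : space R | A (piX p) /\ B (piY p)] <=
    a%:E * leb2 B + (4 / a ^+ 2)%:E * (leb2 A * leb2 A).
Proof.
move=> mA mB a0.
set W := [set p | _].
have mW : measurable W.
  have -> : W = (piX @^-1` A) `&` (piY @^-1` B) by [].
  apply: measurableI.
    by rewrite -[_ @^-1` _]setTI; exact: measurable_piX.
  by rewrite -[_ @^-1` _]setTI; exact: measurable_piY.
rewrite -((mp_shear_mul 1).2 _ mW).
rewrite [leLHS](_ : _ = leb3 [set p : space R |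
    A (yc p, tc p + 2 * (xc p * yc p))%R /\ B (xc p, tc p)]); last first.
  congr (leb3 _); apply/seteqP; split => -[[x y] t]; rewrite /W /piX /piY /xc /yc /tc/=.
    move=> [Ap Bp]; split.
      by move: Ap; congr (A (_, _)); ring.
    by move: Bp; congr (B (_, _)); ring.
  move=> [Ap Bp]; split.
    by move: Ap; congr (A (_, _)); ring.
  by move: Bp; congr (B (_, _)); ring.
rewrite incidence//.
pose P := [set z | a%:E <= line_section A z].
have mls := measurable_line_section mA.
have mP : measurable P by rewrite -[P]setTI; exact: emeasurable_fun_c_infty.
have ls0 z : 0 <= line_section A z by apply: integral_ge0 => y _; exact: ind_ge0.
have mPl : measurable_fun setT (fun z => ind P z * line_section A z).
  by apply: emeasurable_funM => //; exact: measurable_ind.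
have Pl0 z : 0 <= ind P z * line_section A z by apply: mule_ge0 => //; exact: ind_ge0.
have maB : measurable_fun setT (fun z => a%:E * ind B z).
  by apply: emeasurable_funM => //; exact: measurable_ind.
have aB0 z : 0 <= a%:E * ind B z.
  by apply: mule_ge0; [rewrite lee_fin ltW|exact: ind_ge0].
apply: (@le_trans _ _ (\int[@leb2 R]_z (a%:E * ind B z + ind P z * line_section A z))).
  apply: ge0_le_integral => //.
  - by move=> z _; apply: mule_ge0 => //; exact: ind_ge0.
  - by apply: emeasurable_funM => //; exact: measurable_ind.
  - exact: emeasurable_funD.
  move=> z _; rewrite /ind !indicE.
  have [zP|zP] := boolP (z \in P).
    rewrite mul1e; apply: le_trans (_ : line_section A z <= _); last first.
      by apply: leeDr; exact: (aB0 z).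
    by case: (_ \in _); rewrite ?mul1e ?mul0e.
  rewrite mul0e adde0 muleC.
  case: (_ \in _); rewrite ?mule1 ?mule0//.
  by move: zP; rewrite notin_setE /P/= => /negP; rewrite -ltNge => /ltW.
rewrite ge0_integralD//; apply: leeD.
  rewrite ge0_integralZl ?integral_ind//; first exact: measurable_ind.
    by move=> z _; exact: ind_ge0.
  by rewrite lee_fin ltW.
rewrite -incidence//.
have mPA : measurable [set p : space R |
    A (yc p, tc p + 2 * (xc p * yc p))%R /\ P (xc p, tc p)].
  rewrite [X in measurable X](_ : _ =
    (fun p : space R => (yc p, tc p + 2 * (xc p * yc p))%R : plane R) @^-1` A `&`
    (fun p : space R => (xc p, tc p) : plane R) @^-1` P)//.
  apply: measurableI; rewrite -[_ @^-1` _]setTI.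
    apply: measurable_piXsub => //; [exact: measurable_yc|exact: measurable_xc|exact: measurable_tc].
  by apply: measurable_fun_pair => //; [exact: measurable_xc|exact: measurable_tc].
(* This map is (y, t, x) -> (x, y, t - 2 x y). The incidences are now counted point by point: (y, t)
   is the point of A, and integration in x runs over the lines through it, as [bush] requires. *)
have mp := mp_comp (mp_swap23 R) (mp_comp (mp_swap12 R) (mp_shear_mul (-2))).
rewrite -(mp.2 _ mPA).
set E := _ @^-1` _.
have mE : measurable E by rewrite -[E]setTI; exact: mp.1.
rewrite -(integral_ind (@leb3 R) mE) (ge0_integral_leb3 (measurable_ind mE) (ind_ge0 E)).
have a4 : (0 <= 4 / a ^+ 2)%R by rewrite divr_ge0// sqr_ge0.
apply: (@le_trans _ _ (\int[@leb2 R]_z ((4 / a ^+ 2)%:E * leb2 A * ind A z))).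
  apply: ge0_le_integral => //.
  - by move=> z _; apply: integral_ge0 => x _; exact: ind_ge0.
  - exact: measurable_fun_fubini_tonelli_F (measurable_ind mE) (ind_ge0 E).
  - by apply: emeasurable_funM => //; exact: measurable_ind.
  move=> [y t] _.
  pose X0 := [set x | a%:E <= line_section A (x, t - 2 * x * y)%R].
  have Exy x : E (y, t, x) <-> A (y, t) /\ X0 x.
    rewrite /E /P /X0 /xc /yc /tc /=.
    have -> : (t + -2 * (x * y) + 2 * (x * y) = t)%R by ring.
    by have -> : (t + -2 * (x * y) = t - 2 * x * y)%R by ring.
  rewrite [X in _ <= _ * X]/ind indicE.
  have [/set_mem Ayt|/negP Ayt] := boolP ((y, t) \in A); last first.
    rewrite mule0 integral0_eq// => x _; rewrite /ind indicE memNset//.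
    by move=> /Exy[] /mem_set.
  rewrite mule1 (_ : \int[leb R]_x _ = leb R X0).
    have a24 : (0 < a ^+ 2 / 4)%R by rewrite divr_gt0// exprn_gt0.
    have := bush y t mA a0; rewrite -/X0 -lee_pdivlMl//; last first.
    by rewrite invf_div.
  rewrite -integral_ind.
    apply: eq_integral => x _; rewrite /ind !indicE; congr (_%:R%:E).
    by congr nat_of_bool; apply/idP/idP => /set_mem => [/Exy[_]|x0]; apply/mem_set => //; apply/Exy.
  rewrite -[X0]setTI; apply: emeasurable_fun_c_infty => //.
  apply: (measurableT_comp mls); apply: measurable_fun_pair => //.
  apply: measurable_funB => //.
  by apply: measurable_funM => //; exact: measurable_funM.
rewrite ge0_integralZl//; last 3 first.
- exact: measurable_ind.
- by move=> z _; exact: ind_ge0.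
- by apply: mule_ge0 => //; rewrite lee_fin.
by rewrite integral_ind// muleA.
Qed.

End loomis_whitney.

Arguments ind R {d T} A x.
Arguments ind_ge0 {R d T} A x.
Arguments measurable_ind {R d T A}.

(** * Smooth test functions *)

Section smooth.
Variable R : realType.

(** Reduces directional derivatives to one real variable, where the chain rule is applied. *)
Lemma is_derive_dirP (V : normedModType R) (f : V -> R) (p v : V) (d : R) :
  is_derive p v f d <-> is_derive (0 : R) 1 (fun t : R => f (t *: v + p)) d.
Proof.
have E : 'D_v f p = 'D_1 (fun t : R => f (t *: v + p)) 0.
  rewrite /derive; set F := (X in lim (X @ _)); set G := (X in _ = lim (X @ _)).
  suff -> : F = G by [].
  apply/funext => h; rewrite /F /G /=.
  by rewrite addr0 scale0r add0r /GRing.scale /= mulr1.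
split=> -[dv dE].
  by apply: DeriveDef; [exact: (derivable1P _ _ _).1|rewrite -E].
by apply: DeriveDef; [exact: (derivable1P _ _ _).2|rewrite E].
Qed.

Lemma is_derive_comp_dir (V : normedModType R) (f : V -> R) (h : R -> R)
    (p v : V) (d d' : R) :
  is_derive p v f d -> is_derive (f p) 1 h d' ->
  is_derive p v (fun q => h (f q)) (d' * d).
Proof.
move=> /is_derive_dirP df dh; apply/is_derive_dirP.
apply: (@is_derive1_comp _ h (fun t => f (t *: v + p))).
by rewrite scale0r add0r.
Qed.

(** The power x ^- k makes the family stable under derivation: the derivative of [flat k] is a
    combination of [flat k.+2] and [flat k.+1]. *)
Definition flat (k : nat) (x : R) : R :=
  if 0 < x then x ^- k * expR (- x^-1) else 0.

Lemma flat_ge0 k (x : R) : 0 <= flat k x.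
Proof.
rewrite /flat; case: ifP => // x0.
by rewrite mulr_ge0 ?expR_ge0// invr_ge0 exprn_ge0// ltW.
Qed.

(** One term of the exponential series: e^(1/x) is at least x^-(k+1) / (k+1)!. The resulting linear
    decay gives differentiability at 0. *)
Lemma flat_le k (x : R) : flat k x <= k.+1`!%:R * `|x|.
Proof.
rewrite /flat; case: ifP => x0; last by rewrite mulr_ge0.
rewrite gtr0_norm// expRN ler_pdivrMr ?expR_gt0//.
have := @expR_ge1Dxn R x^-1 k (ltW _); rewrite invr_gt0 => /(_ x0) h.
have f0 : 0 < (k.+1)`!%:R :> R by rewrite ltr0n fact_gt0.
have {}h : x^-1 ^+ k.+1 <= k.+1`!%:R * expR x^-1.
  rewrite mulrC -ler_pdivrMr//; apply: le_trans h.
  by rewrite lerDr.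
rewrite exprSr in h.
have xk : 0 < x^-1 ^+ k by rewrite exprn_gt0// invr_gt0.
rewrite -exprVn mulrAC -mulrA.
have -> : x^-1 ^+ k = x^-1 ^+ k * x^-1 * x by rewrite mulfVK// gt_eqF.
by rewrite mulrA ler_wpM2r// ltW.
Qed.

Lemma flatS k (x : R) : x != 0 -> flat k.+1 x = x^-1 * flat k x.
Proof.
move=> x0; rewrite /flat; case: ifP => _; last by rewrite mulr0.
by rewrite exprS invfM mulrA.
Qed.

Lemma is_derive_flat k (x : R) :
  is_derive x (1 : R) (flat k) (flat k.+2 x - k%:R * flat k.+1 x).
Proof.
have [x0|x0|->] := ltgtP x 0.
- have -> : flat k.+2 x - k%:R * flat k.+1 x = 0.
    by rewrite /flat ltNge (ltW x0)/= mulr0 subrr.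
  apply: (@near_eq_is_derive _ _ _ (cst 0)).
    near=> y; rewrite /flat ltNge ifF//; apply/negbTE; rewrite negbK ltW//.
    near: y; exact: lt_nbhsl.
- rewrite flatS ?gt_eqF// flatS ?gt_eqF//.
  suff h : is_derive x (1 : R) (fun y : R => y^-1 ^+ k * expR (- y^-1))
      (x^-1 * (x^-1 * flat k x) - k%:R * (x^-1 * flat k x)).
    apply: near_eq_is_derive h.
    near=> y; rewrite /flat ifT ?exprVn//.
    near: y; exact: lt_nbhsr.
  have dV : is_derive x (1 : R) (fun y : R => y^-1) (- x^-1 ^+ 2).
    have x0' : id x != 0 by rewrite gt_eqF.
    have := is_deriveV x0' (is_derive_id x (1 : R)).
    by rewrite /GRing.scale/= mulr1 exprVn.
  have dE : is_derive x (1 : R) (fun y : R => expR (- y^-1)) (expR (- x^-1) * x^-1 ^+ 2).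
    apply: (@is_derive1_comp _ expR (fun y => - y^-1)).
    rewrite -[X in is_derive _ _ _ X]opprK; exact: is_deriveN.
  have fE : flat k x = x^-1 ^+ k * expR (- x^-1) by rewrite /flat x0 exprVn.
  rewrite fE; case: k fE => [|k] _.
    rewrite mul0r subr0 expr0 mul1r mulrA.
    rewrite (_ : (fun y => _) = (fun y => expR (- y^-1))); last first.
      by apply/funext => y; rewrite expr0 mul1r.
    by rewrite [X in is_derive _ _ _ X]mulrC -expr2.
  have := is_deriveM (is_deriveX k.+1 dV) dE.
  set d := (X in is_derive _ _ _ X -> _).
  rewrite (_ : _ - _ = d); last first.
    rewrite /d /GRing.scale /=.
    rewrite (_ : (GRing.inv : R -> R) ^+ k.+1 = fun y => y^-1 ^+ k.+1); last first.
      by apply/funext => y; rewrite fctE.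
    by rewrite exprS expr2; ring.
  rewrite (_ : _ * _ = (fun y : R => y^-1 ^+ k.+1 * expR (- y^-1)))//.
  by apply/funext => y; rewrite !fctE.
- have -> : flat k.+2 0 - k%:R * flat k.+1 0 = 0 by rewrite /flat ltxx mulr0 subrr.
  have f0 j : flat j 0 = 0 by rewrite /flat ltxx.
  (* The difference quotient of [flat k] at 0 is [flat k.+1 h], which [flat_le] squeezes to 0. *)
  have c : (fun h : R => h^-1 *: (flat k (h *: 1 + 0) - flat k 0)) @ 0^' --> (0 : R).
    apply: (@squeeze_cvgr _ _ _ _ (fun=> 0) (fun h => k.+2`!%:R * `|h|)).
    - near=> h; rewrite addr0 f0 subr0 /GRing.scale /= mulr1 -flatS.
        by rewrite flat_ge0 flat_le.
      by near: h; exact: nbhs_dnbhs_neq.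
    - exact: cvg_cst.
    - rewrite -[X in _ --> X](mulr0 (k.+2`!%:R : R)); apply: cvgMr.
      rewrite -[X in _ --> X](normr0 R).
      apply: cvg_within_filter.
      exact: norm_continuous.
  by apply: DeriveDef; [apply/cvg_ex; exists 0|exact/cvg_lim].
Unshelve. all: by end_near. Qed.

(* A class of smooth functions whose stability under derivation is a matter of
   structural induction; it is large enough for the test functions used below. *)
Inductive smooth1 : (R -> R) -> Prop :=
| smooth1_flat k : smooth1 (flat k)
| smooth1_affine (a b : R) : smooth1 (fun x => a * x + b)
| smooth1_add f g : smooth1 f -> smooth1 g -> smooth1 (fun x => f x + g x)
| smooth1_mul f g : smooth1 f -> smooth1 g -> smooth1 (fun x => f x * g x)
| smooth1_comp f g : smooth1 f -> smooth1 g -> smooth1 (fun x => f (g x))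
| smooth1_prim f g : smooth1 g -> (forall x : R, is_derive x (1 : R) f (g x)) -> smooth1 f.

Lemma smooth1_derive f : smooth1 f ->
  exists2 g, smooth1 g & forall x : R, is_derive x (1 : R) f (g x).
Proof.
elim=> {f}.
- move=> k; exists (fun x => flat k.+2 x + (0 * x - k%:R) * flat k.+1 x).
    apply: smooth1_add; first exact: smooth1_flat.
    by apply: smooth1_mul; [exact: smooth1_affine|exact: smooth1_flat].
  by move=> x; rewrite mul0r sub0r mulNr; exact: is_derive_flat.
- move=> a b; exists (fun x => 0 * x + a); first exact: smooth1_affine.
  move=> x; rewrite mul0r add0r.
  have : is_derive x (1 : R) ((a *: (id : R -> R)) + cst b) (a *: 1 + 0) by typeclasses eauto.
  by rewrite addr0 /GRing.scale/= mulr1.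
- move=> f g sf [f' sf' df] sg [g' sg' dg].
  exists (fun x => f' x + g' x); first exact: smooth1_add.
  by move=> x; exact: is_deriveD.
- move=> f g sf [f' sf' df] sg [g' sg' dg].
  exists (fun x => f x * g' x + g x * f' x).
    by apply: smooth1_add; exact: smooth1_mul.
  by move=> x; exact: is_deriveM.
- move=> f g sf [f' sf' df] sg [g' sg' dg].
  exists (fun x => f' (g x) * g' x).
    by apply: smooth1_mul => //; exact: (@smooth1_comp f' g).
  by move=> x; exact: is_derive1_comp.
- by move=> f g sg _ dfg; exists g.
Qed.

Lemma smooth1_continuous f : smooth1 f -> continuous f.
Proof.
move=> /smooth1_derive[g _ df] x.
by apply: differentiable_continuous; apply/derivable1_diffP; case: (df x).
Qed.

(** The base case is a continuous linear form l, recognised by its derivative l v in every direction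
    v. Its derivatives are constants, which [smooth3_cst] obtains from an affine map of slope 0. *)
Inductive smooth3 : (R * R * R -> R) -> Prop :=
| smooth3_coord (l : R * R * R -> R) : continuous l ->
    (forall p v, is_derive p v l (l v)) -> smooth3 l
| smooth3_add f g : smooth3 f -> smooth3 g -> smooth3 (fun p => f p + g p)
| smooth3_mul f g : smooth3 f -> smooth3 g -> smooth3 (fun p => f p * g p)
| smooth3_comp f g : smooth1 f -> smooth3 g -> smooth3 (fun p => f (g p)).

Lemma smooth3_continuous f : smooth3 f -> continuous f.
Proof.
elim=> {f}//.
- by move=> f g _ cf _ cg p; apply: cvgD; [exact: cf|exact: cg].
- by move=> f g _ cf _ cg p; apply: cvgM; [exact: cf|exact: cg].
- move=> f g /smooth1_continuous cf _ cg p.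
  by apply: continuous_comp; [exact: cg|exact: cf].
Qed.

Lemma smooth3_cst c : smooth3 (fun=> c).
Proof.
have := @smooth3_comp (fun x => 0 * x + c) (fun=> 0) (smooth1_affine _ _).
rewrite (_ : (fun=> 0 * 0 + c) = fun=> c); last by apply/funext => p; rewrite mul0r add0r.
apply; apply: smooth3_coord.
by move=> p; exact: cvg_cst.
Qed.

Lemma smooth3_derive f v : smooth3 f ->
  exists2 g, smooth3 g & forall p, is_derive p v f (g p).
Proof.
elim=> {f}.
- by move=> l cl dl; exists (fun=> l v); [exact: smooth3_cst|move=> p; exact: dl].
- move=> f g sf [f' sf' df] sg [g' sg' dg].
  exists (fun x => f' x + g' x); first exact: smooth3_add.
  by move=> x; exact: is_deriveD.
- move=> f g sf [f' sf' df] sg [g' sg' dg].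
  exists (fun x => f x * g' x + g x * f' x).
    by apply: smooth3_add; exact: smooth3_mul.
  by move=> x; exact: is_deriveM.
- move=> f g sf sg [g' sg' dg]; have [f' sf' df] := smooth1_derive sf.
  exists (fun x => f' (g x) * g' x).
    by apply: smooth3_mul => //; exact: (@smooth3_comp f' g).
  by move=> x; exact: is_derive_comp_dir.
Qed.

Lemma smooth3_Cn n f : smooth3 f -> Cn n f.
Proof.
elim: n f => [|n IHn] f sf /=; split=> //; try exact: smooth3_continuous.
move=> v; have [g sg dg] := smooth3_derive v sf.
have E : (fun p => 'D_v f p) = g by apply/funext => p; case: (dg p).
split; first by move=> p; case: (dg p).
by rewrite E; exact: IHn.
Qed.

Lemma smooth3_linear (l : R * R * R -> R) : continuous l ->
  (forall (t : R) v p, l (t *: v + p) = t * l v + l p) -> smooth3 l.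
Proof.
move=> cl ll; apply: smooth3_coord => // p v; apply/is_derive_dirP.
rewrite (_ : (fun t => _) = (l v *: (id : R -> R)) + cst (l p)); last first.
  by apply/funext => t; rewrite ll mulrC.
have : is_derive (0 : R) (1 : R) ((l v *: (id : R -> R)) + cst (l p)) (l v *: 1 + 0).
  by typeclasses eauto.
by rewrite addr0 /GRing.scale/= mulr1.
Qed.

Lemma smooth3_xc : smooth3 (@xc R).
Proof.
apply: smooth3_linear => // p.
by apply: (@continuous_comp _ _ _ fst fst); [exact: cvg_fst|exact: cvg_fst].
Qed.

Lemma smooth3_yc : smooth3 (@yc R).
Proof.
apply: smooth3_linear => // p.
by apply: (@continuous_comp _ _ _ fst snd); [exact: cvg_fst|exact: cvg_snd].
Qed.

Lemma smooth3_tc : smooth3 (@tc R).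
Proof. by apply: smooth3_linear => // p; exact: cvg_snd. Qed.

(** On ]a, b[ this is exp (- 1 / ((n+1)(s-a)) - 1 / ((n+1)(b-s))): a smooth approximation from below
    of the indicator of ]a, b[. *)
Definition bump (a b : R) (n : nat) (s : R) : R :=
  flat 0 (n.+1%:R * (s - a)) * flat 0 (n.+1%:R * (b - s)).

Lemma smooth1_bump a b n : smooth1 (bump a b n).
Proof.
have E (c : R) : (fun s : R => n.+1%:R * (s - c)) = (fun s => n.+1%:R * s + - (n.+1%:R * c)).
  by apply/funext => s; ring.
have E' (c : R) : (fun s : R => n.+1%:R * (c - s)) = (fun s => - n.+1%:R * s + (n.+1%:R * c)).
  by apply/funext => s; ring.
apply: smooth1_mul.
  by apply: (@smooth1_comp (flat 0) (fun s => n.+1%:R * (s - a)));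
    [exact: smooth1_flat|rewrite E; exact: smooth1_affine].
by apply: (@smooth1_comp (flat 0) (fun s => n.+1%:R * (b - s)));
    [exact: smooth1_flat|rewrite E'; exact: smooth1_affine].
Qed.

Lemma flat0_le1 x : flat 0 x <= 1.
Proof.
rewrite /flat; case: ifP => x0; last by rewrite ler01.
by rewrite expr0 invr1 mul1r expR_le1 oppr_le0 invr_ge0 ltW.
Qed.

Lemma flat_le0 k x : x <= 0 -> flat k x = 0.
Proof. by rewrite /flat leNgt => /negbTE ->. Qed.

Lemma bump_ge0 a b n s : 0 <= bump a b n s.
Proof. by rewrite mulr_ge0// flat_ge0. Qed.

Lemma bump_le1 a b n s : bump a b n s <= 1.
Proof. by rewrite mulr_ile1 ?flat_ge0// flat0_le1. Qed.

Lemma bump_eq0 a b n s : ~~ (a < s < b) -> bump a b n s = 0.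
Proof.
rewrite negb_and -!leNgt => /orP[sa|bs]; rewrite /bump.
  by rewrite flat_le0 ?mul0r// mulr_ge0_le0// subr_le0.
by rewrite mulrC flat_le0 ?mul0r// mulr_ge0_le0// subr_le0.
Qed.

Lemma bump_le_indic a b n s : bump a b n s <= \1_(`]a, b[%classic) s.
Proof.
rewrite indicE; have [/set_mem/=|] := boolP (s \in _); first by rewrite bump_le1.
by rewrite notin_setE/= in_itv/= => /negP sab; rewrite bump_eq0.
Qed.

Let flat0_cvg (c : R) : 0 < c -> flat 0 (n.+1%:R * c) @[n --> \oo] --> (1 : R).
Proof.
move=> c0; rewrite [X in X @ _](_ : _ = fun n => expR (- (n.+1%:R^-1 * c^-1))); last first.
  by apply/funext => n; rewrite /flat mulr_gt0// expr0 invr1 mul1r invfM.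
rewrite -[X in _ --> X]expR0.
apply: continuous_cvg; first exact: continuous_expR.
rewrite -[X in _ --> X]oppr0; apply: cvgN.
rewrite -[X in _ --> X](mul0r (c^-1)); apply: cvgMl.
exact: cvg_harmonic.
Qed.

Lemma bump_cvg a b s :
  bump a b n s @[n --> \oo] --> (\1_(`]a, b[%classic) s : R).
Proof.
have [/andP[sa sb]|sab] := boolP (a < s < b).
  rewrite indicE mem_set/= ?in_itv/= ?sa// -[X in _ --> X]mulr1.
  by apply: cvgM; apply: flat0_cvg; rewrite subr_gt0.
rewrite indicE memNset/=; last by rewrite in_itv/=; exact/negP.
rewrite [X in X @ _](_ : _ = cst 0); first exact: cvg_cst.
by apply/funext => n; rewrite bump_eq0.
Qed.

(** A product in the coordinates (x, y, t + x y): X annihilates y and t + x y, hence differentiates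
    the factor phi alone. *)
Definition prod_test (phi psi chi : R -> R) (p : R * R * R) : R :=
  phi (xc p) * psi (yc p) * chi (tc p + xc p * yc p).

Lemma test_function_of_support (f : R * R * R -> R) (A B C : R) :
  (forall n, Cn n f) ->
  (forall p, f p != 0 -> [/\ `|xc p| <= A, `|yc p| <= B & `|tc p| <= C]) ->
  test_function f.
Proof.
move=> Cf supp; split=> //.
pose K := (`[- A, A] `*` `[- B, B] `*` `[- C, C])%classic : set (R * R * R).
have cK : compact K.
  by apply: compact_setX; [apply: compact_setX|]; exact: segment_compact.
apply: (subclosed_compact _ cK); first exact: closed_closure.
have clK : closed K by apply: compact_closed cK; exact: norm_hausdorff.
rewrite [K](closure_id K).1//.
apply: closure_subset => p /supp[]; rewrite /K /= !in_itv/= -!ler_norml.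
by move=> *; split; [split|].
Qed.

Lemma smooth3_prod_test (phi psi chi : R -> R) :
  smooth1 phi -> smooth1 psi -> smooth1 chi -> smooth3 (prod_test phi psi chi).
Proof.
move=> sphi spsi schi; apply: smooth3_mul.
  by apply: smooth3_mul; apply: smooth3_comp => //; [exact: smooth3_xc|exact: smooth3_yc].
apply: smooth3_comp => //; apply: smooth3_add; first exact: smooth3_tc.
by apply: smooth3_mul; [exact: smooth3_xc|exact: smooth3_yc].
Qed.

Lemma prod_test_support (phi psi chi : R -> R) (M : R) p :
  (forall s, M < `|s| -> phi s = 0) -> (forall s, M < `|s| -> psi s = 0) ->
  (forall s, M < `|s| -> chi s = 0) -> prod_test phi psi chi p != 0 ->
  [/\ `|xc p| <= M, `|yc p| <= M & `|tc p| <= M + M * M].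
Proof.
move: p => [[x y] t] phi0 psi0 chi0; rewrite /prod_test /xc /yc /tc/=.
have [xM|/phi0 ->] := leP `|x| M; last by rewrite !mul0r eqxx.
have [yM|/psi0 ->] := leP `|y| M; last by rewrite mulr0 mul0r eqxx.
have [tM|/chi0 ->] := leP `|t + x * y| M; last by rewrite mulr0 eqxx.
move=> _; split=> //.
rewrite (_ : t = (t + x * y) - x * y); last by ring.
rewrite (le_trans (ler_normB _ _))// lerD// normrM.
by rewrite ler_pM.
Qed.

Lemma prod_test_function (phi psi chi : R -> R) (M : R) :
  smooth1 phi -> smooth1 psi -> smooth1 chi ->
  (forall s, M < `|s| -> phi s = 0) -> (forall s, M < `|s| -> psi s = 0) ->
  (forall s, M < `|s| -> chi s = 0) ->
  test_function (prod_test phi psi chi).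
Proof.
move=> sphi spsi schi phi0 psi0 chi0.
apply: (@test_function_of_support _ M M (M + M * M)).
  by move=> n; apply: smooth3_Cn; exact: smooth3_prod_test.
by move=> p; exact: prod_test_support.
Qed.

Lemma flip_linear (t : R) (v p : R * R * R) : flip (t *: v + p) = t *: flip v + flip p.
Proof.
case: v p => [[vx vy] vt] [[x y] s]; rewrite /flip /xc /yc /tc/=.
by congr (_, _, _); rewrite /= /GRing.scale/=; ring.
Qed.

Lemma flip_continuous : continuous (@flip R : R * R * R -> R * R * R).
Proof.
move=> p.
have cy : @yc R q @[q --> p] --> yc p := smooth3_continuous smooth3_yc (x := p).
have cx : @xc R q @[q --> p] --> xc p := smooth3_continuous smooth3_xc (x := p).
have ct : - @tc R q @[q --> p] --> - tc p.
  by apply: cvgN; exact: (smooth3_continuous smooth3_tc).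
exact: (cvg_pair (cvg_pair cy cx) ct).
Qed.

Lemma derive_flip (f : R * R * R -> R) (v p : R * R * R) :
  'D_v (f \o @flip R) p = 'D_(flip v) f (flip p).
Proof.
rewrite /derive; set F := (X in lim (X @ _)); set G := (X in _ = lim (X @ _)).
by suff -> : F = G by []; apply/funext => h; rewrite /F /G /= flip_linear.
Qed.

Lemma smooth3_flip (f : R * R * R -> R) : smooth3 f -> smooth3 (f \o @flip R).
Proof.
elim=> {f}.
- move=> l cl dl; apply: smooth3_coord.
    by move=> p; apply: continuous_comp; [exact: flip_continuous|exact: cl].
  move=> p v; apply/is_derive_dirP.
  rewrite (_ : (fun t => _) = (fun t => l (t *: flip v + flip p))); last first.
    by apply/funext => t /=; rewrite flip_linear.
  by have /is_derive_dirP := dl (flip p) (flip v).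
- by move=> f g _ sf _ sg; exact: (smooth3_add sf sg).
- by move=> f g _ sf _ sg; exact: (smooth3_mul sf sg).
- by move=> f g sf _ sg; exact: (smooth3_comp sf sg).
Qed.

Lemma lie_prod_test (phi phi' psi chi : R -> R) p :
  smooth1 psi -> smooth1 chi -> (forall x : R, is_derive x (1 : R) phi (phi' x)) ->
  lie_derivative (@vfX R) (prod_test phi psi chi) p =
  prod_test phi' psi chi p.
Proof.
move=> /smooth1_derive[psi' _ dpsi] /smooth1_derive[chi' _ dchi] dphi.
have dx : is_derive p (vfX p) (@xc R) 1.
  apply/is_derive_dirP; rewrite (_ : (fun t => _) = (id : R -> R) + cst (xc p)); last first.
    by apply/funext => t; rewrite /xc/= /GRing.scale/= mulr1.
  rewrite -[X in is_derive _ _ _ X]addr0; typeclasses eauto.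
have dy : is_derive p (vfX p) (@yc R) 0.
  apply/is_derive_dirP; rewrite (_ : (fun t => _) = cst (yc p)); last first.
    by apply/funext => t; rewrite /yc/= /GRing.scale/= mulr0 add0r.
  exact: is_derive_cst.
have dt : is_derive p (vfX p) (fun q => tc q + xc q * yc q) 0.
  apply/is_derive_dirP; rewrite (_ : (fun t => _) = cst (tc p + xc p * yc p)); last first.
    by apply/funext => t; rewrite /tc /xc /yc/= /GRing.scale/=; ring.
  exact: is_derive_cst.
have d1 := is_derive_comp_dir dx (dphi (xc p)).
have d2 := is_derive_comp_dir dy (dpsi (yc p)).
have d3 := is_derive_comp_dir dt (dchi (tc p + xc p * yc p)).
have d12 := is_deriveM d1 d2.
have [_ E] := is_deriveM d12 d3.
rewrite /lie_derivative [LHS]E /prod_test /GRing.scale/=.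
by rewrite !fctE; ring.
Qed.

Local Notation mu := (@lebesgue_measure R).

Lemma measurable_bump a b n : measurable_fun setT (bump a b n).
Proof. by apply: continuous_measurable_fun; exact/smooth1_continuous/smooth1_bump. Qed.

Lemma integrable_itvoo (D : set R) (a b : R) : measurable D ->
  mu.-integrable D (fun s => (\1_(`]a, b[%classic) s : R)%:E).
Proof.
move=> mD; apply: (integrableS measurableT) => //.
apply/integrableP; split; first by apply/measurable_EFinP; exact: measurable_indic.
under eq_integral do rewrite gee0_abs ?lee_fin//.
rewrite integral_indic// setIT [X in (X < _)%E](@lebesgue_measure_itv R (Interval (BRight a) (BLeft b)))/=.
by case: ifP => _; rewrite ?ltry// -EFinB ltry.
Qed.

Lemma integrable_bump (D : set R) a b n : measurable D ->
  mu.-integrable D (EFin \o bump a b n).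
Proof.
move=> mD; apply: le_integrable (integrable_itvoo a b mD) => //.
  by apply/measurable_EFinP; apply: measurable_funTS; exact: measurable_bump.
move=> x _ /=; rewrite lee_fin !ger0_norm ?bump_ge0// ?bump_le_indic//.
Qed.

Definition prim (a b : R) n (s : R) : R :=
  \int[mu]_(r in `]-oo, s]) bump a b n r.

Lemma is_derive_prim a b n (s : R) : is_derive s (1 : R) (prim a b n) (bump a b n s).
Proof.
have [] := @continuous_FTC1 R (bump a b n) -oo%O s (s + 1).
- by rewrite ltrDl.
- by apply: integrable_bump.
- by rewrite ltNyr.
- exact/smooth1_continuous/smooth1_bump.
by move=> dp; rewrite derive1E; exact: DeriveDef.
Qed.

Lemma smooth1_prim_bump a b n : smooth1 (prim a b n).
Proof. by apply: smooth1_prim (smooth1_bump a b n) _ => x; exact: is_derive_prim. Qed.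

Lemma prim_ge0 a b n s : 0 <= prim a b n s.
Proof. by apply: Rintegral_ge0 => r _; exact: bump_ge0. Qed.

(* Limit of [prim a b n] as n tends to infinity. *)
Definition mass (a b s : R) : R := \int[mu]_(r in `]-oo, s]) \1_(`]a, b[%classic) r.

Lemma prim_le a b n s : a < b -> prim a b n s <= b - a.
Proof.
move=> ab.
rewrite -lee_fin /prim /Rintegral fineK; last first.
  by apply: integrable_fin_num => //; exact: integrable_bump.
apply: (@le_trans _ _ (\int[mu]_r (\1_(`]a, b[%classic) r : R)%:E)%E); last first.
  rewrite integral_indic// setIT [X in (X <= _)%E](@lebesgue_measure_itv R (Interval (BRight a) (BLeft b)))/=.
  by rewrite lte_fin ab.
apply: (@le_trans _ _ (\int[mu]_(r in `]-oo, s]) (\1_(`]a, b[%classic) r : R)%:E)%E).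
  apply: ge0_le_integral => //.
  - by move=> r _; rewrite lee_fin bump_ge0.
  - by apply/measurable_EFinP; apply: measurable_funTS; exact: measurable_bump.
  - by apply/measurable_EFinP; exact: measurable_indic.
  - by move=> r _; rewrite lee_fin bump_le_indic.
apply: ge0_subset_integral => //.
by apply/measurable_EFinP; exact: measurable_indic.
Qed.

Lemma prim_eq0 a b n s : s <= a -> prim a b n s = 0.
Proof.
move=> sa; rewrite /prim (@eq_Rintegral _ _ _ mu _ (cst 0)) ?Rintegral_cst// ?mul0r//.
move=> r; rewrite inE/= in_itv/= => rs; rewrite bump_eq0// negb_and -!leNgt.
by rewrite (le_trans rs sa).
Qed.

Lemma prim_eq_right a b n s : b <= s -> prim a b n s = prim a b n b.
Proof.
move=> bs; rewrite /prim Rintegral_mkcond [RHS]Rintegral_mkcond.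
apply: eq_Rintegral => r _; rewrite !patchE.
have [rb|br] := leP r b.
  by rewrite !mem_set//= in_itv//= (le_trans rb bs).
rewrite (@bump_eq0 a b n r); first by case: ifP; case: ifP.
by rewrite negb_and -!leNgt (ltW br) orbT.
Qed.

Lemma prim_cvg a b s : prim a b n s @[n --> \oo] --> mass a b s.
Proof.
apply: fine_cvg; rewrite fineK; last first.
  by apply: integrable_fin_num => //; exact: integrable_itvoo.
have [] // := @dominated_convergence _ _ R mu `]-oo, s]%classic _
  (fun n => EFin \o bump a b n) (fun r => (\1_(`]a, b[%classic) r : R)%:E)
  (fun r => (\1_(`]a, b[%classic) r : R)%:E).
- move=> n; apply/measurable_EFinP; apply: measurable_funTS; exact: measurable_bump.
- by apply/measurable_EFinP; exact: measurable_indic.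
- by apply: aeW => r _; apply/fine_cvgP; split; [exact: nearW|exact: bump_cvg].
- exact: integrable_itvoo.
- by apply: aeW => r n _ /=; rewrite lee_fin ger0_norm ?bump_ge0 ?bump_le_indic.
Qed.

(* A compactly supported primitive: the second bump escapes to infinity with n,
   so the derivative tends to the indicator of ]a, b[. *)
Definition cutoff (a b : R) n (s : R) : R :=
  prim a b n s + (-1 * prim a b n (1 * s + (- n.+1%:R))).

Lemma smooth1_cutoff a b n : smooth1 (cutoff a b n).
Proof.
have sp := smooth1_prim_bump a b n.
apply: smooth1_add => //; apply: smooth1_mul.
  have := smooth1_affine 0 (-1).
  by rewrite (_ : (fun x => 0 * x + -1) = fun=> -1)//; apply/funext => x; rewrite mul0r add0r.
by apply: (@smooth1_comp (prim a b n) (fun s => 1 * s + - n.+1%:R)) => //; exact: smooth1_affine.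
Qed.

Lemma cutoffE a b n s : cutoff a b n s = prim a b n s - prim a b n (s - n.+1%:R).
Proof. by rewrite /cutoff mul1r mulN1r. Qed.

Lemma is_derive_cutoff a b n (s : R) :
  is_derive s (1 : R) (cutoff a b n) (bump a b n s - bump a b n (s - n.+1%:R)).
Proof.
have -> : cutoff a b n = prim a b n - (prim a b n \o (id - cst n.+1%:R)).
  by apply/funext => x; rewrite cutoffE.
apply: is_deriveB; first exact: is_derive_prim.
rewrite -[X in is_derive _ _ _ X]mulr1; apply: is_derive1_comp.
  exact: is_derive_prim.
by rewrite -[X in is_derive _ _ _ X]subr0; exact: is_deriveB.
Qed.

Lemma cutoff_eq0 a b n s : a < b -> ~~ (a <= s <= b + n.+1%:R) -> cutoff a b n s = 0.
Proof.
move=> ab; rewrite cutoffE negb_and -!ltNge => /orP[sa|bs].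
  by rewrite !prim_eq0 ?subrr// ?(ltW sa)// (le_trans _ (ltW sa))// gerBl.
rewrite prim_eq_right; last by rewrite (le_trans _ (ltW bs))// lerDl.
by rewrite prim_eq_right ?subrr// lerBrDr ltW.
Qed.

Lemma cutoff_le a b n s : a < b -> `|cutoff a b n s| <= b - a.
Proof.
move=> ab; rewrite cutoffE ler_norml.
have := prim_ge0 a b n s; have := prim_le n s ab.
have := prim_ge0 a b n (s - n.+1%:R); have := prim_le n (s - n.+1%:R) ab.
by move=> *; apply/andP; split; lra.
Qed.

Lemma smooth1_cutoff' a b n : smooth1 (fun s => bump a b n s - bump a b n (s - n.+1%:R)).
Proof.
have sb := smooth1_bump a b n.
rewrite (_ : (fun s => _) = (fun s => bump a b n s + (0 * s + -1) * bump a b n (1 * s + - n.+1%:R))).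
  apply: smooth1_add => //; apply: smooth1_mul; first exact: smooth1_affine.
  by apply: (@smooth1_comp (bump a b n) (fun s => 1 * s + - n.+1%:R)) => //; exact: smooth1_affine.
by apply/funext => s; rewrite mul0r add0r mulN1r mul1r.
Qed.

Let near_far (a s : R) : \forall n \near \oo, s - n.+1%:R <= a.
Proof.
near=> n; rewrite lerBlDr -lerBlDl; apply: (@le_trans _ _ n%:R); last by rewrite ler_nat.
by near: n; exact: nbhs_infty_ger.
Unshelve. all: by end_near. Qed.

Lemma cutoff_cvg a b s : cutoff a b n s @[n --> \oo] --> mass a b s.
Proof.
rewrite -[X in _ --> X]subr0.
rewrite [X in X @ _](_ : _ = fun n => prim a b n s - prim a b n (s - n.+1%:R)); last first.
  by apply/funext => n; rewrite cutoffE.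
apply: cvgB; first exact: prim_cvg.
apply: cvg_near_cst; near=> n; rewrite prim_eq0//.
by near: n; exact: near_far.
Unshelve. all: by end_near. Qed.

Lemma cutoff'_cvg a b s : (bump a b n s - bump a b n (s - n.+1%:R)) @[n --> \oo]
  --> (\1_(`]a, b[%classic) s : R).
Proof.
rewrite -[X in _ --> X]subr0; apply: cvgB; first exact: bump_cvg.
apply: cvg_near_cst; near=> n; rewrite bump_eq0// negb_and -!leNgt.
by apply/orP; left; near: n; exact: near_far.
Unshelve. all: by end_near. Qed.

(** The form of weak differentiability that serves both fields: X satisfies it directly, Y after
    composition with [flip]. M is a common bound for the supports of the three factors. *)
Definition weak_on_products (u g : R * R * R -> R) : Prop :=
  forall (phi phi' psi chi : R -> R) (M : R),
  smooth1 phi -> smooth1 phi' -> (forall x : R, is_derive x (1 : R) phi (phi' x)) ->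
  smooth1 psi -> smooth1 chi ->
  (forall s, M < `|s| -> phi s = 0) -> (forall s, M < `|s| -> psi s = 0) ->
  (forall s, M < `|s| -> chi s = 0) ->
  \int[@leb3 R]_p (u p * prod_test phi' psi chi p) =
  - \int[@leb3 R]_p (g p * prod_test phi psi chi p).

Lemma weak_on_productsX (u g : R * R * R -> R) :
  is_weak_lie_derivative (@vfX R) u g -> weak_on_products u g.
Proof.
move=> w phi phi' psi chi M sphi _ dphi spsi schi phi0 psi0 chi0.
rewrite -(w _ (prod_test_function sphi spsi schi phi0 psi0 chi0)).
by apply: eq_Rintegral => p _; rewrite (lie_prod_test _ spsi schi dphi).
Qed.

Lemma measurable_prod_test (phi psi chi : R -> R) :
  smooth1 phi -> smooth1 psi -> smooth1 chi ->
  measurable_fun setT (prod_test phi psi chi : space R -> line R).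
Proof.
have m h : smooth1 h -> measurable_fun setT (h : line R -> line R).
  by move=> sh; apply: continuous_measurable_fun; exact: smooth1_continuous.
move=> /m mphi /m mpsi /m mchi; apply: measurable_funM; first apply: measurable_funM.
- exact: measurableT_comp mphi (@measurable_xc R).
- exact: measurableT_comp mpsi (@measurable_yc R).
- apply: (measurableT_comp mchi); apply: measurable_funD.
    exact: measurable_tc.
  by apply: measurable_funM; [exact: measurable_xc|exact: measurable_yc].
Qed.

Lemma mp_Rintegral (f : space R -> space R) (h : space R -> line R) :
  measure_preserving (@leb3 R) f -> measurable_fun setT h ->
  \int[@leb3 R]_p h (f p) = \int[@leb3 R]_p h p.
Proof.
move=> mpf mh; rewrite /Rintegral; congr fine.
by apply: (mp_integral mpf (g := EFin \o h)); exact/measurable_EFinP.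
Qed.

(** [flip] is linear and carries the vector [vfY p] to [vfX (flip p)], so Y of a function composed
    with [flip] is X of that function, composed with [flip]. The integrals follow because [flip] is
    measure preserving and involutive. *)
Lemma weak_on_productsY (u g : R * R * R -> R) : in_L1 u -> in_L1 g ->
  is_weak_lie_derivative (@vfY R) u g ->
  weak_on_products (u \o @flip R) (g \o @flip R).
Proof.
move=> iu ig w phi phi' psi chi M sphi sphi' dphi spsi schi phi0 psi0 chi0.
have mu_ : measurable_fun setT u by apply/measurable_EFinP; exact: measurable_int iu.
have mg_ : measurable_fun setT g by apply/measurable_EFinP; exact: measurable_int ig.
have mf := (mp_flip R).1.
have tf : test_function (prod_test phi psi chi \o @flip R).
  apply: (@test_function_of_support _ M M (M + M * M)).
    by move=> n; apply: smooth3_Cn; apply: smooth3_flip; exact: smooth3_prod_test.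
  by move=> p /(prod_test_support phi0 psi0 chi0)[]; rewrite /flip /xc /yc /tc/= normrN.
have lie p : lie_derivative (@vfY R) (prod_test phi psi chi \o @flip R) p =
    prod_test phi' psi chi (flip p).
  rewrite /lie_derivative derive_flip -(lie_prod_test _ spsi schi dphi).
  by rewrite /lie_derivative /flip /vfY /vfX /xc /yc /tc/=.
have mP := measurable_prod_test sphi spsi schi.
have mP' := measurable_prod_test sphi' spsi schi.
transitivity (\int[@leb3 R]_p (u p * prod_test phi' psi chi (flip p))).
  rewrite -(mp_Rintegral (mp_flip R)); last first.
    by apply: measurable_funM => //; exact: measurableT_comp mu_ mf.
  by apply: eq_Rintegral => p _; rewrite /= flipK.
transitivity (- \int[@leb3 R]_p (g p * prod_test phi psi chi (flip p))).
  by rewrite -(w _ tf); apply: eq_Rintegral => p _; rewrite lie.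
congr (- _); rewrite -(mp_Rintegral (mp_flip R)); last first.
  by apply: measurable_funM => //; exact: measurableT_comp mP mf.
by apply: eq_Rintegral => p _; rewrite /= flipK.
Qed.

End smooth.

(** * Weak derivatives along lines *)

Section density.
Local Open Scope ereal_scope.
Context d (T : measurableType d) (R : realType).
Variables (mu : {measure set T -> \bar R}) (f : T -> \bar R).
Hypotheses (mf : measurable_fun setT f) (f0 : forall x, 0 <= f x).

Let density (A : set T) : \bar R := \int[mu]_(x in A) f x.

Let density0 : density set0 = 0.
Proof. exact: integral_set0. Qed.

Let density_ge0 A : 0 <= density A.
Proof. by apply: integral_ge0 => x _; exact: f0. Qed.

Let density_sigma_additive : semi_sigma_additive density.
Proof.
move=> F mF tF mUF; rewrite /density ge0_integral_bigcup//; last exact: measurable_funTS.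
by apply: is_cvg_nneseries => n _ _; exact: density_ge0.
Qed.

HB.instance Definition _ := isMeasure.Build _ _ _ density
  density0 density_ge0 density_sigma_additive.

Definition density_measure : {measure set T -> \bar R} := density.

End density.

(** * Functions determined by their integrals over boxes *)

Section boxes.
Local Open Scope ereal_scope.
Variable R : realType.

Definition box (a b c d e f : R) : set (space R) :=
  `]a, b[%classic `*` `]c, d[%classic `*` `]e, f[%classic.

Lemma measurable_box a b c d e f : measurable (box a b c d e f).
Proof. by apply: measurableX; [apply: measurableX|]. Qed.

Definition boxes : set (set (space R)) :=
  [set B | exists a b c d e f, B = box a b c d e f].

Lemma boxes_setI : setI_closed boxes.
Proof.
move=> _ _ [a [b [c [d [e [f ->]]]]]] [a' [b' [c' [d' [e' [f' ->]]]]]].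
exists (Num.max a a'), (Num.min b b'), (Num.max c c'), (Num.min d d'),
  (Num.max e e'), (Num.min f f').
apply/seteqP; split => -[[x y] t]; rewrite /box /= !in_itv/= !gt_max !lt_min.
  by move=> [] [[/andP[-> ->] /andP[-> ->]] /andP[-> ->]] [[/andP[-> ->] /andP[-> ->]] /andP[-> ->]].
by move=> [[/andP[/andP[-> ->] /andP[-> ->]] /andP[/andP[-> ->] /andP[-> ->]]]
  /andP[/andP[-> ->] /andP[-> ->]]].
Qed.

Definition cube (n : nat) : set (space R) :=
  box (- n%:R) n%:R (- n%:R) n%:R (- n%:R) n%:R.

Let nat_above (x : R) : exists n : nat, (x < n%:R)%R.
Proof. by exists (Num.truncn x).+1; exact: truncnS_gt. Qed.

Lemma bigcup_cube : \bigcup_n cube n = setT.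
Proof.
rewrite -subTset => -[[x y] t] _.
have [n hn] := nat_above (`|x| + `|y| + `|t|)%R.
have N (s : R) : (- `|s| <= s <= `|s|)%R by rewrite -ler_norml.
have := N x; have := N y; have := N t.
have := normr_ge0 x; have := normr_ge0 y; have := normr_ge0 t.
move=> t0 y0 x0 /andP[t1 t2] /andP[y1 y2] /andP[x1 x2].
by exists n => //; split; [split|]; rewrite /= in_itv/=; apply/andP; split; lra.
Qed.

(** A half-space above a level of one coordinate is a countable union of boxes growing with n. Hence
    the coordinates, and with them the identity map, are measurable for the sigma-algebra generated
    by the boxes. *)
Lemma measurable_boxes : @measurable _ (space R) = <<s boxes >>.
Proof.
apply/seteqP; split; last first.
  apply: smallest_sub; first exact: sigma_algebra_measurable.
  by move=> _ [a [b [c [d [e [f ->]]]]]]; exact: measurable_box.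
pose S := g_sigma_algebraType boxes.
have mcoord (l : R * R * R -> R) :
    (forall x : R, exists2 B : nat -> set (space R), (forall n, boxes (B n)) &
       l @^-1` `]x, +oo[%classic = \bigcup_n B n) ->
    measurable_fun setT (l : S -> line R).
  move=> hl; apply: (@measurability _ _ S (line R) setT l _ (RGenOInfty.measurableE R)).
  move=> _ [_ [x ->] <-]; rewrite setTI; have [B boxB ->] := hl x.
  by apply: bigcupT_measurable => n; exact: sub_sigma_algebra.
have far (x x' y' t' : R) : exists n : nat,
    [/\ (`|x| + `|x'| < n%:R)%R, (`|x| + `|y'| < n%:R)%R & (`|x| + `|t'| < n%:R)%R].
  have [n hn] := nat_above (`|x| + `|x'| + `|y'| + `|t'|)%R; exists n.
  have := normr_ge0 x'; have := normr_ge0 y'; have := normr_ge0 t'.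
  by move=> *; split; lra.
have inI (x s : R) (n : nat) : (`|x| + `|s| < n%:R -> (s < x + n%:R) /\ (- n%:R < s < n%:R))%R.
  have : (- `|s| <= s <= `|s|)%R by rewrite -ler_norml.
  have : (- `|x| <= x <= `|x|)%R by rewrite -ler_norml.
  have := normr_ge0 x; have := normr_ge0 s.
  by move=> ? ? /andP[? ?] /andP[? ?] ?; split; [lra|apply/andP; split; lra].
have mx : measurable_fun setT (@xc R : S -> line R).
  apply: mcoord => x.
  exists (fun n => box x (x + n%:R) (- n%:R) n%:R (- n%:R) n%:R) => [n|].
    by do 6 eexists.
  apply/seteqP; split => -[[x' y'] t']; rewrite /box /xc /= in_itv/= andbT.
    move=> xx; have [n [/inI[n1 _] /inI[_ n2] /inI[_ n3]]] := far x x' y' t'.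
    by exists n => //; rewrite /= !in_itv/= xx.
  by move=> [n _] /=; rewrite !in_itv/= => -[[/andP[]]].
have my : measurable_fun setT (@yc R : S -> line R).
  apply: mcoord => x.
  exists (fun n => box (- n%:R) n%:R x (x + n%:R) (- n%:R) n%:R) => [n|].
    by do 6 eexists.
  apply/seteqP; split => -[[x' y'] t']; rewrite /box /yc /= in_itv/= andbT.
    move=> xx; have [n [/inI[_ n1] /inI[n2 _] /inI[_ n3]]] := far x x' y' t'.
    by exists n => //; rewrite /= !in_itv/= xx.
  by move=> [n _] /=; rewrite !in_itv/= => -[[_ /andP[]]].
have mt : measurable_fun setT (@tc R : S -> line R).
  apply: mcoord => x.
  exists (fun n => box (- n%:R) n%:R (- n%:R) n%:R x (x + n%:R)) => [n|].
    by do 6 eexists.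
  apply/seteqP; split => -[[x' y'] t']; rewrite /box /tc /= in_itv/= andbT.
    move=> xx; have [n [/inI[_ n1] /inI[_ n2] /inI[n3 _]]] := far x x' y' t'.
    by exists n => //; rewrite /= !in_itv/= xx.
  by move=> [n _] /=; rewrite !in_itv/= => -[_ /andP[]].
have mid : measurable_fun setT (fun p : S => (xc p, yc p, tc p) : space R).
  by apply: measurable_fun_pair => //; exact: measurable_fun_pair.
move=> A mA; have := mid measurableT A mA; rewrite setTI.
by rewrite (_ : _ @^-1` A = A)//; apply/seteqP; split => -[[x y] t].
Qed.

(** The measures of densities f1 and f2 agree on the boxes, a generating family stable under
    intersection, hence on all Borel sets; finiteness on each [cube n] then gives equality almost
    everywhere there. *)
Lemma ae_eq_of_boxes (f1 f2 : space R -> \bar R) :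
  measurable_fun setT f1 -> (forall p, 0 <= f1 p) ->
  measurable_fun setT f2 -> (forall p, 0 <= f2 p) ->
  (forall n, \int[@leb3 R]_(p in cube n) f1 p < +oo) ->
  (forall B, boxes B -> \int[@leb3 R]_(p in B) f1 p = \int[@leb3 R]_(p in B) f2 p) ->
  {ae @leb3 R, forall p, f1 p = f2 p}.
Proof.
move=> mf1 f10 mf2 f20 foo fB.
have E A : measurable A -> \int[@leb3 R]_(p in A) f1 p = \int[@leb3 R]_(p in A) f2 p.
  move=> mA.
  apply: (@measure_unique _ _ _ boxes cube measurable_boxes boxes_setI _ bigcup_cube
    (density_measure (@leb3 R) mf1 f10) (density_measure (@leb3 R) mf2 f20)) => //.
  by move=> n; do 6 eexists.
have H n : ae_eq (@leb3 R) (cube n) f1 f2.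
  apply: integral_ae_eq => //.
  - exact: measurable_box.
  - apply/integrableP; split; first exact: measurable_funTS.
    by under eq_integral do rewrite gee0_abs//.
  - exact: measurable_funTS.
  - by move=> A _; exact: E.
have /ae_foralln : forall n, {ae @leb3 R, forall p, cube n p -> f1 p = f2 p} := H.
apply: filterS => p hp.
by have [n _ /hp] : (\bigcup_n cube n) p by rewrite bigcup_cube.
Qed.

End boxes.

(** * Integrals over half-lines *)

Section tail_integral.
Local Open Scope ereal_scope.
Variable R : realType.
Local Notation ind := (ind R).
Local Notation one a b := (\1_(`]a, b[%classic) : R -> R).

(** In the straightened coordinates ((y, tau), x): a window in (y, tau) times a profile h along the
    X-line. The profile will be the indicator of ]e, f[ or its primitive [mass e f]. *)
Definition wbox (a b c d : R) (h : R -> R) (q : space R) : R :=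
  (h q.2 * one a b q.1.1 * one c d q.1.2)%R.

Lemma measurable_wbox a b c d (h : line R -> line R) :
  measurable_fun setT h -> measurable_fun setT (wbox a b c d h : space R -> line R).
Proof.
move=> mh; apply: measurable_funM; first apply: measurable_funM.
- exact: measurableT_comp mh (@measurable_tc R).
- exact: measurableT_comp (measurable_indic _) (@measurable_xc R).
- exact: measurableT_comp (measurable_indic _) (@measurable_yc R).
Qed.

Lemma wbox_box a b c d e f (q : space R) :
  (wbox a b c d (one e f) q)%:E = ind (box a b c d e f) q.
Proof.
rewrite /ind /wbox !indicE -!natrM !mulnb; congr (_%:R%:E); congr nat_of_bool.
apply/andP/idP => [[/andP[/set_mem q2 /set_mem q11] /set_mem q12]|/set_mem[[]]].
  exact/mem_set.
by move=> ? ? ?; split; [apply/andP; split|]; exact/mem_set.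
Qed.

Lemma measurable_mass (e f : R) : measurable_fun setT (mass e f : line R -> line R).
Proof.
apply: (measurable_fun_cvg (h := cutoff e f)) => // [n|s _]; last exact: cutoff_cvg.
by apply: continuous_measurable_fun; exact/smooth1_continuous/smooth1_cutoff.
Qed.

Lemma mass_ge0 (e f s : R) : (0 <= mass e f s)%R.
Proof. by apply: Rintegral_ge0 => r _; rewrite indicE. Qed.

Lemma mass_le (e f s : R) : (e < f)%R -> (mass e f s <= f - e)%R.
Proof.
move=> ef; rewrite -(cvg_lim (@Rhausdorff R) (@cutoff_cvg R e f s)).
apply: limr_le; first by apply: cvgP; exact: cutoff_cvg.
by apply: nearW => n; rewrite (le_trans (ler_norm _))// cutoff_le.
Qed.

Let rayE (s : R) : `]-oo, s]%classic = [set r | (r <= s)%R].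
Proof. by apply/seteqP; split => x /=; rewrite in_itv. Qed.

Lemma massE (e f s : R) :
  (mass e f s)%:E = \int[leb R]_r (ind `]e, f[%classic r * ind [set r | (r <= s)%R] r).
Proof.
rewrite /mass /Rintegral fineK; last first.
  by apply: integrable_fin_num => //; exact: integrable_itvoo.
rewrite integral_mkcond; apply: eq_integral => r _.
rewrite patchE /ind !indicE.
have -> : (r \in `]-oo, s]%classic) = (r \in [set r | (r <= s)%R]) by rewrite rayE.
by case: ifP => _; rewrite ?mule1 ?mule0.
Qed.

(* The last coordinate is the parameter along the X-lines in the coordinates of
   [strX]: this is the integral of h on the half-line issued from q. *)
Definition tail (h : space R -> \bar R) (q : space R) : \bar R :=
  \int[leb R]_s (h (q.1, s) * ind [set z : plane R | (z.1 <= z.2)%R] (q.2, s)).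

Let mle : measurable [set z : plane R | (z.1 <= z.2)%R].
Proof.
have := measurable_fun_ler (measurable_fst : measurable_fun setT (fst : plane R -> line R)) measurable_snd.
move=> /(_ measurableT [set true] I); rewrite setTI.
by congr (measurable _); apply/seteqP; split => z.
Qed.

Lemma mtail_integrand (h : space R -> \bar R) : measurable_fun setT h ->
  measurable_fun setT (fun p : space R * line R =>
    h (p.1.1, p.2) * ind [set z : plane R | (z.1 <= z.2)%R] (p.1.2, p.2)).
Proof.
move=> mh; have m11 : measurable_fun setT (fun p : space R * line R => p.1.1 : plane R).
  exact: measurableT_comp measurable_fst measurable_fst.
have m12 : measurable_fun setT (fun p : space R * line R => p.1.2 : line R).
  exact: measurableT_comp measurable_snd measurable_fst.
apply: emeasurable_funM.
  apply: (measurableT_comp mh); apply: measurable_fun_pair => //; exact: measurable_snd.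
apply: (measurableT_comp (measurable_ind mle)).
by apply: measurable_fun_pair => //; exact: measurable_snd.
Qed.

Lemma tail_ge0 h q : (forall q, 0 <= h q) -> 0 <= tail h q.
Proof. by move=> h0; apply: integral_ge0 => s _; apply: mule_ge0 => //; exact: ind_ge0. Qed.

Lemma measurable_tail (h : space R -> \bar R) : measurable_fun setT h ->
  (forall q, 0 <= h q) -> measurable_fun setT (tail h).
Proof.
move=> mh h0.
apply: (@measurable_fun_fubini_tonelli_F _ _ _ _ _ (leb R) _ (mtail_integrand mh)) => p.
by apply: mule_ge0 => //; exact: ind_ge0.
Qed.

(** Tonelli on the half-plane r <= s: for fixed s, the r in ]e, f[ with r <= s have measure
    [mass e f s]. The primitive carried by the test function is thus exchanged for an integral of h
    over a half-line. *)
Lemma tail_box (h : space R -> \bar R) a b c d e f : measurable_fun setT h ->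
  (forall q, 0 <= h q) ->
  \int[@leb3 R]_(q in box a b c d e f) tail h q =
  \int[@leb3 R]_q (h q * (wbox a b c d (mass e f) q)%:E).
Proof.
move=> mh h0.
have mt := measurable_tail mh h0; have t0 q := @tail_ge0 h q h0.
have mb := @measurable_box R a b c d e f.
have mi := measurable_ind mb.
have mti : measurable_fun setT (fun q => tail h q * ind (box a b c d e f) q).
  exact: emeasurable_funM.
transitivity (\int[@leb3 R]_q (tail h q * ind (box a b c d e f) q)).
  rewrite integral_mkcond; apply: eq_integral => q _.
  by rewrite patchE /ind indicE; case: ifP => _; rewrite ?mule1 ?mule0.
rewrite (ge0_integral_leb3 mti); last first.
  by move=> q; apply: mule_ge0 => //; exact: ind_ge0.
have mw : measurable_fun setT (fun q => h q * (wbox a b c d (mass e f) q)%:E).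
  apply: emeasurable_funM => //; apply/measurable_EFinP.
  by apply: measurable_wbox; exact: measurable_mass.
have w0 m q : (forall s, (0 <= m s)%R) -> (0 <= wbox a b c d m q)%R.
  by move=> m0; rewrite /wbox !indicE !mulr_ge0.
rewrite (ge0_integral_leb3 mw); last first.
  by move=> q; rewrite mule_ge0// lee_fin w0// => s; exact: mass_ge0.
apply: eq_integral => -[y t] _.
have mhs : measurable_fun setT (fun s : line R => h (y, t, s)).
  exact: measurableT_comp mh (pair1_measurable (y, t)).
pose k : \bar R := (one a b y * one c d t)%:E.
have k0 : 0 <= k by rewrite lee_fin !indicE mulr_ge0.
have mF : measurable_fun setT (fun z : plane R =>
    h (y, t, z.2) * ind [set z : plane R | (z.1 <= z.2)%R] z * (k * ind `]e, f[%classic z.1)).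
  apply: emeasurable_funM.
    apply: emeasurable_funM; last exact: measurable_ind.
    exact: measurableT_comp mhs measurable_snd.
  apply: emeasurable_funM => //.
  by apply: (measurableT_comp (measurable_ind _)) => //; exact: measurable_fst.
have F0 (z : plane R) : 0 <= h (y, t, z.2) * ind [set z : plane R | (z.1 <= z.2)%R] z * (k * ind `]e, f[%classic z.1).
  by apply: mule_ge0; apply: mule_ge0 => //; exact: ind_ge0.
transitivity (\int[leb R]_r \int[leb R]_s
    (h (y, t, s) * ind [set z : plane R | (z.1 <= z.2)%R] (r, s) * (k * ind `]e, f[%classic r))).
  apply: eq_integral => r _; rewrite /tail/=.
  rewrite -wbox_box ge0_integralZr//.
  - congr (_ * _); rewrite /wbox/= /k /ind -EFinM; congr EFin.
    by ring.
  - apply: emeasurable_funM => //.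
    exact: measurableT_comp (measurable_ind mle) (pair1_measurable r).
  - by move=> s _; apply: mule_ge0 => //; exact: ind_ge0.
  - by apply: mule_ge0 => //; exact: ind_ge0.
rewrite (fubini_tonelli _ mF F0); apply: eq_integral => s _ /=.
rewrite /wbox/= -mulrA mulrC EFinM -/k massE -ge0_integralZl//.
- rewrite -ge0_integralZl//.
  + apply: eq_integral => r _; rewrite -muleA; congr (_ * _).
    rewrite muleCA; congr (_ * _); rewrite muleC; congr (_ * _).
  + apply: emeasurable_funM => //; apply: emeasurable_funM.
      exact: measurable_ind.
    by apply: measurable_ind; rewrite -rayE.
  + by move=> r _; apply: mule_ge0 => //; apply: mule_ge0; exact: ind_ge0.
- apply: emeasurable_funM; first exact: measurable_ind.
  by apply: measurable_ind; rewrite -rayE.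
- by move=> r _; apply: mule_ge0; exact: ind_ge0.
Qed.

End tail_integral.

(** * From test functions to a pointwise bound *)

Section weak_derivative.
Local Open Scope ereal_scope.
Variable R : realType.

(* In the coordinates ((y, tau), x) the vector field X is the derivative with
   respect to x. *)
Definition strX (q : space R) : space R :=
  (q.2, q.1.1, q.1.2 - q.2 * q.1.1)%R.
Definition unstrX (p : space R) : space R := (piX p, xc p).

Lemma strXK p : strX (unstrX p) = p.
Proof. by case: p => [[x y] t]; rewrite /strX /unstrX /piX /xc /yc /tc/= addrK. Qed.

Lemma mp_strX : measure_preserving (@leb3 R) strX.
Proof.
have := mp_comp (mp_comp (mp_swap23 R) (mp_swap12 R)) (mp_shear_mul (-1)).
by rewrite (_ : _ \o _ = strX)//; apply/funext => q; rewrite /strX /= mulN1r.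
Qed.

Lemma mp_unstrX : measure_preserving (@leb3 R) unstrX.
Proof.
have := mp_comp (mp_shear_mul 1) (mp_comp (mp_swap12 R) (mp_swap23 R)).
by rewrite (_ : _ \o _ = unstrX)//; apply/funext => q; rewrite /unstrX /piX /= mul1r.
Qed.

Let weighted_cvg (V : space R -> R) (h_ : nat -> space R -> R) (h : space R -> R) (C : R) :
  (@leb3 R).-integrable setT (EFin \o V) ->
  (forall n, measurable_fun setT (h_ n)) -> measurable_fun setT h ->
  (forall n p, `|h_ n p| <= C)%R -> (forall p, h_ n p @[n --> \oo] --> h p) ->
  (\int[@leb3 R]_p (V p * h_ n p))%R @[n --> \oo] --> (\int[@leb3 R]_p (V p * h p))%R.
Proof.
move=> iV mh_ mh hC hh.
have mV : measurable_fun setT V by apply/measurable_EFinP; exact: measurable_int iV.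
have iC : (@leb3 R).-integrable setT (fun p => C%:E * `|V p|%:E).
  by apply: integrableZl => //; exact: integrable_abse iV.
have [] // := @dominated_convergence _ _ R (@leb3 R) setT measurableT
  (fun n p => (V p * h_ n p)%:E) (fun p => (V p * h p)%:E) (fun p => C%:E * `|V p|%:E).
- by move=> n; apply/measurable_EFinP; exact: measurable_funM.
- by apply/measurable_EFinP; exact: measurable_funM.
- apply: aeW => p _; apply/fine_cvgP; split; first exact: nearW.
  by apply: cvgMr; exact: hh.
- apply: aeW => p n _ /=; rewrite lee_fin normrM mulrC.
  by rewrite ler_wpM2r.
move=> iVh _ cv; apply: fine_cvg; rewrite fineK//.
exact: integrable_fin_num.
Qed.

Variables (u g : space R -> R).
Hypotheses (iu : in_L1 u) (ig : in_L1 g).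
Hypothesis wug : weak_on_products u g.

Let U q := u (strX q).
Let G q := g (strX q).
Let iU : (@leb3 R).-integrable setT (EFin \o U) := mp_integrable mp_strX iu.
Let iG : (@leb3 R).-integrable setT (EFin \o G) := mp_integrable mp_strX ig.

Local Notation one a b := (\1_(`]a, b[%classic) : R -> R).

(** Limit of the weak identity for phi = [cutoff e f n] and bumps in the other two factors. The
    derivative of the cutoff tends to the indicator of ]e, f[ and the cutoff to [mass e f], both
    boundedly, while u and g are integrable. *)
Lemma weak_box (a b c d e f : R) : (e < f)%R ->
  (\int[@leb3 R]_q (U q * wbox a b c d (one e f) q))%R =
  (- \int[@leb3 R]_q (G q * wbox a b c d (mass e f) q))%R.
Proof.
move=> ef.
have mu_ : measurable_fun setT u by apply/measurable_EFinP; exact: measurable_int iu.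
have mg_ : measurable_fun setT g by apply/measurable_EFinP; exact: measurable_int ig.
have mx : measurable_fun setT (fun q : space R => q.2 : line R) := @measurable_tc R.
have my : measurable_fun setT (fun q : space R => q.1.1 : line R) := @measurable_xc R.
have mt : measurable_fun setT (fun q : space R => q.1.2 : line R) := @measurable_yc R.
pose w (h : R -> R) n (q : space R) : R := (h q.2 * bump a b n q.1.1 * bump c d n q.1.2)%R.
pose dphi n (s : R) : R := (bump e f n s - bump e f n (s - n.+1%:R))%R.
have mw h n : measurable_fun setT h -> measurable_fun setT (w h n).
  move=> mh; apply: measurable_funM; first apply: measurable_funM.
  - exact: measurableT_comp mh mx.
  - exact: measurableT_comp (measurable_bump a b n) my.
  - exact: measurableT_comp (measurable_bump c d n) mt.
have mcut n : measurable_fun setT (cutoff e f n).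
  by apply: continuous_measurable_fun; exact/smooth1_continuous/smooth1_cutoff.
have mdphi n : measurable_fun setT (dphi n).
  by apply: continuous_measurable_fun; exact/smooth1_continuous/smooth1_cutoff'.
have mmass := measurable_mass e f.
have mone := measurable_indic (measurable_itv `]e, f[ : measurable (`]e, f[%classic : set (line R))).
have wE n : (\int[@leb3 R]_q (U q * w (dphi n) n q))%R = (- \int[@leb3 R]_q (G q * w (cutoff e f n) n q))%R.
  (* [cutoff e f n] is supported in [e, f + n + 1], whence the last term of M. *)
  pose M := (`|a| + `|b| + `|c| + `|d| + `|e| + `|f| + n.+1%:R)%R.
  have bump0 (a' b' s : R) : (`|a'| <= M -> `|b'| <= M -> M < `|s| -> bump a' b' n s = 0)%R.
    move=> aM bM Ms; apply: bump_eq0; apply/negP => /andP[as_ sb].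
    have : (`|s| <= M)%R.
      rewrite ler_norml (le_trans _ (ltW as_)) ?(le_trans (ltW sb))//.
        by rewrite (le_trans (ler_norm _)).
      by move: aM; rewrite ler_norml => /andP[].
    by rewrite leNgt Ms.
  have pa := normr_ge0 a; have pb := normr_ge0 b; have pc := normr_ge0 c.
  have pd := normr_ge0 d; have pe := normr_ge0 e; have pf := normr_ge0 f.
  have n0 : (0 <= n.+1%:R :> R)%R by [].
  have cut0 s : (M < `|s| -> cutoff e f n s = 0)%R.
    move=> Ms; apply: cutoff_eq0 => //; apply/negP => /andP[es sf].
    have : (`|s| <= M)%R.
      rewrite ler_norml; apply/andP; split.
        have : (- `|e| <= e)%R by rewrite lerNnormlW.
        by rewrite /M; lra.
      by have := ler_norm f; rewrite /M; lra.
    by rewrite leNgt Ms.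
  have := @wug (cutoff e f n) (dphi n) (bump a b n) (bump c d n) M
    (smooth1_cutoff e f n) (smooth1_cutoff' e f n) (is_derive_cutoff e f n)
    (smooth1_bump a b n) (smooth1_bump c d n) cut0.
  have wP h q : prod_test h (bump a b n) (bump c d n) (strX q) = w h n q.
    by rewrite /prod_test /w /strX /xc /yc /tc/= subrK.
  rewrite -(mp_Rintegral mp_strX); last first.
    apply: measurable_funM => //; apply: measurable_prod_test; try exact: smooth1_bump.
    exact: smooth1_cutoff'.
  rewrite -[X in _ = (- X)%R](mp_Rintegral mp_strX); last first.
    apply: measurable_funM => //; apply: measurable_prod_test; try exact: smooth1_bump.
    exact: smooth1_cutoff.
  under eq_Rintegral do rewrite wP.
  under [X in _ = (- X)%R]eq_Rintegral do rewrite wP.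
  apply.
    by move=> s; apply: bump0; rewrite /M; lra.
  by move=> s; apply: bump0; rewrite /M; lra.
have b1 (a' b' : R) n s : (`|bump a' b' n s| <= 1)%R.
  by rewrite ger0_norm ?bump_ge0// bump_le1.
have cvU : (\int[@leb3 R]_q (U q * w (dphi n) n q))%R @[n --> \oo] -->
    (\int[@leb3 R]_q (U q * wbox a b c d (one e f) q))%R.
  apply: (@weighted_cvg _ _ _ 2) => //.
  - by move=> n; exact: mw.
  - exact: measurable_wbox.
  - move=> n q; rewrite /w normrM normrM -[leRHS]mulr1 ler_pM// -[leRHS]mulr1 ler_pM//.
    by rewrite (le_trans (ler_normB _ _))// (_ : 2 = 1 + 1)%R// lerD.
  - move=> q; apply: cvgM; last exact: bump_cvg.
    by apply: cvgM; [exact: cutoff'_cvg|exact: bump_cvg].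
have cvG : (- \int[@leb3 R]_q (G q * w (cutoff e f n) n q))%R @[n --> \oo] -->
    (- \int[@leb3 R]_q (G q * wbox a b c d (mass e f) q))%R.
  apply: cvgN; apply: (@weighted_cvg _ _ _ (f - e)) => //.
  - by move=> n; exact: mw.
  - exact: measurable_wbox.
  - move=> n q; rewrite /w normrM normrM -[leRHS]mulr1 ler_pM// -[leRHS]mulr1 ler_pM//.
    exact: cutoff_le.
  - move=> q; apply: cvgM; last exact: bump_cvg.
    by apply: cvgM; [exact: cutoff_cvg|exact: bump_cvg].
have := cvg_unique (@Rhausdorff R) cvU; apply.
rewrite (_ : (fun n => _) = (fun n => (- \int[@leb3 R]_q (G q * w (cutoff e f n) n q))%R))//.
by apply/funext => n; exact: wE.
Qed.

Let wbox_ge0 a b c d (m : R -> R) (q : space R) : (forall s, (0 <= m s)%R) -> (0 <= wbox a b c d m q)%R.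
Proof. by move=> m0; rewrite /wbox !indicE !mulr_ge0. Qed.

Let wbox_le a b c d (m : R -> R) (q : space R) C : (forall s, (0 <= m s <= C)%R) -> (wbox a b c d m q <= C)%R.
Proof.
move=> m0; have C0 : (0 <= C)%R by have /andP[m1 m2] := m0 0%R; exact: le_trans m2.
have /andP[m1 m2] := m0 q.2.
rewrite /wbox !indicE; case: (_ \in _); case: (_ \in _); by rewrite ?mulr1 ?mulr0.
Qed.

Let weighted (V : space R -> R) (w : space R -> R) C :
  (@leb3 R).-integrable setT (EFin \o V) -> measurable_fun setT w ->
  (forall q, 0 <= w q <= C)%R ->
  [/\ \int[@leb3 R]_q ((EFin \o V)^\+ q * (w q)%:E) \is a fin_num,
     \int[@leb3 R]_q ((EFin \o V)^\- q * (w q)%:E) \is a fin_num &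
  ((\int[@leb3 R]_q (V q * w q))%R)%:E =
    \int[@leb3 R]_q ((EFin \o V)^\+ q * (w q)%:E) -
    \int[@leb3 R]_q ((EFin \o V)^\- q * (w q)%:E)].
Proof.
move=> iV mw wC.
have mV : measurable_fun setT V by apply/measurable_EFinP; exact: measurable_int iV.
have iC : (@leb3 R).-integrable setT (fun p => C%:E * `|V p|%:E).
  by apply: integrableZl => //; exact: integrable_abse iV.
have iVw : (@leb3 R).-integrable setT (fun q => (V q * w q)%:E).
  apply: le_integrable iC => //.
    by apply/measurable_EFinP; exact: measurable_funM.
  move=> q _ /=; rewrite lee_fin normrM mulrC.
  have /andP[w0 w1] := wC q.
  by rewrite normrM normr_id ler_wpM2r// !ger0_norm// (le_trans w0).
have pE : (fun q => (V q * w q)%:E)^\+ = (fun q => (EFin \o V)^\+ q * (w q)%:E).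
  apply/funext => q; rewrite !funeposE /= EFinM.
  have /andP[w0 _] := wC q.
  by rewrite maxe_pMl ?mul0e// lee_fin.
have nE : (fun q => (V q * w q)%:E)^\- = (fun q => (EFin \o V)^\- q * (w q)%:E).
  apply/funext => q; rewrite !funenegE /= -mulNr EFinM.
  have /andP[w0 _] := wC q.
  by rewrite maxe_pMl ?mul0e// lee_fin.
rewrite -pE -nE.
split.
- by apply: integrable_fin_num => //; exact: integrable_funepos.
- by apply: integrable_fin_num => //; exact: integrable_funeneg.
- by rewrite /Rintegral fineK; [rewrite integralE|exact: integrable_fin_num].
Qed.

Let up := (EFin \o U)^\+.
Let un := (EFin \o U)^\-.
Let gp := (EFin \o G)^\+.
Let gn := (EFin \o G)^\-.

(* U = - (integral of G over the half-line), written without subtraction because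
   the four terms may be infinite. *)
Lemma weak_tail : {ae @leb3 R, forall q, up q + tail gp q = un q + tail gn q}.
Proof.
have mU : measurable_fun setT (EFin \o U) := measurable_int _ iU.
have mG : measurable_fun setT (EFin \o G) := measurable_int _ iG.
have mup : measurable_fun setT up by exact: measurable_funepos.
have mun : measurable_fun setT un by exact: measurable_funeneg.
have mgp : measurable_fun setT gp by exact: measurable_funepos.
have mgn : measurable_fun setT gn by exact: measurable_funeneg.
have up0 q : 0 <= up q := funepos_ge0 _ q.
have un0 q : 0 <= un q := funeneg_ge0 _ q.
have gp0 q : 0 <= gp q := funepos_ge0 _ q.
have gn0 q : 0 <= gn q := funeneg_ge0 _ q.
(* The weights are bounded and U, G are integrable, so the four integrals on a box are finite and
   the signed identity [weak_box] can be rearranged into sums. *)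
have key a b c d e f : (e < f)%R ->
    [/\ \int[@leb3 R]_(q in box a b c d e f) (up q + tail gp q) \is a fin_num &
    \int[@leb3 R]_(q in box a b c d e f) (up q + tail gp q) =
    \int[@leb3 R]_(q in box a b c d e f) (un q + tail gn q)].
  move=> ef.
  have mB := @measurable_box R a b c d e f.
  have D (h1 h2 : space R -> \bar R) : measurable_fun setT h1 -> (forall q, 0 <= h1 q) ->
      measurable_fun setT h2 -> (forall q, 0 <= h2 q) ->
      \int[@leb3 R]_(q in box a b c d e f) (h1 q + tail h2 q) =
      \int[@leb3 R]_(q in box a b c d e f) h1 q + \int[@leb3 R]_(q in box a b c d e f) tail h2 q.
    move=> mh1 h10 mh2 h20; apply: ge0_integralD => //.
    - exact: measurable_funTS.
    - by move=> q _; exact: tail_ge0.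
    - by apply: measurable_funTS; exact: measurable_tail.
  rewrite (D _ _ mup up0 mgp gp0) (D _ _ mun un0 mgn gn0) {D}.
  rewrite (tail_box _ _ _ _ _ _ mgp gp0) (tail_box _ _ _ _ _ _ mgn gn0).
  have boxE (h : space R -> \bar R) : \int[@leb3 R]_(q in box a b c d e f) h q =
      \int[@leb3 R]_q (h q * (wbox a b c d (one e f) q)%:E).
    rewrite integral_mkcond; apply: eq_integral => q _.
    rewrite wbox_box patchE /ind indicE; by case: ifP => _; rewrite ?mule1 ?mule0.
  rewrite (boxE up) (boxE un).
  have m1 : measurable_fun setT (wbox a b c d (one e f) : space R -> R).
    by apply: measurable_wbox; exact: measurable_indic.
  have m2 : measurable_fun setT (wbox a b c d (mass e f) : space R -> R).
    by apply: measurable_wbox; exact: measurable_mass.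
  have w1 q : (0 <= wbox a b c d (one e f) q <= 1)%R.
    have h s : (0 <= one e f s <= 1)%R by rewrite indicE; case: (_ \in _); rewrite /= ?lexx ?ler01.
    by rewrite wbox_ge0 ?wbox_le// => s; have /andP[] := h s.
  have w2 q : (0 <= wbox a b c d (mass e f) q <= f - e)%R.
    have h s : (0 <= mass e f s <= f - e)%R by rewrite mass_ge0 mass_le.
    by rewrite wbox_ge0 ?wbox_le// => s; have /andP[] := h s.
  have [u1 u2 u3] := weighted iU m1 w1.
  have [g1 g2 g3] := weighted iG m2 w2.
  split; first by rewrite fin_numD u1 g1.
  have := congr1 EFin (weak_box a b c d ef); rewrite EFinN u3 g3.
  move: u1 u2 g1 g2; rewrite -/up -/un -/gp -/gn.
  set A := integral _ _ _; set B := integral _ _ _; set C := integral _ _ _; set D := integral _ _ _.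
  case: A => // A _; case: B => // B _; case: C => // C _; case: D => // D _.
  by rewrite -!EFinB -EFinN => -[] ?; rewrite -!EFinD; congr EFin; lra.
have box0 a b c d e f : ~~ (e < f)%R -> box a b c d e f = set0.
  rewrite -leNgt => fe; rewrite -subset0 => -[z t] [_] /=; rewrite in_itv/= => /andP[et tf].
  by have := lt_trans et tf; rewrite ltNge fe.
apply: ae_eq_of_boxes.
- by apply: emeasurable_funD => //; exact: measurable_tail.
- by move=> q; rewrite adde_ge0// tail_ge0.
- by apply: emeasurable_funD => //; exact: measurable_tail.
- by move=> q; rewrite adde_ge0// tail_ge0.
(* The cube of index 0 is empty and escapes [key]. *)
- move=> n; have [n0|n0] := boolP ((- n%:R < n%:R :> R)%R).
    by have [/fin_numP[_ ?] _] := key (- n%:R)%R n%:R (- n%:R)%R n%:R (- n%:R)%R n%:R n0; rewrite ltey.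
  by rewrite /cube box0// integral_set0.
- move=> _ [a [b [c [d [e [f ->]]]]]].
  have [ef|/box0 ->] := boolP (e < f)%R; last by rewrite !integral_set0.
  by have [] := key a b c d e f ef.
Qed.

(** Where U >= 0, [un] vanishes and U is at most [tail gn]; where U < 0 the roles are exchanged.
    Extending the half-line to the whole line makes the bound depend on the line only. *)
Lemma weak_le_line : {ae @leb3 R, forall q, `|U q|%:E <= \int[leb R]_s `|G (q.1, s)|%:E}.
Proof.
have mG : measurable_fun setT (EFin \o G) := measurable_int _ iG.
have le1 (h : space R -> \bar R) q : measurable_fun setT h -> (forall q, 0 <= h q) ->
    (forall q, h q <= `|G q|%:E) -> tail h q <= \int[leb R]_s `|G (q.1, s)|%:E.
  move=> mh h0 hG; apply: ge0_le_integral => //.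
  - by move=> s _; apply: mule_ge0 => //; exact: ind_ge0.
  - exact: (measurableT_comp (mtail_integrand mh) (pair1_measurable q)).
  - apply/measurable_EFinP; apply: measurableT_comp => //.
    by apply/measurable_EFinP; exact: (measurableT_comp mG (pair1_measurable q.1)).
  - move=> s _; apply: le_trans (hG (q.1, s)).
    by rewrite /ind indicE; case: (_ \in _); rewrite ?mule1 ?mule0.
apply: filterS weak_tail => q E.
have gpG q' : gp q' <= `|G q'|%:E.
  by rewrite /gp funeposE /= ge_max !lee_fin ler_norm normr_ge0.
have gnG q' : gn q' <= `|G q'|%:E.
  by rewrite /gn funenegE /= ge_max !lee_fin -normrN ler_norm normr_ge0.
have gp0 q' : 0 <= gp q' := funepos_ge0 _ q'.
have gn0 q' : 0 <= gn q' := funeneg_ge0 _ q'.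
have [U0|U0] := leP 0%R (U q).
  apply: le_trans (le1 gn q (measurable_funeneg mG) gn0 gnG).
  have <- : up q + tail gp q = tail gn q.
    by rewrite E /un funenegE /= max_r ?add0e// lee_fin oppr_le0.
  rewrite ger0_norm// /up funeposE /= max_l ?lee_fin//.
  by apply: leeDl; exact: tail_ge0.
apply: le_trans (le1 gp q (measurable_funepos mG) gp0 gpG).
have -> : tail gp q = un q + tail gn q.
  by rewrite -E /up funeposE /= max_r ?add0e// lee_fin ltW.
rewrite ltr0_norm// /un funenegE /= max_l; last by rewrite lee_fin oppr_ge0 ltW.
by apply: leeDl; exact: tail_ge0.
Qed.

End weak_derivative.

Section weak_bounds.
Local Open Scope ereal_scope.
Variable R : realType.

Definition line_integralX (g : space R -> R) (z : plane R) : \bar R :=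
  \int[leb R]_s `|g (strX (z, s))|%:E.

Lemma weak_on_products_le (u g : space R -> R) : in_L1 u -> in_L1 g ->
  weak_on_products u g ->
  {ae @leb3 R, forall p, `|u p|%:E <= line_integralX g (piX p)}.
Proof.
move=> iu ig w; have := mp_ae (mp_unstrX R) (weak_le_line iu ig w).
by apply: filterS => p; rewrite strXK.
Qed.

Lemma weakX_le (u g : space R -> R) : in_L1 u -> in_L1 g ->
  is_weak_lie_derivative (@vfX R) u g ->
  {ae @leb3 R, forall p, `|u p|%:E <= line_integralX g (piX p)}.
Proof.
by move=> iu ig w; apply: weak_on_products_le => //; exact: weak_on_productsX.
Qed.

Lemma measurable_line_integralX (g : space R -> R) : in_L1 g ->
  measurable_fun setT (line_integralX g).
Proof.
move=> ig; have /measurable_int mG := mp_integrable (mp_strX R) ig.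
apply: (@measurable_fun_fubini_tonelli_F _ _ _ _ _ (leb R) (fun q => `|g (strX q)|%:E)) => [|q].
  by apply/measurable_EFinP; apply: measurableT_comp => //; exact/measurable_EFinP.
by rewrite lee_fin.
Qed.

Lemma integral_line_integralX (g : space R -> R) : in_L1 g ->
  \int[@leb2 R]_z line_integralX g z = \int[@leb3 R]_p `|g p|%:E.
Proof.
move=> ig; have /measurable_int mg := ig.
have /measurable_int mG := mp_integrable (mp_strX R) ig.
have m1 : measurable_fun setT (fun p : space R => `|g p|%:E).
  by apply/measurable_EFinP; apply: measurableT_comp => //; exact/measurable_EFinP.
have m2 : measurable_fun setT (fun p : space R => `|g (strX p)|%:E).
  by apply/measurable_EFinP; apply: measurableT_comp => //; exact/measurable_EFinP.
by rewrite -(mp_ge0_integral (mp_strX R) m1)// (ge0_integral_leb3 m2).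
Qed.

Lemma in_L1_flip (u : space R -> R) : in_L1 u -> in_L1 (u \o @flip R).
Proof. exact: (mp_integrable (mp_flip R)). Qed.

(** [piX (flip p)] equals [oppsnd (piY p)]: this reflection translates X-projections of flipped
    points into Y-projections. *)
Definition oppsnd (z : plane R) : plane R := (z.1, - z.2)%R.

Lemma weakY_le (u g : space R -> R) : in_L1 u -> in_L1 g ->
  is_weak_lie_derivative (@vfY R) u g ->
  {ae @leb3 R, forall p, `|u p|%:E <= line_integralX (g \o @flip R) (oppsnd (piY p))}.
Proof.
move=> iu ig w.
have := weak_on_products_le (in_L1_flip iu) (in_L1_flip ig) (weak_on_productsY iu ig w).
move=> /(mp_ae (mp_flip R)); apply: filterS => p /=; rewrite flipK.
congr (_ <= line_integralX _ _).
by rewrite /oppsnd /piX /piY /flip /xc /yc /tc/= opprB addrC mulrC.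
Qed.

End weak_bounds.

(** * Weak-type estimate and embedding *)

Section levels.
Local Open Scope ereal_scope.
Variable R : realType.
Local Notation ind := (ind R).

Lemma markov_ineq d (T : measurableType d) (mu : {measure set T -> \bar R})
    (f : T -> \bar R) (c : R) :
  measurable_fun setT f -> (forall x, 0 <= f x) -> (0 < c)%R ->
  c%:E * mu [set x | c%:E <= f x] <= \int[mu]_x f x.
Proof.
move=> mf f0 c0.
have mA : measurable [set x | c%:E <= f x].
  by rewrite -[X in measurable X]setTI; exact: emeasurable_fun_c_infty.
rewrite -(integral_ind _ mA) -ge0_integralZl//; first last.
- by rewrite lee_fin ltW.
- by move=> x _; exact: ind_ge0.
- exact: measurable_ind.
apply: ge0_le_integral => //.
- by move=> x _; apply: mule_ge0; [rewrite lee_fin ltW|exact: ind_ge0].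
- by apply: emeasurable_funM => //; exact: measurable_ind.
move=> x _; rewrite /ind indicE.
have [/set_mem xA|_] := boolP (x \in _); first by rewrite mule1.
by rewrite mule0.
Qed.

Lemma ge0_integral_oppsnd (f : plane R -> \bar R) :
  measurable_fun setT f -> (forall z, 0 <= f z) ->
  \int[@leb2 R]_z f (oppsnd z) = \int[@leb2 R]_z f z.
Proof.
move=> mf f0.
have mo : measurable_fun setT (@oppsnd R).
  apply: measurable_fun_pair; first exact: measurable_fst.
  by apply: measurable_funN; exact: measurable_snd.
rewrite [RHS](ge0_integral_leb2 mf f0).
rewrite [LHS](ge0_integral_leb2 (measurableT_comp mf mo) (fun z => f0 _)).
apply: eq_integral => x _ /=.
apply: (@ge0_integral_opp R (fun y => f (x, y))) => //.
exact: measurableT_comp mf (pair1_measurable x).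
Qed.

Lemma line_integralX_ge0 g (z : plane R) : 0 <= line_integralX g z.
Proof. by apply: integral_ge0 => s _; rewrite lee_fin. Qed.

(* The choice a = (N / l)^(1/3) gives 5 (N / l)^(4/3). *)
Lemma weak_type (u g1 g2 : space R -> R) (N l a : R) :
  in_L1 u -> is_weak_hgrad u (g1, g2) ->
  \int[@leb3 R]_p `|g1 p|%:E <= N%:E -> \int[@leb3 R]_p `|g2 p|%:E <= N%:E ->
  (0 < l)%R -> (0 < a)%R ->
  leb3 [set p : space R | (l <= `|u p|)%R] <=
    (a * (N / l) + 4 / a ^+ 2 * (N / l * (N / l)))%:E.
Proof.
move=> iu [/= i1 i2 w1 w2] N1 N2 l0 a0.
have mu_ : measurable_fun setT u by apply/measurable_EFinP; exact: measurable_int iu.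
have m1 := measurable_line_integralX i1.
have m2 := measurable_line_integralX (in_L1_flip i2).
have mo : measurable_fun setT (@oppsnd R).
  apply: measurable_fun_pair; first exact: measurable_fst.
  by apply: measurable_funN; exact: measurable_snd.
have m2o := measurableT_comp m2 mo.
pose A := [set z | l%:E <= line_integralX g1 z].
pose B := [set z | l%:E <= line_integralX (g2 \o @flip R) (oppsnd z)].
have mA : measurable A.
  by rewrite -[X in measurable X]setTI; exact: emeasurable_fun_c_infty.
have mB : measurable B.
  by rewrite -[X in measurable X]setTI; exact: (emeasurable_fun_c_infty _ m2o).
have bound (x : \bar R) : 0 <= x -> l%:E * x <= N%:E -> x <= (N / l)%:E.
  by move=> x0; rewrite EFinM lee_pdivlMr// muleC.
have leA : leb2 A <= (N / l)%:E.
  apply: bound => //; apply: le_trans (markov_ineq _ m1 (line_integralX_ge0 g1) l0) _.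
  by rewrite integral_line_integralX.
have leB : leb2 B <= (N / l)%:E.
  apply: bound => //; apply: le_trans (markov_ineq _ m2o (fun z => line_integralX_ge0 _ _) l0) _.
  rewrite (ge0_integral_oppsnd m2 (line_integralX_ge0 _)) integral_line_integralX; last exact: in_L1_flip.
  have mg2 : measurable_fun setT (fun p : space R => `|g2 p|%:E).
    by apply/measurable_EFinP; apply: measurableT_comp => //; apply/measurable_EFinP; exact: measurable_int i2.
  by rewrite (mp_ge0_integral (mp_flip R) mg2).
have mE : measurable [set p : space R | (l <= `|u p|)%R].
  have : measurable_fun setT (fun p : space R => `|u p|%R) by exact: measurableT_comp.
  move=> /(_ measurableT `[l, +oo[%classic (measurable_itv _)); rewrite setTI.
  by congr measurable; apply/seteqP; split => p /=; rewrite in_itv/= andbT.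
have [N0 [mN0 N00 sub]] : (@leb3 R).-negligible
    (~` [set p : space R | `|u p|%:E <= line_integralX g1 (piX p) /\
      `|u p|%:E <= line_integralX (g2 \o @flip R) (oppsnd (piY p))]).
  exact: (@filterI _ _ (ae_filter_ringOfSetsType (@leb3 R)) _ _
    (weakX_le iu i1 w1) (weakY_le iu i2 w2)).
have mW : measurable [set p : space R | A (piX p) /\ B (piY p)].
  have -> : [set p : space R | A (piX p) /\ B (piY p)] = ((@piX R) @^-1` A) `&` ((@piY R) @^-1` B) by [].
  apply: measurableI.
    by rewrite -[_ @^-1` _]setTI; exact: measurable_piX.
  by rewrite -[_ @^-1` _]setTI; exact: measurable_piY.
(* Almost every point of the level set projects into A and B; N0 contains the exceptions. *)
apply: (@le_trans _ _ (leb3 ([set p : space R | A (piX p) /\ B (piY p)] `|` N0))).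
  apply: le_measure; rewrite ?inE//; first exact: measurableU.
  move=> p /= lup; have [pN|pN] := pselect (N0 p); first by right.
  left; have [h1 h2] : `|u p|%:E <= line_integralX g1 (piX p) /\
      `|u p|%:E <= line_integralX (g2 \o @flip R) (oppsnd (piY p)).
    by apply: contrapT => h; apply: pN; exact: sub.
  by split; [apply: le_trans h1|apply: le_trans h2]; rewrite lee_fin.
rewrite measureU0//.
apply: le_trans (loomis_whitney mA mB a0) _.
rewrite EFinD (EFinM a) (EFinM (4 / a ^+ 2)) (EFinM (N / l)); apply: leeD.
  by apply: lee_pmul => //; rewrite lee_fin ltW.
apply: lee_pmul => //.
- by rewrite lee_fin divr_ge0// sqr_ge0.
- by rewrite mule_ge0.
- by have A0 := measure_ge0 (@leb2 R) A; exact: (lee_pmul A0 A0 leA leA).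
Qed.

Lemma geometric_sum_le (c r : R) (n : nat) : (0 <= c)%R -> (0 <= r < 1)%R ->
  (\sum_(0 <= k < n) c * r ^+ k <= c / (1 - r))%R.
Proof.
move=> c0 /andP[r0 r1].
have := @geometric_seriesE R c r; rewrite lt_eqF// => /(_ isT) /(congr1 (@^~ n)).
rewrite /series/= => ->.
apply: ler_wpM2r; first by rewrite invr_ge0 subr_ge0 ltW.
by rewrite -[leRHS]mulr1; apply: ler_wpM2l => //; rewrite gerBl exprn_ge0.
Qed.

(** From e^d >= 1 + d one gets 1 - e^(-d) >= d / (1 + d), which is at least d / 2 for d <= 1. *)
Lemma expR_inv_bound (d : R) : (0 < d <= 1)%R -> ((1 - expR (- d))^-1 <= 2 / d)%R.
Proof.
move=> /andP[d0 d1].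
have h : (expR (- d) <= (1 + d)^-1)%R.
  by rewrite expRN lef_pV2 ?posrE ?expR_gt0 ?expR_ge1Dx// addr_gt0.
have d2 : (d / 2 <= 1 - (1 + d)^-1)%R.
  have -> : (1 - (1 + d)^-1 = d / (1 + d))%R by field; lra.
  by apply: ler_wpM2l; [exact: ltW|rewrite lef_pV2 ?posrE; lra].
rewrite -invf_div lef_pV2 ?posrE ?divr_gt0//; first by lra.
by have : (0 < d / 2)%R; [rewrite divr_gt0|lra].
Qed.

(** A discrete layer-cake bound. For v <= 1 the term v suffices since q >= 1; otherwise the single
    term k = floor (ln v) does, because e^k <= v < e^(k+1). *)
Lemma powR_level_le (v q : R) : (0 <= v)%R -> (1 <= q)%R ->
  (v `^ q)%:E <= v%:E +
    \sum_(k <oo) (expR (k.+1%:R * q))%:E * ((expR k%:R <= v)%R%:R)%:E.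
Proof.
move=> v0 q1.
have t0 (k : nat) : 0 <= (expR (k.+1%:R * q))%:E * ((expR k%:R <= v)%R%:R : R)%:E.
  by rewrite mule_ge0 ?lee_fin ?expR_ge0.
have [v1|v1] := leP v 1%R.
  rewrite -[leLHS]adde0; apply: leeD; last by apply: nneseries_ge0.
  rewrite lee_fin; move: v0; rewrite le_eqVlt => /predU1P[<-|v0].
    by rewrite powR0// gt_eqF// (lt_le_trans _ q1).
  by apply: ge1r_powR; rewrite ?v0.
have lv0 : (0 <= ln v)%R by rewrite ln_ge0 ?ltW.
pose k := Num.truncn (ln v).
have /andP[k1 k2] := Num.Theory.truncn_itv lv0.
have vE : v = expR (ln v) by rewrite lnK// posrE (lt_trans _ v1).
apply: (@le_trans _ _ (\sum_(0 <= i < k.+1) (expR (i.+1%:R * q))%:E * ((expR i%:R <= v)%R%:R)%:E)).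
  rewrite big_nat_recr//=.
  have -> : (expR k%:R <= v)%R by rewrite [leRHS]vE ler_expR.
  rewrite mule1; apply: le_trans (_ : (expR (k.+1%:R * q))%:E <= _).
    rewrite lee_fin expRM ge0_ler_powR ?nnegrE ?expR_ge0 ?(le_trans _ q1)//.
    by rewrite [leLHS]vE ler_expR ltW.
  by apply: leeDr; apply: sume_ge0 => i _; exact: t0.
apply: le_trans (_ : \sum_(i <oo) _ <= _); last first.
  by apply: leeDr; rewrite lee_fin.
exact: nneseries_lim_ge.
Qed.

Lemma Lq_bound (u g1 g2 : space R -> R) (M q : R) :
  in_L1 u -> is_weak_hgrad u (g1, g2) -> (0 < M)%R ->
  \int[@leb3 R]_p `|u p|%:E <= M%:E ->
  \int[@leb3 R]_p `|g1 p|%:E <= M%:E -> \int[@leb3 R]_p `|g2 p|%:E <= M%:E ->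
  (1 <= q < 4 / 3)%R ->
  \int[@leb3 R]_p (`|u p| `^ q)%:E <=
    (M `^ q * ((1 + 10 * expR 2) / (4 / 3 - q)))%:E.
Proof.
move=> iu wu M0 u1 gg1 gg2 /andP[q1 q2].
pose d := (4 / 3 - q)%R.
have d01 : (0 < d <= 1)%R by apply/andP; split; rewrite /d; lra.
have mu_ : measurable_fun setT u by apply/measurable_EFinP; exact: measurable_int iu.
have mau : measurable_fun setT (fun p : space R => `|u p|%R) by exact: measurableT_comp.
pose E k : set (space R) := [set p | (M * expR k%:R <= `|u p|)%R].
have mE k : measurable (E k).
  move: (mau measurableT `[(M * expR k%:R)%R, +oo[%classic (measurable_itv _)); rewrite setTI.
  by congr measurable; apply/seteqP; split => p /=; rewrite in_itv/= andbT.
have leE k : leb3 (E k) <= (5 * expR (- (4 / 3 * k%:R)))%:E.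
  (* The optimal parameter in [weak_type]: the cube root of M / (M e^k). *)
  have a0 : (0 < expR (- (k%:R / 3)) :> R)%R by exact: expR_gt0.
  apply: le_trans (@weak_type u g1 g2 M (M * expR k%:R) _ iu wu gg1 gg2 _ a0) _.
    by rewrite mulr_gt0// expR_gt0.
  have -> : (M / (M * expR k%:R) = expR (- (k%:R : R)))%R.
    by rewrite invfM mulVKf ?gt_eqF// expRN.
  have -> : (4 / expR (- (k%:R / 3)) ^+ 2 = 4 * expR (2 / 3 * k%:R) :> R)%R.
    by rewrite -expRM_natl -expRN; congr (_ * expR _)%R; field.
  rewrite lee_fin -[X in (_ + X <= _)%R]mulrA -!expRD.
  rewrite (_ : - (k%:R / 3) - k%:R = - (4 / 3 * k%:R))%R; last by field.
  rewrite (_ : 2 / 3 * k%:R + (- k%:R - k%:R) = - (4 / 3 * k%:R))%R; last by field.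
  lra.
(* Term k integrates to at most e^((k+1) q) 5 e^(-4k/3) = c r^k, and r = e^(-d) < 1 because q < 4/3.
   The sum is at most c (2 / d), and e^q <= e^2 gives 10 e^2 / d. *)
pose c := (5 * expR q)%R.
pose r := expR (- d).
have r01 : (0 <= r < 1)%R.
  by rewrite expR_ge0/= expR_lt1 oppr_lt0; case/andP: d01.
have c0 : (0 <= c)%R by rewrite mulr_ge0 ?expR_ge0.
pose S p := \sum_(k <oo) (expR (k.+1%:R * q))%:E * ind (E k) p.
have mt k : measurable_fun setT (fun p => (expR (k.+1%:R * q))%:E * ind (E k) p).
  by apply: emeasurable_funM => //; exact: measurable_ind.
have t0 k p : 0 <= (expR (k.+1%:R * q))%:E * ind (E k) p.
  by rewrite mule_ge0 ?lee_fin ?expR_ge0 ?ind_ge0.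
have mS : measurable_fun setT S.
  by apply: ge0_emeasurable_sum => // *.
have S0 p : 0 <= S p by exact: nneseries_ge0.
have iS : \int[@leb3 R]_p S p <= (10 * expR 2 / d)%:E.
  rewrite integral_nneseries//.
  apply: lime_le; first by apply: is_cvg_nneseries => k _ _; exact: integral_ge0.
  apply: nearW => n; apply: (@le_trans _ _ (\sum_(0 <= k < n) (c * r ^+ k)%:E)).
    apply: lee_sum => k _; rewrite ge0_integralZl//; last 2 first.
    - exact: measurable_ind.
    - by move=> p _; exact: ind_ge0.
    rewrite integral_ind//; apply: le_trans (lee_wpmul2l _ (leE k)) _.
      by rewrite lee_fin expR_ge0.
    rewrite -EFinM lee_fin /c /r -expRM_natl mulrCA -!mulrA -!expRD.
    rewrite (_ : (k.+1%:R * q - 4 * (3^-1 * k%:R))%R = (q + k%:R * - d)%R)//.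
    by rewrite /d -natr1; ring.
  rewrite sumEFin lee_fin; apply: le_trans (geometric_sum_le n c0 r01) _.
  rewrite (_ : 10 * expR 2 / d = 5 * expR 2 * (2 / d))%R; last by field; case/andP: d01 => ? _; lra.
  rewrite ler_pM// ?invr_ge0 ?subr_ge0.
  - by case/andP: r01 => _ /ltW.
  - by rewrite ler_wpM2l// ler_expR; lra.
  - exact: expR_inv_bound.
apply: (@le_trans _ _ (\int[@leb3 R]_p ((M `^ q)%:E * ((M^-1)%:E * `|u p|%:E + S p)))).
  apply: ge0_le_integral => //.
  - by apply/measurable_EFinP; apply: (measurableT_comp (measurable_powR _)).
  - apply: emeasurable_funM => //; apply: emeasurable_funD => //.
    by apply: emeasurable_funM => //; apply/measurable_EFinP.
  move=> p _.
  rewrite [in leLHS](_ : `|u p| = M * (M^-1 * `|u p|))%R; last by rewrite mulVKf// gt_eqF.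
  have v0 : (0 <= M^-1 * `|u p|)%R by rewrite mulr_ge0// invr_ge0 ltW.
  rewrite powRM ?(ltW M0)// [leLHS]EFinM; apply: lee_wpmul2l; first by rewrite lee_fin powR_ge0.
  apply: le_trans (powR_level_le v0 q1) _.
  rewrite EFinM; apply: leeD => //.
  apply: lee_nneseries => [k _ _|k _]; first by rewrite mule_ge0 ?lee_fin ?expR_ge0.
  apply: lee_wpmul2l; first by rewrite lee_fin expR_ge0.
  rewrite /ind indicE lee_fin ler_nat /E.
  have -> : (expR k%:R <= M^-1 * `|u p|)%R = (M * expR k%:R <= `|u p|)%R.
    by rewrite ler_pdivlMl.
  by case: (boolP (M * expR k%:R <= `|u p|)%R) => //= h; rewrite mem_set.
rewrite ge0_integralZl//; last 3 first.
- apply: emeasurable_funD => //.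
  by apply: emeasurable_funM => //; apply/measurable_EFinP.
- by move=> p _; apply: adde_ge0 => //; apply: mule_ge0 => //; rewrite lee_fin invr_ge0 (ltW M0).
- by rewrite lee_fin powR_ge0.
rewrite EFinM; apply: lee_wpmul2l; first by rewrite lee_fin powR_ge0.
rewrite ge0_integralD//; last 2 first.
- by move=> p _; apply: mule_ge0 => //; rewrite lee_fin invr_ge0 (ltW M0).
- by apply: emeasurable_funM => //; apply/measurable_EFinP.
rewrite ge0_integralZl//; last 2 first.
- exact/measurable_EFinP.
- by rewrite lee_fin invr_ge0 ltW.
rewrite -/d mulrDl EFinD; apply: leeD => //.
(* The low values of |u| contribute at most 1, which is absorbed in 1 / d because d <= 1. *)
apply: (@le_trans _ _ 1).
  apply: le_trans (lee_wpmul2l _ u1) _; first by rewrite lee_fin invr_ge0 ltW.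
  by rewrite -EFinM mulVf// gt_eqF.
by rewrite lee_fin div1r invf_ge1; case/andP: d01.
Qed.

(** The q-th root of c is at most c, since c >= 1 and q >= 1; keeping c whole makes the bound linear
    in 1 / (4/3 - q). *)
Lemma Lnorm_le_of_integral (u : space R -> R) (M c q : R) :
  (1 <= q)%R -> (0 < M)%R -> (1 <= c)%R ->
  \int[@leb3 R]_p (`|u p| `^ q)%:E <= (M `^ q * c)%:E ->
  Lnorm (@leb3 R) q%:E (EFin \o u) <= (M * c)%:E.
Proof.
move=> q1 M0 c1 h.
have q0 : (0 < q)%R by rewrite (lt_le_trans _ q1).
rewrite Lnorm.unlock.
rewrite (_ : \int[@leb3 R]_p _ = \int[@leb3 R]_p (`|u p| `^ q)%:E); last first.
  by apply: eq_integral => p _; rewrite abse_EFin poweR_EFin.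
have i0 : 0 <= \int[@leb3 R]_p (`|u p| `^ q)%:E.
  by apply: integral_ge0 => p _; rewrite lee_fin powR_ge0.
apply: (@le_trans _ _ ((M `^ q * c)%:E `^ q^-1)).
  apply: gt0_ler_poweR => //; rewrite ?invr_ge0 ?(ltW q0)// in_itv/= leey andbT//.
  by rewrite lee_fin mulr_ge0 ?powR_ge0// (le_trans _ c1).
rewrite poweR_EFin lee_fin powRM ?powR_ge0 ?(le_trans _ c1)//.
rewrite -powRrM mulfV ?gt_eqF// powRr1 ?(ltW M0)// ler_wpM2l ?(ltW M0)//.
rewrite -[leRHS]powRr1 ?(le_trans _ c1)//.
by apply: ler_powR => //; rewrite invf_le1.
Qed.

Lemma W11_hgradP (u : space R -> R) : W11 u -> is_weak_hgrad u (hgrad u).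
Proof. by case=> _ h; exact: getPex. Qed.

Lemma measurable_hgrad_norm (u : space R -> R) : W11 u ->
  measurable_fun setT (hgrad_norm u).
Proof.
move=> /W11_hgradP[/measurable_int/measurable_EFinP m1 /measurable_int/measurable_EFinP m2 _ _].
apply: (measurableT_comp (f := @Num.sqrt R)).
  by apply: continuous_measurable_fun; exact: sqrt_continuous.
by apply: measurable_funD; apply: measurable_funX.
Qed.

Lemma W11_normE (u : space R -> R) :
  W11_norm u = \int[@leb3 R]_p `|u p|%:E + \int[@leb3 R]_p (hgrad_norm u p)%:E.
Proof.
rewrite /W11_norm !Lnorm1; congr (_ + _).
by apply: eq_integral => p _ /=; rewrite ger0_norm// sqrtr_ge0.
Qed.

Lemma le_hgrad_norm (u : space R -> R) p :
  (`|(hgrad u).1 p| <= hgrad_norm u p)%R /\ (`|(hgrad u).2 p| <= hgrad_norm u p)%R.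
Proof.
by rewrite /hgrad_norm -!sqrtr_sqr !ler_sqrt ?addr_ge0 ?sqr_ge0// lerDl lerDr !sqr_ge0.
Qed.

Lemma hgrad_norm_le (u : space R -> R) p :
  (hgrad_norm u p <= `|(hgrad u).1 p| + `|(hgrad u).2 p|)%R.
Proof.
rewrite /hgrad_norm -[leRHS]ger0_norm ?addr_ge0// -sqrtr_sqr ler_sqrt ?sqr_ge0//.
rewrite -(real_normK (num_real ((hgrad u).1 p))) -(real_normK (num_real ((hgrad u).2 p))).
by rewrite sqrrD lerD2r lerDl mulrn_wge0// mulr_ge0.
Qed.

Lemma W11_norm_lty (u : space R -> R) : W11 u -> W11_norm u < +oo.
Proof.
move=> uW; have [iu _] := uW; have [i1 i2 _ _] := W11_hgradP uW.
have mh := measurable_hgrad_norm uW.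
rewrite W11_normE; apply: lte_add_pinfty.
  by case/integrableP : iu.
have m1 := measurable_int _ i1; have m2 := measurable_int _ i2.
have /integrableP[_] := integrableD measurableT (integrable_abse i1) (integrable_abse i2).
apply: le_lt_trans; apply: ge0_le_integral => //.
- by move=> p _; rewrite lee_fin sqrtr_ge0.
- exact/measurable_EFinP.
- apply: measurableT_comp => //; apply: emeasurable_funD.
    by apply: measurableT_comp m1.
  by apply: measurableT_comp m2.
move=> p _ /=; rewrite lee_fin ger0_norm ?addr_ge0//; exact: hgrad_norm_le.
Qed.

(** With exponent 1 the weight 4/3 - q cancels the denominator of the constant in [Lq_bound],
    uniformly in q. *)
Lemma grand_term_le (u : space R -> R) (M q : R) : W11 u -> (0 < M)%R ->
  W11_norm u <= M%:E -> (1 <= q < qstar R)%R ->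
  ((qstar R - q) `^ 1)%:E * Lnorm (@leb3 R) q%:E (EFin \o u) <=
    ((1 + 10 * expR 2) * M)%:E.
Proof.
move=> uW M0 uM; have [iu _] := uW; have wu := W11_hgradP uW.
have [i1 i2 _ _] := wu.
have mh := measurable_hgrad_norm uW.
have m1 := measurable_int _ i1; have m2 := measurable_int _ i2.
have -> : qstar R = (4 / 3)%R by rewrite /qstar /Qdim; congr (_ / _)%R; ring.
move=> q12; have /andP[q1 q2] := q12.
have u0 : 0 <= \int[@leb3 R]_p `|u p|%:E by exact: integral_ge0.
have h0 : 0 <= \int[@leb3 R]_p (hgrad_norm u p)%:E.
  by apply: integral_ge0 => p _; rewrite lee_fin sqrtr_ge0.
have uM1 : \int[@leb3 R]_p `|u p|%:E <= M%:E.
  by apply: le_trans uM; rewrite W11_normE leeDl.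
have hM : \int[@leb3 R]_p (hgrad_norm u p)%:E <= M%:E.
  by apply: le_trans uM; rewrite W11_normE leeDr.
have g1M : \int[@leb3 R]_p `|(hgrad u).1 p|%:E <= M%:E.
  apply: le_trans hM; apply: ge0_le_integral => //.
  - by apply/measurable_EFinP; apply: measurableT_comp => //; apply/measurable_EFinP.
  - exact/measurable_EFinP.
  - by move=> p _; rewrite lee_fin; case: (le_hgrad_norm u p).
have g2M : \int[@leb3 R]_p `|(hgrad u).2 p|%:E <= M%:E.
  apply: le_trans hM; apply: ge0_le_integral => //.
  - by apply/measurable_EFinP; apply: measurableT_comp => //; apply/measurable_EFinP.
  - exact/measurable_EFinP.
  - by move=> p _; rewrite lee_fin; case: (le_hgrad_norm u p).
rewrite [hgrad u]surjective_pairing in wu.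
have B := Lq_bound iu wu M0 uM1 g1M g2M q12.
have d0 : (0 < 4 / 3 - q)%R by rewrite subr_gt0.
have e0 : (0 <= 10 * expR 2 :> R)%R by rewrite mulr_ge0 ?expR_ge0.
have c1 : (1 <= (1 + 10 * expR 2) / (4 / 3 - q))%R.
  by rewrite ler_pdivlMr// mul1r; lra.
have := Lnorm_le_of_integral q1 M0 c1 B.
rewrite (powRr1 (ltW d0)) => /(lee_wpmul2l (_ : 0 <= (4 / 3 - q)%:E)); rewrite lee_fin => /(_ (ltW d0)).
by move=> /le_trans; apply; rewrite -EFinM lee_fin mulrC -mulrA divfK ?gt_eqF// mulrC.
Qed.

Lemma embedding : continuous_embedding (1 : R).
Proof.
pose C := (1 + 10 * expR 2 : R)%R.
have C0 : (0 < C)%R by rewrite ltr_wpDr// mulr_ge0 ?expR_ge0.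
have W0 (u : space R -> R) : 0 <= W11_norm u by rewrite adde_ge0 ?Lnorm_ge0.
have main (u : space R -> R) : W11 u -> grand_norm 1 u <= C%:E * W11_norm u.
  move=> uW; have fW : W11_norm u \is a fin_num by rewrite ge0_fin_numE// W11_norm_lty.
  apply/lee_addgt0Pr => e e0; apply: ge_ereal_sup => _ [q q12 <-].
  (* M has to be positive while the norm may vanish; multiplied by C, the excess e / C is exactly
     the allowed error e. *)
  have M0 : (0 < fine (W11_norm u) + e / C)%R by rewrite ltr_wpDl ?divr_gt0// fine_ge0.
  apply: le_trans (grand_term_le uW M0 _ q12) _.
    by rewrite EFinD fineK// leeDl// lee_fin divr_ge0// ltW.
  by rewrite -/C mulrDr EFinD EFinM fineK// mulrCA mulfV ?gt_eqF// mulr1.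
split; last by exists C.
move=> u uW; split.
  by have [/measurable_int/measurable_EFinP] := uW.
apply: le_lt_trans (main u uW) _.
by rewrite lte_mul_pinfty ?lee_fin ?ltW// W11_norm_lty.
Qed.

End levels.

(** * Lower bound for the isoperimetric profile *)

Section tube.
Local Open Scope ereal_scope.
Variable R : realType.
Local Notation ind := (ind R).

Lemma leb_itv_oc (c r : R) : (0 <= r)%R -> leb R `]c, (c + r)%R] = r%:E.
Proof.
move=> r0; rewrite lebesgue_measure_itv/= lte_fin ltrDl.
move: r0; rewrite le_eqVlt => /predU1P[<-|->]; first by rewrite ltxx.
by rewrite -EFinD addrAC subrr add0r.
Qed.

(* Split F at a point c of F: the part after c is shifted by r, which leaves room
   for the interval ]c, c + r]. *)
Lemma line_tube (F H : set (line R)) (r : R) : measurable F -> measurable H ->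
  (0 <= r)%R -> (forall s h : R, F s -> (0 <= h <= r)%R -> H (s + h)%R) ->
  F !=set0 -> leb R F + r%:E <= leb R H.
Proof.
move=> mF mH r0 FH [c Fc].
pose L : set (line R) := F `&` `]-oo, c].
pose G : set (line R) := F `&` `]c, +oo[.
pose G' : set (line R) := (fun x : line R => (x - r)%R : line R) @^-1` G.
pose I : set (line R) := `]c, (c + r)%R]%classic.
have mL : measurable L by apply: measurableI => //; exact: measurable_itv.
have mG : measurable G by apply: measurableI => //; exact: measurable_itv.
have mI : measurable I by exact: measurable_itv.
have msub : measurable_fun setT (fun x : line R => (x - r)%R : line R).
  by apply: measurable_funB.
have mG' : measurable G' by rewrite -[G']setTI; exact: msub.
have GG' : leb R G' = leb R G.
  rewrite -(integral_ind (leb R) mG) -(integral_ind (leb R) mG').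
  by rewrite -(ge0_integral_translate (- r) (@measurable_ind R _ _ _ mG))// => x; exact: ind_ge0.
have -> : leb R F = leb R L + leb R G.
  rewrite -measureU//.
    congr (leb R _); apply/seteqP; split => x; rewrite /L /G/= !in_itv/=.
      by move=> Fx; have [xc|xc] := leP x c; [left|right]; rewrite ?xc.
    by case=> -[].
  by apply/seteqP; split => x //; rewrite /L /G/= !in_itv/= andbT => -[[_ xc] [_]]; rewrite ltNge xc.
rewrite -GG' -(leb_itv_oc c r0) addeAC -measureU//; last first.
  by apply/seteqP; split => x //; rewrite /L /I/= !in_itv/= => -[[_ xc] /andP[]]; rewrite ltNge xc.
rewrite -measureU//; last 2 first.
- exact: measurableU.
- apply/seteqP; split => x //; rewrite /L /I /G' /G/= !in_itv/= andbT ltrBrDr.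
  case=> -[[_ xc]|/andP[_ xc]] [_]; last by rewrite ltNge xc.
  by rewrite ltNge (le_trans xc)// lerDl.
apply: le_measure; rewrite ?inE//; first by apply: measurableU => //; exact: measurableU.
move=> x [[|]|].
- by case=> Fx _; rewrite -[x]addr0; apply: FH; rewrite ?lexx.
- rewrite /I/= in_itv/= => /andP[cx xr].
  by rewrite -(subrKC c x); apply: FH => //; rewrite subr_ge0 ltW//= lerBlDl.
- by case=> Fx _; rewrite -(subrK r x); apply: FH; rewrite ?lexx ?r0.
Qed.

Definition fiberX (E : set (space R)) (z : plane R) : set (line R) :=
  [set s | E (strX (z, s))].

(** Sections of positive measure instead of nonempty ones: this set is Borel, whereas the projection
    of a Borel set need not be, and the points of E left out form a null set ([shadowX_null]). *)
Definition shadowX (E : set (space R)) : set (plane R) :=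
  [set z | 0 < leb R (fiberX E z)].

Lemma measurable_preimage_strX (E : set (space R)) : measurable E ->
  measurable (@strX R @^-1` E).
Proof. by move=> mE; rewrite -[_ @^-1` _]setTI; exact: (mp_strX R).1. Qed.

Lemma measurable_fiberX (E : set (space R)) z : measurable E ->
  measurable (fiberX E z).
Proof.
move=> /measurable_preimage_strX mE.
by rewrite -[X in measurable X]setTI; exact: (pair1_measurable z measurableT mE).
Qed.

Lemma leb_fiberX (E : set (space R)) z : measurable E ->
  leb R (fiberX E z) = \int[leb R]_s ind (@strX R @^-1` E) (z, s).
Proof.
move=> mE; rewrite -(integral_ind (leb R) (measurable_fiberX z mE)).
by apply: eq_integral => s _; rewrite /ind !indicE.
Qed.

Lemma measurable_leb_fiberX (E : set (space R)) : measurable E ->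
  measurable_fun setT (fun z => leb R (fiberX E z)).
Proof.
move=> mE.
have mi := @measurable_ind R _ _ _ (measurable_preimage_strX mE).
have := measurable_fun_fubini_tonelli_F (m2 := leb R) _ mi (ind_ge0 _).
by congr measurable_fun; apply/funext => z; rewrite leb_fiberX.
Qed.

Lemma measurable_shadowX (E : set (space R)) : measurable E ->
  measurable (shadowX E).
Proof.
move=> mE; rewrite -[X in measurable X]setTI.
by apply: emeasurable_fun_o_infty => //; exact: measurable_leb_fiberX.
Qed.

Lemma leb3_fiberX (E : set (space R)) : measurable E ->
  leb3 E = \int[@leb2 R]_z leb R (fiberX E z).
Proof.
move=> mE; have mE' := measurable_preimage_strX mE.
rewrite -((mp_strX R).2 _ mE) -(integral_ind (@leb3 R) mE').
rewrite (ge0_integral_leb3 (@measurable_ind R _ _ _ mE') (ind_ge0 _)).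
by apply: eq_integral => z _; rewrite leb_fiberX.
Qed.

Lemma piX_strX (q : space R) : piX (strX q) = q.1.
Proof. by case: q => [[y t] x]; rewrite /piX /strX /xc /yc /tc/= subrK. Qed.

Lemma measurable_preimage_piX (A : set (plane R)) : measurable A ->
  measurable [set p : space R | A (piX p)].
Proof. by move=> mA; have := measurable_piX measurableT mA; rewrite setTI. Qed.

Lemma shadowX_null (E : set (space R)) : measurable E ->
  leb3 (E `\` [set p | shadowX E (piX p)]) = 0.
Proof.
move=> mE; have mS := measurable_shadowX mE.
have mP := measurable_preimage_piX mS.
rewrite leb3_fiberX; last exact: measurableD.
apply: integral0_eq => z _; apply/eqP; rewrite eq_le measure_ge0 andbT.
have [Sz|] := boolP (0 < leb R (fiberX E z)).
  rewrite (_ : fiberX _ _ = set0) ?measure0//.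
  by apply/seteqP; split => s //= -[_]; rewrite /= piX_strX.
rewrite -leNgt; apply: le_trans; apply: le_measure; rewrite ?inE.
- by apply: measurable_fiberX; exact: measurableD.
- exact: measurable_fiberX.
- by move=> s [].
Qed.

(** Right multiplication by (h, 0, 0) is translation by h along the fibres of [strX]. Each fibre
    over the shadow gains r by [line_tube], and the gain is integrated over the plane. *)
Lemma tubeX (E H : set (space R)) (r : R) : measurable E -> measurable H ->
  (0 <= r)%R ->
  (forall p h, E p -> (0 <= h <= r)%R -> H (heis_mul p (h, 0, 0)%R)) ->
  leb3 E + r%:E * leb2 (shadowX E) <= leb3 H.
Proof.
move=> mE mH r0 EH; have mS := measurable_shadowX mE.
have fibH z (s h : R) : fiberX E z s -> (0 <= h <= r)%R -> fiberX H z (s + h)%R.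
  move=> Es hr; have := EH _ _ Es hr; rewrite /fiberX/=; congr H.
  by rewrite /heis_mul /strX /xc /yc /tc/=; congr (_, _, _); ring.
have re0 : 0 <= r%:E by rewrite lee_fin.
have mF := measurable_leb_fiberX mE.
have mi := @measurable_ind R _ _ _ mS.
rewrite !leb3_fiberX// -(integral_ind (@leb2 R) mS).
rewrite -(ge0_integralZl (@leb2 R) measurableT mi (fun z _ => ind_ge0 _ z) re0).
have mri : measurable_fun setT (fun z => r%:E * ind (shadowX E) z).
  by apply: emeasurable_funM.
have ri0 z : 0 <= r%:E * ind (shadowX E) z by apply: mule_ge0 => //; exact: ind_ge0.
rewrite -(ge0_integralD (@leb2 R) measurableT (fun z _ => measure_ge0 _ _) mF (fun z _ => ri0 z) mri).
apply: ge0_le_integral => //.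
- by move=> z _; exact: adde_ge0.
- exact: emeasurable_funD.
- exact: measurable_leb_fiberX.
move=> z _; rewrite /ind indicE.
have [/set_mem Sz|_] := boolP (z \in _).
  rewrite mule1; apply: line_tube => //; [exact: measurable_fiberX|exact: measurable_fiberX|exact: fibH|].
  apply/set0P/eqP => F0; move: Sz; rewrite /shadowX/= F0 measure0 ltxx//.
rewrite mule0 adde0; apply: le_measure; rewrite ?inE; [exact: measurable_fiberX|exact: measurable_fiberX|].
by move=> s Es; rewrite -[s]addr0; apply: fibH; rewrite ?lexx.
Qed.

(** The choice a = b in [loomis_whitney]: b b^3 + (4 / b^2) b^6 = 5 b^4. *)
Lemma lw_scaled_le (b : R) (x y : \bar R) : (0 < b)%R -> 0 <= x ->
  x <= (b ^+ 3)%:E -> y <= (b ^+ 3)%:E ->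
  b%:E * y + (4 / b ^+ 2)%:E * (x * x) <= (5 * b ^+ 4)%:E.
Proof.
move=> b0 x0 xb yb.
rewrite (_ : 5 * b ^+ 4 = b * b ^+ 3 + 4 / b ^+ 2 * (b ^+ 3 * b ^+ 3))%R; last first.
  by field; rewrite gt_eqF.
rewrite EFinD (EFinM b) (EFinM (4 / b ^+ 2)) (EFinM (b ^+ 3)); apply: leeD.
  by apply: lee_wpmul2l => //; rewrite lee_fin ltW.
apply: lee_wpmul2l; last exact: lee_pmul.
by rewrite lee_fin divr_ge0// sqr_ge0.
Qed.

(** If one shadow has measure at least b^3, [tubeX] concludes, for Y after [flip]. Otherwise E lies,
    up to null sets, over two sets of measure below b^3, and [loomis_whitney] contradicts the lower
    bound on the measure of E. *)
Lemma heis_tube (E H : set (space R)) (r b : R) : measurable E -> measurable H ->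
  (0 <= r)%R -> (0 < b)%R ->
  (forall p h, E p -> (0 <= h <= r)%R -> H (heis_mul p (h, 0, 0)%R)) ->
  (forall p h, E p -> (0 <= h <= r)%R -> H (heis_mul p (0, h, 0)%R)) ->
  (5 * b ^+ 4)%:E < leb3 E ->
  leb3 E + (r * b ^+ 3)%:E <= leb3 H.
Proof.
move=> mE mH r0 b0 EX EY bE.
have mfl (K : set (space R)) : measurable K -> measurable (@flip R @^-1` K).
  by move=> mK; rewrite -[_ @^-1` _]setTI; exact: (mp_flip R).1.
have mo : measurable_fun setT (@oppsnd R).
  apply: measurable_fun_pair; first exact: measurable_fst.
  by apply: measurable_funN; exact: measurable_snd.
pose A := shadowX E.
pose B' := shadowX (@flip R @^-1` E).
have mA : measurable A by exact: measurable_shadowX.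
have mB' : measurable B' by apply: measurable_shadowX; exact: mfl.
pose B : set (plane R) := @oppsnd R @^-1` B'.
have mB : measurable B by rewrite -[B]setTI; exact: mo.
have BB' : leb2 B = leb2 B'.
  rewrite -(integral_ind (@leb2 R) mB) -(integral_ind (@leb2 R) mB').
  by rewrite -(ge0_integral_oppsnd (@measurable_ind R _ _ _ mB') (ind_ge0 _)).
have re0 : 0 <= r%:E by rewrite lee_fin.
have [bA|Ab] := leP (b ^+ 3)%:E (leb2 A).
  apply: le_trans (tubeX mE mH r0 EX).
  by rewrite EFinM; apply: (leeD (lexx _)); exact: (lee_wpmul2l re0 bA).
have [bB|Bb] := leP (b ^+ 3)%:E (leb2 B).
  rewrite -((mp_flip R).2 _ mE) -((mp_flip R).2 _ mH).
  apply: le_trans (tubeX (mfl _ mE) (mfl _ mH) r0 _) => [|p h /= Ep hr].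
    rewrite EFinM -/B' -BB'; apply: (leeD (lexx _)); exact: (lee_wpmul2l re0 bB).
  have := EY _ _ Ep hr; congr H.
  by rewrite /heis_mul /flip /xc /yc /tc/=; congr (_, _, _); ring.
have mP : measurable [set p : space R | A (piX p) /\ B (piY p)].
  have -> : [set p : space R | A (piX p) /\ B (piY p)] = ((@piX R) @^-1` A) `&` ((@piY R) @^-1` B) by [].
  apply: measurableI; first exact: measurable_preimage_piX.
  by rewrite -[_ @^-1` _]setTI; exact: measurable_piY.
(* N1 and N2 are the points of E whose X-line, respectively Y-line, meets E in a null set. *)
pose N1 := E `\` [set p | A (piX p)].
pose N2 := @flip R @^-1` ((@flip R @^-1` E) `\` [set p | B' (piX p)]).
have mN1 : measurable N1.
  exact: (measurableD mE (measurable_preimage_piX mA)).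
have mN2' : measurable ((@flip R @^-1` E) `\` [set p | B' (piX p)]).
  exact: (measurableD (mfl _ mE) (measurable_preimage_piX mB')).
have mN2 : measurable N2 by exact: mfl.
have mPN1 := measurableU _ _ mP mN1; have mU := measurableU _ _ mPN1 mN2.
have N10 : leb3 N1 = 0 by exact: shadowX_null.
have N20 : leb3 N2 = 0.
  by rewrite ((mp_flip R).2 _ mN2'); apply: shadowX_null; exact: mfl.
have : leb3 E <= leb3 ([set p : space R | A (piX p) /\ B (piY p)] `|` N1 `|` N2).
  apply: le_measure; [by rewrite inE|by rewrite inE|].
  move=> p Ep; have [Ap|Ap] := pselect (A (piX p)); last first.
    left; right; split; [exact: Ep|exact: Ap].
  have [Bp|Bp] := pselect (B (piY p)).
    left; left; split; [exact: Ap|exact: Bp].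
  right; split; first by rewrite /preimage/= flipK; exact: Ep.
  move=> /= h; apply: Bp; move: h; rewrite /B/=; congr B'.
  by rewrite /piX /piY /oppsnd /flip /xc /yc /tc/=; congr (_, _); ring.
rewrite (measureU0 mPN1 mN2 N20) (measureU0 mP mN1 N10).
move=> /le_trans /(_ (loomis_whitney mA mB b0)) /le_trans.
move=> /(_ _ (lw_scaled_le b0 (measure_ge0 (@leb2 R) A) (ltW Ab) (ltW Bb))).
by rewrite leNgt bE.
Qed.

End tube.

(** * From Borel tubes to the Minkowski content *)

Section lower.
Local Open Scope ereal_scope.
Variable R : realType.

Lemma leb_itv_cc (s : R) : (0 <= s)%R -> leb R `[0%R, s] = s%:E.
Proof.
rewrite lebesgue_measure_itv/= lte_fin le_eqVlt => /predU1P[<-|->].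
  by rewrite ltxx.
by rewrite -EFinB subr0.
Qed.

Lemma Rintegral_itv_cst (c s : R) : (0 <= s)%R ->
  (\int[leb R]_(r in `[0%R, s]) c)%R = (c * s)%R.
Proof. move=> s0; transitivity (c * fine (leb R `[0%R, s]))%R; first exact: Rintegral_cst.
by rewrite leb_itv_cc. Qed.

Lemma horizontal_line (p : R * R * R) (a b T : R) : (0 <= T)%R ->
  horizontal_curve T (fun s => heis_mul p (s * a, s * b, 0)%R)
    (fun=> a) (fun=> b).
Proof.
move=> T0; have icst c : (leb R).-integrable `[0%R, T] (EFin \o cst c).
  apply/integrableP; split; first by apply/measurable_EFinP; exact: measurable_cst.
  rewrite (_ : \int[leb R]_(x in _) _ = `|c|%:E * leb R `[0%R, T]).
    by rewrite leb_itv_cc// -EFinM ltry.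
  have := @integral_cst _ _ R (leb R) `[0%R, T] (measurable_itv _) `|c|%:E; exact.
have I (f : R -> R) k s : (0 <= s)%R -> (forall r, f r = k) ->
    (\int[leb R]_(r in `[0%R, s]) f r = k * s)%R.
  by move=> s0 fk; rewrite -(Rintegral_itv_cst k s0); apply: eq_Rintegral => r _.
split=> //; [exact: icst|exact: icst|].
split=> s /[!in_itv]/= /andP[s0 _]; rewrite /heis_mul /xc /yc /tc/=.
- by rewrite (I _ a)//; [ring|move=> r; ring].
- by rewrite (I _ b)//; [ring|move=> r; ring].
by rewrite (I _ (b * p.1.1 - a * p.1.2)%R)//; [ring|move=> r; ring].
Qed.

Lemma d_cc_line (p : R * R * R) (a b T : R) : (0 <= T)%R ->
  d_cc p (heis_mul p (T * a, T * b, 0)%R) <=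
    (Num.sqrt (a ^+ 2 + b ^+ 2) * T)%:E.
Proof.
move=> T0; apply: ereal_inf_lbound; exists T, (fun s => heis_mul p (s * a, s * b, 0)%R).
exists (fun=> a), (fun=> b); split => //; first exact: horizontal_line.
  by case: p => [[x y] t]; rewrite /heis_mul /xc /yc /tc/=; congr (_, _, _); ring.
by rewrite /cc_length integral_cst// EFinM; congr (_ * _); apply/esym; exact: leb_itv_cc.
Qed.

Lemma enlargement_line (E : set (R * R * R)) (eps : R) p q (a b h : R) :
  E p -> (a ^+ 2 + b ^+ 2 = 1)%R -> (0 <= h < eps)%R ->
  q = heis_mul p (h * a, h * b, 0)%R ->
  enlargement eps E q.
Proof.
move=> Ep ab /andP[h0 he] ->; rewrite /enlargement/=.
set q' := heis_mul _ _.
apply: (@le_lt_trans _ _ h%:E); last by rewrite lte_fin.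
apply: (@le_trans _ _ (d_cc q' p)).
  by apply: ereal_inf_lbound; exists p.
(* The distance to E starts from q', so the segment is travelled backwards. *)
have := d_cc_line q' (- a) (- b) h0; rewrite !sqrrN ab sqrtr1 mul1r.
congr (d_cc _ _ <= _).
by rewrite /q' /heis_mul /xc /yc /tc/=; case: p {Ep q'} => [[x y] t] /=; congr (_, _, _); ring.
Qed.

(** Applied to enlargements, which enter only through their outer measure: a Borel superset takes
    their place in [heis_tube]. *)
Lemma leb3_ext_cover (A : set (space R)) (e : R) :
  leb3_ext A \is a fin_num -> (0 < e)%R ->
  exists H : set (space R), [/\ measurable H, A `<=` H & leb3 H <= leb3_ext A + e%:E].
Proof.
move=> fA e0; have [_ [F [mF AF] <-] lt] := lb_ereal_inf_adherent e0 fA.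
exists (\bigcup_k F k); split => //; first exact: bigcupT_measurable.
apply: le_trans (ltW lt).
apply: measure_sigma_subadditive => //; exact: bigcupT_measurable.
Qed.

(** Inner approximation through complements: cover E by a Borel set H, then H minus E, small by the
    Caratheodory condition, by a Borel set N; what remains of H outside N lies in E. *)
Lemma lebesgue_measurable_inner (E : set (space R)) (s d : R) :
  lebesgue_measurable E -> leb3_ext E = s%:E -> (0 < d)%R ->
  exists E' : set (space R),
    [/\ measurable E', E' `<=` E & s%:E <= leb3 E' + d%:E].
Proof.
move=> cE Es d0; have d20 : (0 < d / 2)%R by rewrite divr_gt0.
have [] := @leb3_ext_cover E (d / 2) _ d20; first by rewrite Es.
move=> H [mH EH HE].
have HEE : leb3_ext (H `\` E) <= (d / 2)%:E.
  have HD : leb3_ext H = leb3_ext (H `&` E) + leb3_ext (H `&` ~` E) by exact: cE.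
  move: HE; rewrite -(measurable_mu_extE (@leb3 R) mH) -/(leb3_ext H) HD (setIidr EH) Es.
  by rewrite leeD2lE.
have fHE : leb3_ext (H `\` E) \is a fin_num.
  by rewrite ge0_fin_numE ?(le_lt_trans HEE) ?ltry//; exact: mu_ext_ge0.
have [N [mN HEN Ne]] := leb3_ext_cover fHE d20.
exists (H `\` N); split; first exact: measurableD.
  by move=> p [Hp Np]; apply: contrapT => Ep; apply: Np; apply: HEN.
apply: (@le_trans _ _ (leb3 H)).
  by rewrite -Es -(measurable_mu_extE (@leb3 R) mH); apply: le_mu_ext.
apply: (@le_trans _ _ (leb3 (H `\` N) + leb3 N)).
  have mHN : measurable (H `\` N) by exact: measurableD.
  rewrite -measureU//; last by apply/seteqP; split => p // -[[]].
  apply: le_measure; rewrite ?inE//; first exact: measurableU.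
  by move=> p Hp; have [Np|Np] := pselect (N p); [right|left].
rewrite leeD2l//; apply: le_trans Ne _.
apply: le_trans (leeD2r _ HEE) _; by rewrite -EFinD lee_fin; lra.
Qed.

Lemma enlargement_ge (E : set (space R)) (s b eps : R) :
  lebesgue_measurable E -> leb3_ext E = s%:E -> (0 < b)%R ->
  (10 * b ^+ 4 <= s)%R -> (0 < eps)%R ->
  (s + eps * (b ^+ 3 / 2))%:E <= leb3_ext (enlargement eps E).
Proof.
move=> cE Es b0 bs e0.
have [fE|] := boolP (leb3_ext (enlargement eps E) \is a fin_num); last first.
  rewrite ge0_fin_numE; last exact: mu_ext_ge0.
  by rewrite -leNgt leye_eq => /eqP ->; rewrite leey.
have s0 : (0 < s)%R.
  by rewrite (lt_le_trans _ bs)// mulr_gt0// exprn_gt0.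
apply/lee_addgt0Pr => e ep.
have e20 : (0 < e / 2)%R by rewrite divr_gt0.
(* The bound s / 4 leaves E' a measure of at least 3 s / 4 > 5 b^4, by 10 b^4 <= s; the bound e / 2
   is half of the error, the other half being spent on H. *)
pose d := Num.min (e / 2)%R (s / 4)%R.
have d0 : (0 < d)%R by rewrite lt_min e20 divr_gt0.
have de : (d <= e / 2)%R by rewrite ge_min lexx.
have ds : (d <= s / 4)%R by rewrite ge_min lexx orbT.
have [H [mH EH He]] := leb3_ext_cover fE e20.
have [E' [mE' EE sE]] := lebesgue_measurable_inner cE Es d0.
(* Enlargements are defined by a strict inequality; closed displacements up to eps / 2 fit inside,
   at the price of the factor 1/2 in the statement. *)
have eps2 : (0 <= eps / 2)%R by rewrite divr_ge0// ltW.
have hX p h : E' p -> (0 <= h <= eps / 2)%R -> H (heis_mul p (h, 0, 0)%R).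
  move=> Ep /andP[h0 h2]; apply: EH; apply: (@enlargement_line E eps p _ 1 0 h).
  - exact: EE.
  - by rewrite expr1n expr0n addr0.
  - by rewrite h0/=; lra.
  - by rewrite mulr1 mulr0.
have hY p h : E' p -> (0 <= h <= eps / 2)%R -> H (heis_mul p (0, h, 0)%R).
  move=> Ep /andP[h0 h2]; apply: EH; apply: (@enlargement_line E eps p _ 0 1 h).
  - exact: EE.
  - by rewrite expr1n expr0n add0r.
  - by rewrite h0/=; lra.
  - by rewrite mulr1 mulr0.
have bE : (5 * b ^+ 4)%:E < leb3 E'.
  rewrite -(@lteD2rE _ d%:E)//; apply: lt_le_trans sE; rewrite -EFinD lte_fin; lra.
have := heis_tube mE' mH eps2 b0 hX hY bE.
move=> /le_trans /(_ He) h.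
apply: (@le_trans _ _ (leb3 E' + (eps / 2 * b ^+ 3)%:E + d%:E)).
  rewrite addeAC EFinD; apply: leeD => //; rewrite lee_fin; lra.
apply: le_trans (leeD2r _ h) _; rewrite -addeA leeD2l// -EFinD lee_fin; lra.
Qed.

Lemma minkowski_content_ge (E : set (space R)) (s b : R) :
  lebesgue_measurable E -> leb3_ext E = s%:E -> (0 < b)%R ->
  (10 * b ^+ 4 <= s)%R -> (b ^+ 3 / 2)%:E <= minkowski_content E.
Proof.
move=> cE Es b0 bs; rewrite /minkowski_content limf_einfE.
apply: (@le_trans _ _ (ereal_inf ((fun eps : R => (leb3_ext (enlargement eps E) - leb3_ext E) * (eps^-1)%:E) @` [set e | 0 < e]%R))); last first.
  apply: ereal_sup_ubound; exists [set e | 0 < e]%R => //.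
  exact: nbhs_right_gt.
apply: le_ereal_inf_tmp => _ [e /= e0 <-].
rewrite lee_pdivlMr// Es leeBrDr// -EFinM -EFinD.
apply: le_trans (enlargement_ge cE Es b0 bs e0).
by rewrite lee_fin addrC mulrC.
Qed.

(** The largest b allowed by [minkowski_content_ge] satisfies 10 b^4 = s, so that b^3 is a multiple
    of s^(3/4). *)
Lemma profile_ge (s : R) : (0 < s)%R ->
  ((10^-1 `^ (3 / 4) / 2) * s `^ (3 / 4))%:E <= isoperimetric_profile s.
Proof.
move=> s0; pose b := ((10^-1 * s) `^ 4^-1)%R.
have x0 : (0 < 10^-1 * s)%R by rewrite mulr_gt0.
have b0 : (0 < b)%R by rewrite powR_gt0.
have b4 : (b ^+ 4 = 10^-1 * s)%R.
  by rewrite -powR_mulrn ?ltW// -powRrM mulVf// powRr1// ltW.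
have b3 : (b ^+ 3 = 10^-1 `^ (3 / 4) * s `^ (3 / 4))%R.
  rewrite -powR_mulrn ?(ltW b0)// -powRrM (mulrC 4^-1)%R powRM// ltW//.
apply: le_ereal_inf_tmp => _ [E [cE Es] <-].
rewrite mulrAC -b3; apply: minkowski_content_ge Es _ _ => //.
by rewrite b4 mulVKf.
Qed.

End lower.

(** * Upper bound for the isoperimetric profile *)

Section upper.
Local Open Scope ereal_scope.
Variable R : realType.

(* No measurability is required: the integral of a nonnegative function is a
   supremum over the simple functions below it. *)
Lemma ge0_integral_monotone d (T : measurableType d)
    (mu : {measure set T -> \bar R}) (D D' : set T) (f h : T -> \bar R) :
  (forall x, 0 <= f x) -> (forall x, 0 <= h x) -> D `<=` D' ->
  (forall x, D x -> f x <= h x) ->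
  \int[mu]_(x in D) f x <= \int[mu]_(x in D') h x.
Proof.
move=> f0 h0 DD fh; rewrite !ge0_integralE//.
apply: ge_ereal_sup => _ [k /= kf <-]; apply: ereal_sup_ubound.
exists k => //= x; apply: le_trans (kf x) _; rewrite !patchE.
have [/set_mem xD|_] := boolP (x \in D); last by case: ifP.
by rewrite mem_set; [exact: fh|exact: DD].
Qed.

(** The two parts of f have integrals in [0, c], so their difference is at most c in absolute value.
    The argument rests on monotonicity because the integrand of the t-coordinate contains [gam],
    whose measurability [horizontal_curve] does not state. *)
Lemma Rintegral_norm_le d (T : measurableType d)
    (mu : {measure set T -> \bar R}) (D D' : set T) (f h : T -> R) (c : R) :
  (forall x, 0 <= h x)%R -> D `<=` D' -> (forall x, D x -> `|f x| <= h x)%R ->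
  \int[mu]_(x in D') (h x)%:E <= c%:E ->
  (`|\int[mu]_(x in D) f x| <= c)%R.
Proof.
move=> h0 DD fh hc; rewrite /Rintegral integralE.
have part (g : T -> \bar R) : (forall x, 0 <= g x) ->
    (forall x, D x -> g x <= (h x)%:E) ->
    exists2 r : R, \int[mu]_(x in D) g x = r%:E & (0 <= r <= c)%R.
  move=> g0 gh; have i0 : 0 <= \int[mu]_(x in D) g x by exact: integral_ge0.
  have ic : \int[mu]_(x in D) g x <= c%:E.
    by apply: le_trans hc; apply: ge0_integral_monotone.
  have fi : \int[mu]_(x in D) g x \is a fin_num.
    by rewrite ge0_fin_numE// (le_lt_trans ic)// ltry.
  exists (fine (\int[mu]_(x in D) g x)); first by rewrite fineK.
  by rewrite -!lee_fin fineK// i0.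
have [x|x Dx|p -> /andP[p0 pc]] := part (fun x => ((EFin \o f)^\+) x).
- exact: funepos_ge0.
- rewrite funeposE ge_max lee_fin /= lee_fin h0 andbT.
  by apply: le_trans (fh x Dx); exact: ler_norm.
have [x|x Dx|n -> /andP[n0 nc]] := part (fun x => ((EFin \o f)^\-) x).
- exact: funeneg_ge0.
- rewrite funenegE ge_max -EFinN !lee_fin h0 andbT.
  by apply: le_trans (fh x Dx); rewrite -normrN; exact: ler_norm.
by rewrite -EFinB/= ler_norml; apply/andP; split; lra.
Qed.

(** x and y vary by at most l: from the endpoint T they are bounded at 0 by m + l, then along the
    whole curve by m + 2 l. The speed of t is |b x - a y|, at most 2 (m + 2 l) times the horizontal
    speed, whose integral is at most l. *)
Lemma horizontal_curve_bounds (T : R) (gam : R -> R * R * R) (a b : R -> R)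
    (l m : R) :
  horizontal_curve T gam a b -> cc_length T a b <= l%:E ->
  (`|xc (gam T)| <= m)%R -> (`|yc (gam T)| <= m)%R ->
  [/\ (`|xc (gam 0%R)| <= m + l)%R, (`|yc (gam 0%R)| <= m + l)%R &
   (`|tc (gam T) - tc (gam 0%R)| <= 2 * (m + 2 * l) * l)%R].
Proof.
move=> [T0 ia ib [sx sy st]] len xm ym.
pose h r := Num.sqrt (a r ^+ 2 + b r ^+ 2).
have h0 r : (0 <= h r)%R by exact: sqrtr_ge0.
have ah r : (`|a r| <= h r)%R.
  by rewrite -sqrtr_sqr ler_sqrt ?addr_ge0 ?sqr_ge0// lerDl sqr_ge0.
have bh r : (`|b r| <= h r)%R.
  by rewrite -sqrtr_sqr ler_sqrt ?addr_ge0 ?sqr_ge0// lerDr sqr_ge0.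
have TT : T \in `[0%R, T] by rewrite in_itv/= T0 lexx.
have sub s : s \in `[0%R, T] -> `[0%R, s] `<=` `[0%R, T].
  rewrite in_itv/= => /andP[_ sT] r/=; rewrite !in_itv/= => /andP[-> rs].
  exact: le_trans sT.
have dx s : s \in `[0%R, T] -> (`|xc (gam s) - xc (gam 0%R)| <= l)%R.
  move=> sT; rewrite sx// addrAC subrr add0r.
  apply: (@Rintegral_norm_le _ (line R) (leb R) _ _ _ h l h0 (sub _ sT) _ len) => r _ /=.
  by rewrite mulr1 mulr0 addr0.
have dy s : s \in `[0%R, T] -> (`|yc (gam s) - yc (gam 0%R)| <= l)%R.
  move=> sT; rewrite sy// addrAC subrr add0r.
  apply: (@Rintegral_norm_le _ (line R) (leb R) _ _ _ h l h0 (sub _ sT) _ len) => r _ /=.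
  by rewrite mulr1 mulr0 add0r.
have tri (u v w : R) : (`|u| <= w -> `|v - u| <= l -> `|v| <= w + l)%R.
  move=> uw vu; rewrite -(subrKC u v); apply: le_trans (ler_normD _ _) _.
  exact: lerD.
have x0 : (`|xc (gam 0%R)| <= m + l)%R by apply: tri xm _; rewrite distrC dx.
have y0 : (`|yc (gam 0%R)| <= m + l)%R by apply: tri ym _; rewrite distrC dy.
have xs s : s \in `[0%R, T] -> (`|xc (gam s)| <= m + 2 * l)%R.
  by move=> /dx /(tri _ _ _ x0); lra.
have ys s : s \in `[0%R, T] -> (`|yc (gam s)| <= m + 2 * l)%R.
  by move=> /dy /(tri _ _ _ y0); lra.
split => //; rewrite st// addrAC subrr add0r.
pose k := (2 * (m + 2 * l))%R.
have k0 : (0 <= k)%R.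
  by rewrite mulr_ge0// (le_trans _ (xs _ TT)).
have mh : measurable_fun `[0%R, T] h.
  have ma : measurable_fun `[0%R, T] a by apply/measurable_EFinP; exact: measurable_int ia.
  have mb : measurable_fun `[0%R, T] b by apply/measurable_EFinP; exact: measurable_int ib.
  apply: (measurableT_comp (f := @Num.sqrt R)).
    by apply: continuous_measurable_fun; exact: sqrt_continuous.
  by apply: measurable_funD; apply: measurable_funX.
apply: (@Rintegral_norm_le _ (line R) (leb R) _ `[0%R, T] _ (fun r => k * h r)%R) => //.
- by move=> r; rewrite mulr_ge0.
- move=> r rT; have rT' : r \in `[0%R, T] by [].
  apply: le_trans (ler_normD _ _) _; rewrite !normrM normrN.
  have -> : (k * h r = h r * (m + 2 * l) + h r * (m + 2 * l))%R by rewrite /k; ring.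
  by apply: lerD; apply: ler_pM => //; [exact: ys|exact: xs].
under eq_integral do rewrite EFinM.
rewrite ge0_integralZl//.
- by rewrite -/k (EFinM k); apply: lee_wpmul2l => //; rewrite lee_fin.
- exact/measurable_EFinP.
by move=> r _; rewrite lee_fin.
Qed.

Definition slab (a h : R) : set (space R) :=
  `[(- a)%R, a]%classic `*` `[(- a)%R, a]%classic `*` `[(- h)%R, h]%classic.

Lemma slabP a h p : slab a h p <->
  [/\ `|xc p| <= a, `|yc p| <= a & `|tc p| <= h]%R.
Proof.
rewrite /slab /xc /yc /tc !ler_norml; case: p => -[x y] t /=; rewrite !in_itv/=.
by split=> [[[]]|[]].
Qed.

Lemma measurable_slab a h : measurable (slab a h).
Proof. by apply: measurableX; [apply: measurableX|]; exact: measurable_itv. Qed.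

Lemma leb3_ext_slab a h : (0 <= a)%R -> (0 <= h)%R ->
  leb3_ext (slab a h) = (8 * a ^+ 2 * h)%:E.
Proof.
have sym c : (0 <= c)%R -> leb R `[(- c)%R, c] = (2 * c)%:E.
  move=> c0; rewrite lebesgue_measure_itv/= lte_fin; case: ltP => [_|].
    by rewrite -EFinB; congr EFin; ring.
  by move=> cc; congr EFin; lra.
move=> a0 h0; rewrite /leb3_ext [LHS](measurable_mu_extE (@leb3 R) (measurable_slab a h)).
have m1 := measurable_itv `[(- a)%R, a]; have m2 := measurable_itv `[(- h)%R, h].
transitivity (@leb2 R (`[(- a)%R, a] `*` `[(- a)%R, a]) * leb R `[(- h)%R, h]).
  exact: (@product_measure1E _ _ _ _ _ (@leb2 R) (leb R) _ _ (measurableX m1 m1) m2).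
rewrite (_ : leb2 _ = leb R `[(- a)%R, a] * leb R `[(- a)%R, a]).
  by rewrite !sym// -!EFinM; congr EFin; ring.
exact: (@product_measure1E _ _ _ _ _ (leb R) (leb R) _ _ m1 m1).
Qed.

Lemma enlargement_slab (m eps : R) : (0 < eps)%R ->
  enlargement eps (slab m (m ^+ 2)) `<=`
  slab (m + eps) (m ^+ 2 + 2 * (m + 2 * eps) * eps).
Proof.
move=> e0 p; rewrite /enlargement/= => /ereal_inf_lt[_ [q /slabP[xq yq tq] <-]].
move=> /ereal_inf_lt[_ [T [gam [a [b [hc g0 gT ->]]]]]] /ltW len.
rewrite -gT in xq yq tq.
have [x0 y0 t0] := horizontal_curve_bounds hc len xq yq.
rewrite -g0; apply/slabP; split => //.
rewrite -(subrKC (tc (gam T)) (tc (gam 0%R))); apply: le_trans (ler_normD _ _) _.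
by apply: lerD => //; rewrite distrC.
Qed.

(** The enlargement has measure at most 8 (m^2 + 3 m eps) (m^2 + 6 m eps), which exceeds 8 m^4 by 72
    m^3 eps + 144 m^2 eps^2; since eps < m, this is at most 216 m^3 eps. *)
Lemma slab_quotient_le (m eps : R) : (0 < eps < m)%R ->
  (leb3_ext (enlargement eps (slab m (m ^+ 2))) - leb3_ext (slab m (m ^+ 2))) *
    (eps^-1)%:E <= (216 * m ^+ 3)%:E.
Proof.
move=> /andP[e0 em]; have m0 : (0 < m)%R by exact: lt_trans em.
rewrite lee_pdivrMr// leeBlDr; last first.
  by rewrite leb3_ext_slab ?sqr_ge0 ?ltW.
apply: (@le_trans _ _ (leb3_ext (slab (m + eps) (m ^+ 2 + 2 * (m + 2 * eps) * eps)))).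
  by apply: le_mu_ext; exact: enlargement_slab.
rewrite !leb3_ext_slab ?sqr_ge0 ?addr_ge0 ?mulr_ge0 ?addr_ge0 ?sqr_ge0 ?(ltW m0) ?(ltW e0)//; last first.
  by rewrite mulr_ge0// ltW.
rewrite -EFinM -EFinD lee_fin.
have h1 : ((m + eps) ^+ 2 <= m ^+ 2 + 3 * m * eps)%R by nra.
have h2 : (m ^+ 2 + 2 * (m + 2 * eps) * eps <= m ^+ 2 + 6 * m * eps)%R by nra.
apply: (@le_trans _ _ (8 * (m ^+ 2 + 3 * m * eps) * (m ^+ 2 + 6 * m * eps))%R).
  apply: ler_pM => //.
  - by rewrite mulr_ge0// sqr_ge0.
  - by rewrite addr_ge0 ?sqr_ge0// !mulr_ge0 ?addr_ge0 ?mulr_ge0 ?ltW.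
  - by rewrite ler_wpM2l.
rewrite -subr_ge0.
have -> : (216 * m ^+ 3 * eps + 8 * m ^+ 2 * m ^+ 2 - 8 * (m ^+ 2 + 3 * m * eps) * (m ^+ 2 + 6 * m * eps) = 144 * (m ^+ 2 * eps) * (m - eps))%R by ring.
by rewrite mulr_ge0 ?subr_ge0 ?(ltW em)// mulr_ge0// mulr_ge0 ?sqr_ge0 ?ltW.
Qed.

(** The height m^2 makes the box the image of a fixed one under the dilation (x, y, t) -> (m x, m y,
    m^2 t), which accounts for the power m^3. *)
Lemma minkowski_content_slab_le (m : R) : (0 < m)%R ->
  minkowski_content (slab m (m ^+ 2)) <= (216 * m ^+ 3)%:E.
Proof.
move=> m0; rewrite /minkowski_content limf_einfE.
apply: ge_ereal_sup => _ [V V0 <-].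
(* The lower limit is a supremum over neighbourhoods V of infima, and every V contains some e below
   m. *)
have [e [Ve em]] : exists e : R, V e /\ (0 < e < m)%R.
  apply: (@filter_ex _ (0%R^'+ : set_system R)); near=> e; split; first by near: e.
  by apply/andP; split; near: e; [exact: nbhs_right_gt|exact: nbhs_right_lt].
apply: le_trans (slab_quotient_le em).
by apply: ereal_inf_lbound; exists e.
Unshelve. all: by end_near. Qed.

(** The box of half-width m has measure 8 m^4, so m is fixed by 8 m^4 = s. *)
Lemma profile_le (s : R) : (0 < s)%R ->
  isoperimetric_profile s <= ((216 * 8^-1 `^ (3 / 4)) * s `^ (3 / 4))%:E.
Proof.
move=> s0; pose m := ((8^-1 * s) `^ 4^-1)%R.
have x0 : (0 < 8^-1 * s)%R by rewrite mulr_gt0.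
have m0 : (0 < m)%R by rewrite powR_gt0.
have m4 : (m ^+ 4 = 8^-1 * s)%R.
  by rewrite -powR_mulrn ?ltW// -powRrM mulVf// powRr1// ltW.
have m3 : (m ^+ 3 = 8^-1 `^ (3 / 4) * s `^ (3 / 4))%R.
  by rewrite -powR_mulrn ?(ltW m0)// -powRrM (mulrC 4^-1)%R powRM// ltW.
rewrite -mulrA -m3; apply: le_trans (minkowski_content_slab_le m0).
have mS := measurable_slab m (m ^+ 2).
apply: ereal_inf_lbound; exists (slab m (m ^+ 2)) => //; split.
  exact: caratheodory_measurable_mu_ext.
rewrite leb3_ext_slab ?sqr_ge0 ?ltW//.
by rewrite -mulrA -exprD m4 mulVKf.
Qed.

Lemma profile_comparableT : profile_comparable R.
Proof.
exists (10^-1 `^ (3 / 4) / 2)%R, (216 * 8^-1 `^ (3 / 4))%R; split.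
- by rewrite divr_gt0// powR_gt0.
- by rewrite mulr_gt0// powR_gt0.
by move=> s /andP[s0 _]; split; [exact: profile_ge|exact: profile_le].
Qed.

End upper.

Theorem theorem6p4 (R : realType) :
  exists alpha : R, [/\ 0 < alpha, continuous_embedding alpha
    & continuous_embedding alpha <-> profile_comparable R].
Proof.
exists 1; split => //; first exact: embedding.
by split=> _; [exact: profile_comparableT|exact: embedding].
Qed.
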